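(* Let $d_c,d_r,q_c,q_r\ge 1$ be integers, $\nu>0$, and let $\mathbf{X}_1,\dots,\mathbf{X}_N\in\mathbb{R}^{d_c\times d_r}$ be i.i.d. observations from the tBFA model with parameters $\mathbf{W},\mathbf{C},\boldsymbol{\Psi}_c,\mathbf{R},\boldsymbol{\Psi}_r,\nu$ (defined in the context), and put $\boldsymbol{\Sigma}_c=\mathbf{C}\mathbf{C}'+\boldsymbol{\Psi}_c$, $\boldsymbol{\Sigma}_r=\mathbf{R}\mathbf{R}'+\boldsymbol{\Psi}_r$. Let $\boldsymbol{\Theta}=(\boldsymbol{\mu},\boldsymbol{\theta}_c,\boldsymbol{\theta}_r,\nu)$, where $\boldsymbol{\mu}=\mathrm{vec}(\mathbf{W})$, $\boldsymbol{\theta}_c=(\theta_c^i)_i$ lists the free scalar entries of $\mathbf{C}$ and the free diagonal entries of $\boldsymbol{\Psi}_c$, and $\boldsymbol{\theta}_r=(\theta_r^k)_k$ lists the free scalar entries of $\mathbf{R}$ and the free diagonal entries of $\boldsymbol{\Psi}_r$. Let $\mathbf{H}_n(\boldsymbol{\Theta}\mid\mathbf{X}_n)$ be the Hessian with respect to $\boldsymbol{\Theta}$ of $\ln p(\mathbf{X}_n)$. Then the Fisher information matrix $$\mathbf{I}_N(\boldsymbol{\Theta})=-\sum_{n=1}^N\mathbb{E}\left[\mathbf{H}_n(\boldsymbol{\Theta}\mid\mathbf{X}_n)\right]$$ has the block form $$\mathbf{I}_N(\boldsymbol{\Theta})=\begin{bmatrix}\mathbf{I}_N^{\boldsymbol{\mu}\boldsymbol{\mu}}&\mathbf{0}&\mathbf{0}&\mathbf{0}\\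 \mathbf{0}&\mathbf{I}_N^{\boldsymbol{\theta}_c\boldsymbol{\theta}_c}&\mathbf{I}_N^{\boldsymbol{\theta}_c\boldsymbol{\theta}_r}&\mathbf{I}_N^{\boldsymbol{\theta}_c\nu}\\ \mathbf{0}&\mathbf{I}_N^{\boldsymbol{\theta}_r\boldsymbol{\theta}_c}&\mathbf{I}_N^{\boldsymbol{\theta}_r\boldsymbol{\theta}_r}&\mathbf{I}_N^{\boldsymbol{\theta}_r\nu}\\ \mathbf{0}&\mathbf{I}_N^{\nu\boldsymbol{\theta}_c}&\mathbf{I}_N^{\nu\boldsymbol{\theta}_r}&\mathbf{I}_N^{\nu\nu}\end{bmatrix}$$ (a symmetric matrix), with $$\mathbf{I}_N^{\boldsymbol{\mu}\boldsymbol{\mu}}=N\frac{\nu+d_cd_r}{\nu+d_cd_r+2}\left(\boldsymbol{\Sigma}_r^{-1}\otimes\boldsymbol{\Sigma}_c^{-1}\right),$$ $$\mathbf{I}_N^{\nu\nu}=N\left\{\tfrac14\mathrm{TG}\left(\tfrac{\nu}{2}\right)-\tfrac14\mathrm{TG}\left(\tfrac{\nu+d_cd_r}{2}\right)-\frac{d_cd_r(\nu+d_cd_r+4)}{2\nu(\nu+d_cd_r)(\nu+d_cd_r+2)}\right\},$$ $$\mathbf{I}_N^{\theta_c^i\theta_c^j}=\frac{Nd_r}{2(\nu+d_cd_r+2)}\left\{(\nu+d_cd_r)\,\mathrm{tr}\left(\boldsymbol{\Sigma}_c^{-1}\dot{\boldsymbol{\Sigma}}_c^i\boldsymbol{\Sigma}_c^{-1}\dot{\boldsymbol{\Sigma}}_c^j\right)-d_r\,\mathrm{tr}\left(\boldsymbol{\Sigma}_c^{-1}\dot{\boldsymbol{\Sigma}}_c^i\right)\mathrm{tr}\left(\boldsymbol{\Sigma}_c^{-1}\dot{\boldsymbol{\Sigma}}_c^j\right)\right\},$$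 $$\mathbf{I}_N^{\theta_c^i\theta_r^k}=\frac{N}{2(\nu+d_cd_r+2)}\left\{(\nu+d_cd_r)\,\mathrm{tr}\left\{\left(\boldsymbol{\Sigma}_r^{-1}\dot{\boldsymbol{\Sigma}}_r^k\right)\otimes\left(\boldsymbol{\Sigma}_c^{-1}\dot{\boldsymbol{\Sigma}}_c^i\right)\right\}-d_cd_r\,\mathrm{tr}\left(\boldsymbol{\Sigma}_r^{-1}\dot{\boldsymbol{\Sigma}}_r^k\right)\mathrm{tr}\left(\boldsymbol{\Sigma}_c^{-1}\dot{\boldsymbol{\Sigma}}_c^i\right)\right\},$$ $$\mathbf{I}_N^{\theta_c^i\nu}=\frac{-Nd_r}{(\nu+d_cd_r)(\nu+d_cd_r+2)}\,\mathrm{tr}\left(\boldsymbol{\Sigma}_c^{-1}\dot{\boldsymbol{\Sigma}}_c^i\right),$$ $$\mathbf{I}_N^{\theta_r^k\theta_r^s}=\frac{Nd_c}{2(\nu+d_cd_r+2)}\left\{(\nu+d_cd_r)\,\mathrm{tr}\left(\boldsymbol{\Sigma}_r^{-1}\dot{\boldsymbol{\Sigma}}_r^k\boldsymbol{\Sigma}_r^{-1}\dot{\boldsymbol{\Sigma}}_r^s\right)-d_c\,\mathrm{tr}\left(\boldsymbol{\Sigma}_r^{-1}\dot{\boldsymbol{\Sigma}}_r^k\right)\mathrm{tr}\left(\boldsymbol{\Sigma}_r^{-1}\dot{\boldsymbol{\Sigma}}_r^s\right)\right\},$$ $$\mathbf{I}_N^{\theta_r^k\nu}=\frac{-Nd_c}{(\nu+d_cd_r)(\nu+d_cd_r+2)}\,\mathrm{tr}\left(\boldsymbol{\Sigma}_r^{-1}\dot{\boldsymbol{\Sigma}}_r^k\right).$$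 Here $\dot{\boldsymbol{\Sigma}}_c^i=\partial\boldsymbol{\Sigma}_c/\partial\theta_c^i$, which equals $\mathbf{C}(\partial\mathbf{C}'/\partial\theta_c^i)+(\partial\mathbf{C}/\partial\theta_c^i)\mathbf{C}'$ if $\theta_c^i$ is an entry of $\mathbf{C}$ and $\partial\boldsymbol{\Psi}_c/\partial\theta_c^i$ if $\theta_c^i$ is an entry of $\boldsymbol{\Psi}_c$; and $\dot{\boldsymbol{\Sigma}}_r^k=\partial\boldsymbol{\Sigma}_r/\partial\theta_r^k$, which equals $\mathbf{R}(\partial\mathbf{R}'/\partial\theta_r^k)+(\partial\mathbf{R}/\partial\theta_r^k)\mathbf{R}'$ if $\theta_r^k$ is an entry of $\mathbf{R}$ and $\partial\boldsymbol{\Psi}_r/\partial\theta_r^k$ if $\theta_r^k$ is an entry of $\boldsymbol{\Psi}_r$.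
   Context: Notation: $'$ is transpose, $\otimes$ the Kronecker product, $\mathrm{vec}$ column-stacking vectorization, $\mathrm{tr}$ the trace, $\Gamma$ the Gamma function, and $\mathrm{TG}(x)=d^2\ln\Gamma(x)/dx^2$ the trigamma function. $\mathcal{N}_{a,b}(\mathbf{M},\mathbf{U},\mathbf{V})$ is the matrix-variate normal distribution on $\mathbb{R}^{a\times b}$: $\mathbf{X}\sim\mathcal{N}_{a,b}(\mathbf{M},\mathbf{U},\mathbf{V})$ iff $\mathrm{vec}(\mathbf{X})\sim\mathcal{N}(\mathrm{vec}(\mathbf{M}),\mathbf{V}\otimes\mathbf{U})$. $\mathrm{Gam}(a,b)$ is the Gamma distribution with shape $a$ and rate $b$. tBFA model: with $\mathbf{W}\in\mathbb{R}^{d_c\times d_r}$, $\mathbf{C}\in\mathbb{R}^{d_c\times q_c}$, $\mathbf{R}\in\mathbb{R}^{d_r\times q_r}$, positive diagonal matrices $\boldsymbol{\Psi}_c\in\mathbb{R}^{d_c\times d_c}$, $\boldsymbol{\Psi}_r\in\mathbb{R}^{d_r\times d_r}$, and $\nu>0$, $$\mathbf{X}=\mathbf{C}\mathbf{Z}\mathbf{R}'+\mathbf{W}+\mathbf{C}\boldsymbol{\epsilon}_r+\boldsymbol{\epsilon}_c\mathbf{R}'+\boldsymbol{\epsilon},$$ where $\tau\sim\mathrm{Gam}(\nu/2,\nu/2)$ and, given $\tau$, the following are independent: $\mathbf{Z}\sim\mathcal{N}_{q_c,q_r}(\mathbf{0},\mathbf{I}/\tau,\mathbf{I})$, $\boldsymbol{\epsilon}_r\sim\mathcal{N}_{q_c,d_r}(\mathbf{0},\mathbf{I}/\tau,\boldsymbol{\Psi}_r)$,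 $\boldsymbol{\epsilon}_c\sim\mathcal{N}_{d_c,q_r}(\mathbf{0},\boldsymbol{\Psi}_c/\tau,\mathbf{I})$, $\boldsymbol{\epsilon}\sim\mathcal{N}_{d_c,d_r}(\mathbf{0},\boldsymbol{\Psi}_c/\tau,\boldsymbol{\Psi}_r)$. Under this model $\mathbf{X}$ has the matrix-variate $t$ distribution, i.e. $\mathrm{vec}(\mathbf{X})$ is multivariate $t$ with center $\mathrm{vec}(\mathbf{W})$, scale matrix $\boldsymbol{\Sigma}_r\otimes\boldsymbol{\Sigma}_c$ and $\nu$ degrees of freedom, with density $$p(\mathbf{X})=\frac{|\boldsymbol{\Sigma}_c|^{-d_r/2}|\boldsymbol{\Sigma}_r|^{-d_c/2}\,\Gamma\left(\frac{\nu+d_cd_r}{2}\right)}{(\pi\nu)^{d_cd_r/2}\,\Gamma\left(\frac{\nu}{2}\right)}\left(1+\frac1\nu\mathrm{tr}\left\{\boldsymbol{\Sigma}_c^{-1}(\mathbf{X}-\mathbf{W})\boldsymbol{\Sigma}_r^{-1}(\mathbf{X}-\mathbf{W})'\right\}\right)^{-\frac{\nu+d_cd_r}{2}}.$$ Expectations are taken under the model at the same parameter value at which the Hessian is evaluated. Entries of $\mathbf{C},\boldsymbol{\Psi}_c,\mathbf{R},\boldsymbol{\Psi}_r$ that are not free parameters (e.g. entries fixed by identifiability constraints) are held constant; each of $\partial\mathbf{C}/\partial\theta_c^i$, $\partial\boldsymbol{\Psi}_c/\partial\theta_c^i$, $\partial\mathbf{R}/\partial\theta_r^k$, $\partial\boldsymbol{\Psi}_r/\partial\theta_r^k$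 is a 0-1 matrix. *)

(* Defs.v *)
From HB Require Import structures.
From mathcomp Require Import all_boot all_order all_algebra.
From mathcomp Require Import all_classical all_reals all_analysis.
From mathcomp Require Export mxtens.

Set Implicit Arguments.
Unset Strict Implicit.
Unset Printing Implicit Defensive.

Import Order.TTheory GRing.Theory Num.Theory.
Import numFieldNormedType.Exports.

Local Open Scope classical_set_scope.
Local Open Scope ring_scope.

(* Column-stacking vectorization.  Entry (j, i) of [vec A], in the index order
   of the Kronecker product [*t], is [A i j], so that
   vec (A X B') = (B *t A) vec X. *)
Definition vec (T : Type) (a b : nat) (A : 'M[T]_(a, b)) : 'cV[T]_(b * a) :=
  \col_k A (mxtens_unindex k).2 (mxtens_unindex k).1.

Definition unvec (T : Type) (a b : nat) (v : 'cV[T]_(b * a)) : 'M[T]_(a, b) :=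
  \matrix_(i, j) v (mxtens_index (j, i)) 0.

Definition Gamma (K : realType) (x : K) : K :=
  \int[lebesgue_measure]_(t in `]0, +oo[) (t `^ (x - 1) * expR (- t)).

Definition TG (K : realType) (x : K) : K := derive1n 2 (fun y => ln (Gamma y)) x.

(* Matrices with their Borel sigma-algebra. *)
Definition borel_mx (K : realType) (a b : nat) :=
  g_sigma_algebraType (@open 'M[K]_(a, b)).
HB.instance Definition _ (K : realType) (a b : nat) :=
  Measurable.on (borel_mx K a b).

Definition gamma_pdf (K : realType) (a b t : K) : K :=
  if 0 < t then b `^ a / Gamma a * t `^ (a - 1) * expR (- (b * t)) else 0.

Definition is_gamma (K : realType) (a b : K) (mu : set K -> \bar K) : Prop :=
  forall B : set K, measurable B ->
    mu B = (\int[lebesgue_measure]_(t in B) (gamma_pdf a b t)%:E)%E.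

(* Univariate normal law with mean [m] and variance [v]; [normal_prob] takes
   the standard deviation and is not meaningful at 0. *)
Definition normal_law (K : realType) (m v : K) (B : set K) : \bar K :=
  if v == 0 then \d_m B else normal_prob m (Num.sqrt v) B.

(* [mu] is N(m, S): every linear functional a'x is univariate normal with mean
   a'm and variance a'Sa. *)
Definition is_mvnormal (K : realType) (k : nat) (m : 'cV[K]_k) (S : 'M[K]_k)
    (mu : set 'cV[K]_k -> \bar K) : Prop :=
  forall (a : 'cV[K]_k) (B : set K), measurable B ->
    mu [set x | B ((a^T *m x) 0 0)] =
    normal_law ((a^T *m m) 0 0) ((a^T *m S *m a) 0 0) B.

Definition is_matrix_normal (K : realType) (a b : nat) (M : 'M[K]_(a, b))
    (U : 'M[K]_a) (V : 'M[K]_b) (mu : set 'M[K]_(a, b) -> \bar K) : Prop :=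
  is_mvnormal (vec M) (V *t U) (fun B => mu (@vec K a b @^-1` B)).

Definition pos_diag (K : realType) (k : nat) (A : 'M[K]_k) : Prop :=
  is_diag_mx A /\ forall i, 0 < A i i.

(* The conditional laws given tau are regular conditional distributions, i.e.
   probability kernels; only their values at t > 0 matter. The product under
   the integral expresses conditional independence given tau. *)
Definition tBFA (K : realType) (d : measure_display) (Om : measurableType d)
    (P : probability Om K) (dc dr qc qr : nat) (W : 'M[K]_(dc, dr))
    (C : 'M[K]_(dc, qc)) (Psic : 'M[K]_dc) (R : 'M[K]_(dr, qr))
    (Psir : 'M[K]_dr) (nu : K) (X : Om -> 'M[K]_(dc, dr)) : Prop :=
  exists (tau : {mfun Om >-> K})
    (Z : {mfun Om >-> borel_mx K qc qr}) (epsr : {mfun Om >-> borel_mx K qc dr})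
    (epsc : {mfun Om >-> borel_mx K dc qr}) (eps : {mfun Om >-> borel_mx K dc dr})
    (kZ : K.-pker K ~> borel_mx K qc qr) (kr : K.-pker K ~> borel_mx K qc dr)
    (kc : K.-pker K ~> borel_mx K dc qr) (ke : K.-pker K ~> borel_mx K dc dr),
  [/\ is_gamma (nu / 2) (nu / 2) (distribution P tau),
      (forall B0 B1 B2 B3 B4, measurable B0 -> measurable B1 ->
         measurable B2 -> measurable B3 -> measurable B4 ->
         P (tau @^-1` B0 `&` Z @^-1` B1 `&` epsr @^-1` B2 `&`
            epsc @^-1` B3 `&` eps @^-1` B4) =
         (\int[distribution P tau]_(t in B0)
            (kZ t B1 * kr t B2 * kc t B3 * ke t B4))%E),
      (forall t : K, 0 < t ->
         [/\ is_matrix_normal 0 (t^-1)%:M 1%:M (kZ t),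
             is_matrix_normal 0 (t^-1)%:M Psir (kr t),
             is_matrix_normal 0 (t^-1 *: Psic) 1%:M (kc t) &
             is_matrix_normal 0 (t^-1 *: Psic) Psir (ke t)]) &
      (forall w, X w = C *m (Z w : 'M[K]_(qc, qr)) *m R^T + W
                       + C *m (epsr w : 'M[K]_(qc, dr))
                       + (epsc w : 'M[K]_(dc, qr)) *m R^T + (eps w : 'M[K]_(dc, dr)))].

(* For a family indexed by the finite type 'I_N the product rule over the whole
   index set implies the one over subfamilies (take the other B n full). *)
Definition mutually_independent (K : realType) (d d' : measure_display)
    (Om : measurableType d) (T : measurableType d') (P : probability Om K)
    (N : nat) (X : 'I_N -> Om -> T) : Prop :=
  forall B : 'I_N -> set T, (forall n, measurable (B n)) ->
    P (\bigcap_n (X n @^-1` B n)) = (\prod_(n < N) P (X n @^-1` B n))%E.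

(* Density of the matrix-variate t distribution. *)
Definition mt_pdf (K : realType) (dc dr : nat) (W : 'M[K]_(dc, dr))
    (Sc : 'M[K]_dc) (Sr : 'M[K]_dr) (nu : K) (x : 'M[K]_(dc, dr)) : K :=
  let p := (dc * dr)%:R in
  (\det Sc `^ (- (dr%:R / 2)) * \det Sr `^ (- (dc%:R / 2))
     * Gamma ((nu + p) / 2))
  / ((pi * nu) `^ (p / 2) * Gamma (nu / 2))
  * (1 + nu^-1 * \tr (invmx Sc *m (x - W) *m invmx Sr *m (x - W)^T))
      `^ (- ((nu + p) / 2)).

(* A free parameter of one side of the model is named by [inl (a, b)], the
   entry (a, b) of the loading matrix, or by [inr a], the a-th diagonal entry of
   the noise matrix.  A list of free parameters is an (injective) function
   [free]; [loading_at] and [noise_at] replace the free entries by the values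
   in [th] and keep the other entries of [L] and [Psi] fixed. *)
Definition par_coord (d q : nat) : Type := ('I_d * 'I_q + 'I_d)%type.

Definition free_values (K : realType) (d q n : nat) (L : 'M[K]_(d, q))
    (Psi : 'M[K]_d) (free : 'I_n -> par_coord d q) : 'cV[K]_n :=
  \col_i match free i with inl ab => L ab.1 ab.2 | inr a => Psi a a end.

Definition loading_at (K : realType) (d q n : nat) (L : 'M[K]_(d, q))
    (free : 'I_n -> par_coord d q) (th : 'cV[K]_n) : 'M[K]_(d, q) :=
  \matrix_(a, b) if [pick i | free i == inl (a, b)] is Some i
                 then th i 0 else L a b.

Definition noise_at (K : realType) (d q n : nat) (Psi : 'M[K]_d)
    (free : 'I_n -> par_coord d q) (th : 'cV[K]_n) : 'M[K]_d :=
  \matrix_(a, b) if [pick i | (a == b) && (free i == inr a)] is Some i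
                 then th i 0 else Psi a b.

Definition scale_at (K : realType) (d q n : nat) (L : 'M[K]_(d, q))
    (Psi : 'M[K]_d) (free : 'I_n -> par_coord d q) (th : 'cV[K]_n) : 'M[K]_d :=
  loading_at L free th *m (loading_at L free th)^T + noise_at Psi free th.

Definition Theta_of (K : realType) (m nc nr : nat) (mu : 'cV[K]_m)
    (thc : 'cV[K]_nc) (thr : 'cV[K]_nr) (nu : K) :
    'cV[K]_(m + (nc + (nr + 1))) :=
  col_mx mu (col_mx thc (col_mx thr nu%:M)).

Definition log_pdf (K : realType) (dc dr qc qr nc nr : nat)
    (C : 'M[K]_(dc, qc)) (Psic : 'M[K]_dc) (freec : 'I_nc -> par_coord dc qc)
    (R : 'M[K]_(dr, qr)) (Psir : 'M[K]_dr) (freer : 'I_nr -> par_coord dr qr)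
    (x : 'M[K]_(dc, dr)) (Theta : 'cV[K]_(dr * dc + (nc + (nr + 1)))) : K :=
  let mu := usubmx Theta in
  let thc := usubmx (dsubmx Theta) in
  let thr := usubmx (dsubmx (dsubmx Theta)) in
  let nu := dsubmx (dsubmx (dsubmx Theta)) 0 0 in
  ln (mt_pdf (unvec mu) (scale_at C Psic freec thc)
        (scale_at R Psir freer thr) nu x).

Definition partial (K : realType) (n : nat) (V : normedModType K)
    (f : 'cV[K]_n -> V) (i : 'I_n) (x : 'cV[K]_n) : V :=
  'D_(delta_mx i 0) f x.

Definition hessian (K : realType) (n : nat) (f : 'cV[K]_n -> K)
    (x : 'cV[K]_n) : 'M[K]_n :=
  \matrix_(i, j) partial (partial f j) i x.

(* ['D_v] is a total operator: this says that all the derivatives occurring in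
   [hessian f x] exist. *)
Definition has_hessian (K : realType) (n : nat) (f : 'cV[K]_n -> K)
    (x : 'cV[K]_n) : Prop :=
  forall i j : 'I_n,
    (\forall y \near x, derivable f y (delta_mx j 0)) /\
    derivable (partial f j) x (delta_mx i 0).

Definition mx_expectation (K : realType) (d : measure_display)
    (Om : measurableType d) (P : probability Om K) (a b : nat)
    (H : Om -> 'M[K]_(a, b)) : 'M[K]_(a, b) :=
  \matrix_(i, j) fine ('E_P[fun w => H w i j])%E.

Definition mx_integrable (K : realType) (d : measure_display)
    (Om : measurableType d) (P : probability Om K) (a b : nat)
    (H : Om -> 'M[K]_(a, b)) : Prop :=
  forall i j, P.-integrable setT (fun w => (H w i j)%:E).

(* Main.v *)
Require Import Defs.
From HB Require Import structures.
From mathcomp Require Import fingroup perm.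
From mathcomp Require Import all_boot all_order all_algebra.
From mathcomp Require Import all_classical all_reals all_analysis.
From mathcomp Require Import measurable_realfun simple_functions.
From mathcomp Require Import measurable_fun_approximation mxtens ring lra.

Set Implicit Arguments.
Unset Strict Implicit.
Unset Printing Implicit Defensive.

Import Order.TTheory GRing.Theory Num.Theory.
Import numFieldNormedType.Exports.
Import HBNNSimple.

Local Open Scope classical_set_scope.
Local Open Scope ring_scope.

(* The law of vec X is multivariate t with location vec W, scale S = Sr (x) Sc
   and nu degrees of freedom.  Put e = vec (X - W), T S T' = 1 and z = T e.  The
   second derivatives of the log-density are combinations of quadratics in z
   divided by nu + |z|^2 and of products of two quadratics divided by
   (nu + |z|^2)^2.
   The moments of these ratios come from the model as follows.  Conditioning on
   tau gives E cos(b.z) = E exp (- |b|^2 / (2 tau)) and E sin(b.z) = 0.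
   Averaging over an independent Gaussian shift of b turns this into a formula
   for E [cos(b.z) exp (- u |z|^2 / 2)], and letting b tend to 0 yields the
   moments of b.z weighted by exp (- u |z|^2 / 2).  Finally
   1 / (nu + |z|^2) = 1/2 \int_0^oo exp (- u (nu + |z|^2) / 2) du, so integrating
   over u against the Gamma law of tau gives E [(b.z)^2 / (nu + |z|^2)] and
   E [(b.z)^4 / (nu + |z|^2)^2]; polarization does the rest.  The second
   derivatives of S cancel in the expectation. *)

(** * Functionals given by integrals *)

(** The hypotheses give no joint density: a matrix normal law is specified only through its linear
    functionals, and conditional independence only as a product rule for events. Characteristic
    functions of linear functionals are the natural entry point, but |z|^2, which sits in every
    denominator, is not linear. Randomizing b removes this obstacle: a Gaussian shift g of one
    coordinate b_k multiplies cos(b.z) by the characteristic function of g at z_k, that is by exp(-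
    u z_k^2 / 2), while the other side stays an explicit Gaussian integral. No inversion or
    uniqueness theorem for characteristic functions enters. The weight exp(- u |z|^2 / 2) also
    bounds every polynomial in z, so that moments up to order four come out by bounded convergence
    from finite combinations of sines and cosines, although z itself may have infinite moments when
    nu is small. The second derivatives of S cancel because E [z'Kz / (nu + |z|^2)] = tr K / (nu +
    p): multiplied by (nu + p) / 2, this offsets the trace coming from the log-determinant. *)

Definition integral_like (K : realType) (d : measure_display) (T : measurableType d)
    (L : (T -> \bar K) -> \bar K) : Prop :=
  [/\ forall f g : T -> \bar K, measurable_fun setT f -> measurable_fun setT g ->
        (forall x, 0 <= f x)%E -> (forall x, 0 <= g x)%E ->
        L (fun x => f x + g x)%E = (L f + L g)%E,
      forall (r : K) (f : T -> \bar K), measurable_fun setT f -> 0 <= r ->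
        (forall x, 0 <= f x)%E -> L (fun x => r%:E * f x)%E = (r%:E * L f)%E &
      forall (g : (T -> \bar K)^nat) (f : T -> \bar K), (forall n, measurable_fun setT (g n)) ->
        measurable_fun setT f ->
        (forall n x, 0 <= g n x)%E ->
        (forall x, {homo g ^~ x : m n / (m <= n)%N >-> (m <= n)%E}) ->
        (forall x, g ^~ x @ \oo --> f x) -> L \o g @ \oo --> L f].

(** Additivity and homogeneity carry the agreement from indicators to simple functions, and monotone
    continuity carries it to the limit of [nnsfun_approx]. Mixtures over kernels can then be
    compared with ordinary integrals by looking at measurable sets only. *)
Lemma integral_like_ext (K : realType) (d : measure_display) (T : measurableType d)
    (L1 L2 : (T -> \bar K) -> \bar K) :
  integral_like L1 -> integral_like L2 ->
  (forall A, measurable A -> L1 (fun x => (\1_A x)%:E) = L2 (fun x => (\1_A x)%:E)) ->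
  forall f : T -> \bar K, measurable_fun setT f -> (forall x, 0 <= f x)%E -> L1 f = L2 f.
Proof.
move=> iL1 iL2 L12 f mf f0.
have simple (g : {nnsfun T >-> K}) : L1 (EFin \o g) = L2 (EFin \o g).
  have gE : EFin \o g = fun x =>
     (\sum_(r <- finmap.enum_fset (fset_set (range g))) (r%:E * (\1_(g @^-1` [set r]) x)%:E))%E.
    apply/funext => x /=; rewrite fimfunE -fsumEFin// fsbig_finite//=.
  rewrite gE.
  have r0 r : r \in finmap.enum_fset (fset_set (range g)) -> 0 <= r.
    by rewrite in_fset_set// inE => -[x _ <-].
  elim: (finmap.enum_fset _) r0 => [_|r s IH r0].
    (* The empty sum is written as a multiple of a nonnegative function, since the value at 0 is
       contained in homogeneity. *)
    have -> : (fun x => \sum_(r <- [::]) (r%:E * (\1_(g @^-1` [set r]) x)%:E))%E =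
              (fun x => 0%:E * cst 0 x)%E.
      by apply/funext => x; rewrite big_nil mul0e.
    by case: iL1 => _ -> // _; case: iL2 => _ -> // _; rewrite !mul0e.
  have mi r' : measurable_fun [set: T] (fun x => (r'%:E * (\1_(g @^-1` [set r']) x)%:E)%E).
    apply/measurable_EFinP; apply: measurable_funM => //.
  have -> : (fun x => \sum_(r' <- (r :: s)%SEQ) (r'%:E * (\1_(g @^-1` [set r']) x)%:E))%E =
     (fun x => r%:E * (\1_(g @^-1` [set r]) x)%:E + \sum_(r <- s) (r%:E * (\1_(g @^-1` [set r]) x)%:E))%E.
    by apply/funext => x; rewrite big_cons.
  have pr : 0 <= r by apply: r0; rewrite inE eqxx.
  have ms : measurable_fun setT (fun x => \sum_(r <- s) (r%:E * (\1_(g @^-1` [set r]) x)%:E))%E.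
    by apply: emeasurable_sum.
  have ps x : (0 <= \sum_(r <- s) (r%:E * (\1_(g @^-1` [set r]) x)%:E))%E.
    rewrite big_seq; apply: sume_ge0 => r' r's; rewrite -EFinM lee_fin mulr_ge0//.
    by apply: r0; rewrite inE r's orbT.
  have pr' x : (0 <= r%:E * (\1_(g @^-1` [set r]) x)%:E)%E.
    by rewrite -EFinM lee_fin mulr_ge0.
  have IH' : L1 (fun x => \sum_(r <- s) (r%:E * (\1_(g @^-1` [set r]) x)%:E))%E =
             L2 (fun x => \sum_(r <- s) (r%:E * (\1_(g @^-1` [set r]) x)%:E))%E.
    by apply: IH => r' r's; apply: r0; rewrite inE r's orbT.
  case: iL1 => -> // L1Z _; case: iL2 => -> // L2Z _; rewrite IH'.
  by rewrite L1Z ?L2Z ?L12//; (try by apply/measurable_EFinP); move=> x; rewrite lee_fin.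
pose h := nnsfun_approx measurableT mf.
have mh n : measurable_fun setT (EFin \o h n) by apply/measurable_EFinP.
have h0 n x : (0 <= (EFin \o h n) x)%E by rewrite lee_fin.
have ndh x : {homo (fun n => (EFin \o h n) x) : m n / (m <= n)%N >-> (m <= n)%E}.
  by move=> m n mn; rewrite lee_fin; exact/lefP/nd_nnsfun_approx.
have ch x : (fun n => (EFin \o h n) x) @ \oo --> f x by exact: cvg_nnsfun_approx.
case: iL1 => _ _ /(_ _ _ mh mf h0 ndh ch) c1.
case: iL2 => _ _ /(_ _ _ mh mf h0 ndh ch) c2.
move/cvg_lim: c1 => <-//; move/cvg_lim: c2 => <-//.
by congr (limn _); apply/funext => n /=; exact: simple.
Qed.

(** Nonnegativity keeps the sum of the two limits away from +oo - oo and lets scalars distribute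
    over the sum. *)
Lemma integral_likeD (K : realType) (d : measure_display) (T : measurableType d)
    (L1 L2 : (T -> \bar K) -> \bar K) :
  integral_like L1 -> integral_like L2 ->
  (forall f : T -> \bar K, (forall x, 0 <= f x)%E -> (0 <= L1 f)%E) ->
  (forall f : T -> \bar K, (forall x, 0 <= f x)%E -> (0 <= L2 f)%E) ->
  integral_like (fun f => (L1 f + L2 f)%E).
Proof.
move=> [D1 Z1 C1] [D2 Z2 C2] p1 p2; split.
- by move=> f g mf mg f0 g0; rewrite D1// D2// addeACA.
- by move=> r f mf r0 f0; rewrite Z1// Z2// ge0_muleDr// ?p1// p2.
- move=> g f mg mf g0 nd c; apply: cvgeD; last 2 first.
  + exact: C1.
  + exact: C2.
  + apply: ge0_adde_def; rewrite inE.
      apply: p1 => x; move/cvg_lim: (c x) => <-//; apply: lime_ge => //.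
        by apply/cvg_ex; exists (f x).
      by apply: nearW => n; exact: g0.
    apply: p2 => x; move/cvg_lim: (c x) => <-//; apply: lime_ge => //.
      by apply/cvg_ex; exists (f x).
    by apply: nearW => n; exact: g0.
Qed.

(** Monotone continuity is used at two levels: inside each [L t], where it is assumed, and for the
    mixing integral, where it is monotone convergence along the increasing sequence [L t (g n)]. *)
Lemma integral_like_mix (K : realType) (d d' : measure_display)
    (T : measurableType d) (T' : measurableType d')
    (mu : {measure set T' -> \bar K}) (D : set T') (w : T' -> \bar K)
    (L : T' -> (T -> \bar K) -> \bar K) :
  measurable D -> measurable_fun D w -> (forall x, 0 <= w x)%E ->
  (forall t, integral_like (L t)) ->
  (forall f : T -> \bar K, measurable_fun setT f -> (forall x, 0 <= f x)%E ->
     measurable_fun D (L ^~ f)) ->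
  (forall (f : T -> \bar K) t, (forall x, 0 <= f x)%E -> (0 <= L t f)%E) ->
  (forall (f g : T -> \bar K) t, measurable_fun setT f -> measurable_fun setT g ->
     (forall x, 0 <= f x)%E -> (forall x, f x <= g x)%E -> (L t f <= L t g)%E) ->
  integral_like (fun f => \int[mu]_(t in D) (w t * L t f))%E.
Proof.
move=> mD mw w0 iL mL L0 leL.
have mf' (f : T -> \bar K) : measurable_fun setT f -> (forall x, 0 <= f x)%E ->
    measurable_fun D (fun t => w t * L t f)%E.
  by move=> mf f0; apply: emeasurable_funM => //; exact: mL.
split.
- move=> f g mf mg f0 g0.
  rewrite -ge0_integralD//; last 4 first.
  + by move=> x _; rewrite mule_ge0// L0.
  + exact: mf'.
  + by move=> x _; rewrite mule_ge0// L0.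
  + exact: mf'.
  apply: eq_integral => t _; have [-> // _ _] := iL t.
  by rewrite ge0_muleDr// L0.
- move=> r f mf r0 f0; rewrite -ge0_integralZl//; last 2 first.
  + exact: mf'.
  + by move=> x _; rewrite mule_ge0// L0.
  by apply: eq_integral => t _; have [_ -> // _] := iL t; rewrite muleCA.
- move=> g f mg mf g0 nd c.
  have f0 x : (0 <= f x)%E.
    move/cvg_lim: (c x) => <-//; apply: lime_ge => //.
      by apply/cvg_ex; exists (f x).
    by apply: nearW => n; exact: g0.
  have cL t : (fun n => L t (g n)) @ \oo --> L t f by have [_ _] := iL t; exact.
  have ndL t : {homo (fun n => L t (g n)) : m n / (m <= n)%N >-> (m <= n)%E}.
    by move=> m n mn; apply: leL => // x; exact: nd.
  have -> : (\int[mu]_(t in D) (w t * L t f) =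
      \int[mu]_(t in D) limn (fun n => w t * L t (g n)))%E.
    apply: eq_integral => t _; apply/esym/cvg_lim => //.
    (* An infinite weight makes every product 0 or +oo; the limit is then decided by whether
       [L t (g n)] is eventually positive. *)
    have := w0 t; case: (w t) => [r|_|//]; last first.
      have [f00|fne] := eqVneq (L t f) 0%E.
        have gz n : L t (g n) = 0%E.
          apply/eqP; rewrite eq_le L0// andbT -f00.
          rewrite -(cvg_lim _ (cL t))//.
          rewrite (cvg_lim _ (ereal_nondecreasing_cvgn (ndL t)))//.
          by apply: ereal_sup_ubound; exists n.
        rewrite f00 mule0; under eq_fun do rewrite gz mule0; exact: cvg_cst.
      have fp : (0 < L t f)%E by rewrite lt0e fne L0.
      rewrite gt0_mulye//.
      have : \forall n \near \oo, (0 < L t (g n))%E.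
        have := fp; rewrite -(cvg_lim _ (cL t))//.
        rewrite (cvg_lim _ (ereal_nondecreasing_cvgn (ndL t)))//.
        move=> /ereal_sup_gt[_ [m _ <-]] gm0.
        by exists m => // n /= mn; apply: lt_le_trans gm0 _; exact: ndL.
      move=> H; apply: (@cvg_trans _ (cst +oo%E @ \oo)); last exact: cvg_cst.
      apply: near_eq_cvg; near=> n; rewrite gt0_mulye//=.
      by near: n.
    by move=> _; apply: cvgeZl => //.
  apply: cvg_monotone_convergence => //.
  + by move=> n; apply: mf'.
  + by move=> n x _; rewrite mule_ge0// L0.
  + by move=> x _ m n mn; apply: lee_wpmul2l => //; exact: ndL.
Unshelve. all: by end_near. Qed.

Lemma integral_like_comp (K : realType) (d d' : measure_display)
    (T : measurableType d) (T' : measurableType d')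
    (mu : {measure set T' -> \bar K}) (D : set T') (w : T' -> \bar K) (phi : T' -> T) :
  measurable D -> measurable_fun D w -> (forall x, 0 <= w x)%E ->
  measurable_fun setT phi ->
  integral_like (fun f => \int[mu]_(x in D) (w x * f (phi x)))%E.
Proof.
move=> mD mw w0 mphi.
apply: (@integral_like_mix _ _ _ _ _ mu D w (fun t f => f (phi t))) => //.
- by move=> t; split => // g f _ _ _ _ c; exact: c.
- by move=> f mf f0; apply: measurable_funTS; exact: measurableT_comp.
Qed.

Lemma integral_like_integral (K : realType) (d : measure_display)
    (T : measurableType d) (mu : {measure set T -> \bar K}) :
  integral_like (fun f => \int[mu]_x f x)%E.
Proof.
split.
- by move=> f g mf mg f0 g0; rewrite ge0_integralD.
- by move=> r f mf r0 f0; rewrite ge0_integralZl.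
- move=> g f mg mf g0 nd c.
  have -> : (\int[mu]_x f x = \int[mu]_x limn (fun n => g n x))%E.
    by apply: eq_integral => t _; apply/esym/cvg_lim => //; exact: c.
  by apply: cvg_monotone_convergence => //; move=> x _ m n mn; exact: nd.
Qed.

Lemma integral_like_kernel (K : realType) (d d' : measure_display)
    (T : measurableType d) (T' : measurableType d')
    (mu : {measure set T' -> \bar K}) (D : set T') (w : T' -> \bar K)
    (k : K.-pker T' ~> T) :
  measurable D -> measurable_fun D w -> (forall x, 0 <= w x)%E ->
  integral_like (fun f => \int[mu]_(t in D) (w t * \int[k t]_x f x))%E.
Proof.
move=> mD mw w0.
apply: (@integral_like_mix _ _ _ _ _ mu D w (fun t f => \int[k t]_x f x)%E) => //.
- by move=> t; exact: integral_like_integral.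
- move=> f mf f0; apply: measurable_funTS.
  by apply: measurable_fun_integral_kernel => // U mU; exact: measurable_kernel.
- by move=> f t f0; exact: integral_ge0.
- by move=> f g t mf mg f0 fg; apply: ge0_le_integral.
Qed.

Lemma ge0_integral_density (K : realType) (d d' : measure_display)
    (T : measurableType d) (T' : measurableType d') (mu : {measure set T -> \bar K})
    (nu : {measure set T' -> \bar K}) (phi : T' -> T) (p : T' -> \bar K) :
  measurable_fun setT phi -> measurable_fun setT p -> (forall x, 0 <= p x)%E ->
  (forall B, measurable B -> mu B = \int[nu]_(x in phi @^-1` B) p x)%E ->
  forall f : T -> \bar K, measurable_fun setT f -> (forall x, 0 <= f x)%E ->
  (\int[mu]_x f x = \int[nu]_x (p x * f (phi x)))%E.
Proof.
move=> mphi mp p0 mup; apply: integral_like_ext.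
- exact: integral_like_integral.
- exact: integral_like_comp.
- move=> A mA; rewrite integral_indic// setIT mup// integral_mkcond.
  by apply: eq_integral => x _; rewrite epatch_indic.
Qed.

Lemma bounded_integrable (K : realType) (d : measure_display) (T : measurableType d)
    (mu : {measure set T -> \bar K}) (D : set T) (f : T -> K) (M : K) :
  mu setT = 1%E -> measurable D -> measurable_fun D f -> (forall x, `|f x| <= M) ->
  mu.-integrable D (EFin \o f).
Proof.
move=> mu1 mD mf fM; apply: measurable_bounded_integrable => //.
  by apply: (@le_lt_trans _ _ (mu setT)); [apply: le_measure; rewrite ?inE|rewrite mu1 ltry].
exists M; split; rewrite ?num_real // => x Mx y _ /=.
by rewrite (le_trans (fM y))// ltW.
Qed.

Lemma Rintegral_EFin (K : realType) (d : measure_display) (T : measurableType d)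
    (mu : {measure set T -> \bar K}) (D : set T) (f : T -> K) :
  measurable D -> mu.-integrable D (EFin \o f) ->
  (\int[mu]_(x in D) (f x)%:E)%E = (\int[mu]_(x in D) f x)%:E.
Proof. by move=> mD intf; rewrite /Rintegral fineK// integrable_fin_num. Qed.

Lemma le1_Rintegral (K : realType) (d : measure_display) (T : measurableType d)
    (mu : {measure set T -> \bar K}) (f : T -> K) (M : K) :
  mu setT = 1%E -> measurable_fun setT f -> (forall x, `|f x| <= M) -> `|\int[mu]_x f x| <= M.
Proof.
move=> mu1 mf fM; have intf := bounded_integrable mu1 measurableT mf fM.
apply: le_trans (le_normr_Rintegral measurableT intf) _.
rewrite -[leRHS]mulr1 -[1]/(fine 1%E) -mu1.
rewrite -Rintegral_cst//; apply: le_Rintegral => //.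
- apply: (bounded_integrable mu1 _ _ (M := M)) => //.
    exact: measurableT_comp.
  by move=> x; rewrite normr_id.
- by apply: (bounded_integrable mu1 _ _ (M := `|M|)).
Qed.

(** Moves subtracted terms to the other side, so that identities between signed integrals become
    equalities of sums of nonnegative ones, the setting of [integral_like_ext]. *)
Lemma EFin_subr_eq (K : realType) (a b c d : K) :
  a - b = c - d <-> (a%:E + d%:E = b%:E + c%:E)%E.
Proof. by rewrite -!EFinD; split => [|[]] E; [congr (_%:E); lra|lra]. Qed.

(** [W] and [W'] change sign, so neither side is a nonnegative functional of f. Once both are split
    into positive and negative parts and the negative parts are moved across, [integral_like_ext]
    applies to nonnegative f; a bounded f is then reached through the nonnegative functions f + M
    and M. *)
Lemma kernel_ext (K : realType) (d d1 d2 : measure_display)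
    (Om : measurableType d) (T : measurableType d1) (T' : measurableType d2)
    (P : probability Om K) (m : probability T' K) (D : set T') (k : K.-pker T' ~> T)
    (Z : Om -> T) (W : Om -> K) (W' : T' -> K) (f : T -> K) (M : K) :
  measurable D -> measurable_fun setT Z ->
  measurable_fun setT W -> measurable_fun setT W' -> measurable_fun setT f ->
  (forall w, `|W w| <= 1) -> (forall t, `|W' t| <= 1) -> (forall x, `|f x| <= M) ->
  (forall B, measurable B -> \int[P]_w (W w * \1_B (Z w)) =
     \int[m]_(t in D) (W' t * fine (k t B))) ->
  \int[P]_w (W w * f (Z w)) = \int[m]_(t in D) (W' t * \int[k t]_x f x).
Proof.
move=> mD mZ mW mW' mf W1 W'1 fM WE.
have max1 (x : K) : `|x| <= 1 -> `|Num.max x 0| <= 1.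
  by move=> x1; rewrite ger0_norm ?le_max ?lexx ?orbT// ge_max ler01 andbT (le_trans _ x1)// ler_norm.
have maxB (x : K) : Num.max x 0 - Num.max (- x) 0 = x.
  by case: (leP x 0) => x0; case: (leP (- x) 0) => x0'; lra.
pose Wp w : K := Num.max (W w) 0; pose Wm w : K := Num.max (- W w) 0.
pose W'p w : K := Num.max (W' w) 0; pose W'm w : K := Num.max (- W' w) 0.
have mWp : measurable_fun setT Wp by apply: measurable_maxr.
have mWm : measurable_fun setT Wm.
  by apply: measurable_maxr => //; exact: measurableT_comp.
have mW'p : measurable_fun setT W'p by apply: measurable_maxr.
have mW'm : measurable_fun setT W'm.
  by apply: measurable_maxr => //; exact: measurableT_comp.
have Wp1 w : `|Wp w| <= 1 by apply: max1.
have Wm1 w : `|Wm w| <= 1 by apply: max1; rewrite normrN.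
have W'p1 w : `|W'p w| <= 1 by apply: max1.
have W'm1 w : `|W'm w| <= 1 by apply: max1; rewrite normrN.
have mkg (g : T -> K) (N : K) : measurable_fun setT g -> (forall x, `|g x| <= N) ->
    measurable_fun setT (fun t => \int[k t]_x g x).
  move=> mg gN.
  (* The shift by N makes the integrand nonnegative, where kernel integrals are measurable; the
     existential keeps [gp] opaque. *)
  have [gp gpE] : exists gp : T -> K, gp = fun x => g x + N by eexists.
  have gp0 x : 0 <= gp x.
    by rewrite gpE; have := gN x; rewrite ler_norml => /andP[] ? ?; lra.
  have mgp : measurable_fun setT gp by rewrite gpE; apply: measurable_funD.
  have gE t : \int[k t]_x g x = \int[k t]_x gp x - N.
    rewrite gpE RintegralD//; last 2 first.
    - exact: (bounded_integrable (@prob_kernel _ _ _ _ _ k _) _ _ gN).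
    - by apply: (bounded_integrable (@prob_kernel _ _ _ _ _ k _) _ _ (M := `|N|)).
    by rewrite Rintegral_cst// prob_kernel /= mulr1 addrK.
  rewrite (_ : (fun t => _) = fun t => \int[k t]_x gp x - N); last exact/funext.
  apply: measurable_funB => //; apply: measurableT_comp => //.
  apply: measurable_fun_integral_kernel => //.
  - by move=> U mU; exact: measurable_kernel.
  - exact/measurable_EFinP.
have bd (U : Om -> K) (g : T -> K) (N : K) : measurable_fun setT U ->
    (forall w, `|U w| <= 1) -> measurable_fun setT g -> (forall x, `|g x| <= N) ->
    P.-integrable setT (EFin \o (fun w => U w * g (Z w))).
  move=> mU U1 mg gN; apply: (bounded_integrable (probability_setT _) _ _ (M := N)) => //.
    by apply: measurable_funM => //; exact: measurableT_comp.
  by move=> x; rewrite normrM -[leRHS]mul1r ler_pM.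
have bd' (U : T' -> K) (g : T -> K) (N : K) : measurable_fun setT U ->
    (forall w, `|U w| <= 1) -> measurable_fun setT g -> (forall x, `|g x| <= N) ->
    m.-integrable D (EFin \o (fun t => U t * \int[k t]_x g x)).
  move=> mU U1 mg gN; apply: (bounded_integrable (probability_setT _) _ _ (M := N)) => //.
    by apply: measurable_funTS; apply: measurable_funM => //; exact: mkg mg gN.
  move=> x; rewrite normrM -[leRHS]mul1r ler_pM//.
  by apply: le1_Rintegral => //; exact: prob_kernel.
(* The negative part of [W] goes to the right and that of [W'] to the left, leaving a nonnegative
   functional of g on each side. *)
have key (g : T -> K) (N : K) : measurable_fun setT g -> (forall x, `|g x| <= N) ->
   \int[P]_w (W w * g (Z w)) = \int[m]_(t in D) (W' t * \int[k t]_x g x) <->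
   ((\int[P]_w ((Wp w)%:E * (g (Z w))%:E) +
     \int[m]_(t in D) ((W'm t)%:E * \int[k t]_x (g x)%:E)) =
    (\int[P]_w ((Wm w)%:E * (g (Z w))%:E) +
     \int[m]_(t in D) ((W'p t)%:E * \int[k t]_x (g x)%:E)))%E.
  move=> mg gN.
  have EP (U : Om -> K) : measurable_fun setT U -> (forall w, `|U w| <= 1) ->
    (\int[P]_w ((U w)%:E * (g (Z w))%:E))%E = (\int[P]_w (U w * g (Z w)))%:E.
    by move=> mU U1; rewrite -Rintegral_EFin//; exact: bd mU U1 mg gN.
  have Em (U : T' -> K) : measurable_fun setT U -> (forall w, `|U w| <= 1) ->
    (\int[m]_(t in D) ((U t)%:E * \int[k t]_x (g x)%:E))%E =
    (\int[m]_(t in D) (U t * \int[k t]_x g x))%:E.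
    move=> mU U1; rewrite -Rintegral_EFin//; last exact: bd' mU U1 mg gN.
    apply: eq_integral => t _; rewrite EFinM -Rintegral_EFin//.
    exact: (bounded_integrable (@prob_kernel _ _ _ _ _ k _) _ _ gN).
  rewrite !EP// !Em//.
  have -> : \int[P]_w (W w * g (Z w)) =
      \int[P]_w (Wp w * g (Z w)) - \int[P]_w (Wm w * g (Z w)).
    rewrite -RintegralB//; last 2 first.
    - exact: bd gN.
    - exact: bd gN.
    by apply: eq_Rintegral => w _; rewrite -mulrBl maxB.
  have -> : \int[m]_(t in D) (W' t * \int[k t]_x g x) =
      \int[m]_(t in D) (W'p t * \int[k t]_x g x) -
      \int[m]_(t in D) (W'm t * \int[k t]_x g x).
    rewrite -RintegralB//; last 2 first.
    - exact: bd' gN.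
    - exact: bd' gN.
    by apply: eq_Rintegral => w _; rewrite -mulrBl maxB.
  exact: EFin_subr_eq.
have pos (g : T -> K) (N : K) : measurable_fun setT g -> (forall x, 0 <= g x) -> (forall x, `|g x| <= N) ->
   \int[P]_w (W w * g (Z w)) = \int[m]_(t in D) (W' t * \int[k t]_x g x).
  move=> mg g0 gN; apply/(key _ _ mg gN).
  have il := @integral_like_ext _ _ _
    (fun g => (\int[P]_w ((Wp w)%:E * (g (Z w))) +
     \int[m]_(t in D) ((W'm t)%:E * \int[k t]_x (g x)))%E)
    (fun g => (\int[P]_w ((Wm w)%:E * (g (Z w))) +
     \int[m]_(t in D) ((W'p t)%:E * \int[k t]_x (g x)))%E).
  apply: (il _ _ _ (EFin \o g)).
  - apply: integral_likeD.
    + apply: integral_like_comp => //; first exact/measurable_EFinP.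
      by move=> x; rewrite lee_fin le_max lexx orbT.
    + apply: integral_like_kernel => //; first by apply/measurable_EFinP/measurable_funTS.
      by move=> x; rewrite lee_fin le_max lexx orbT.
    + move=> h h0; apply: integral_ge0 => x _; rewrite mule_ge0//.
      by rewrite lee_fin le_max lexx orbT.
    + move=> h h0; apply: integral_ge0 => x _; rewrite mule_ge0//.
        by rewrite lee_fin le_max lexx orbT.
      exact: integral_ge0.
  - apply: integral_likeD.
    + apply: integral_like_comp => //; first exact/measurable_EFinP.
      by move=> x; rewrite lee_fin le_max lexx orbT.
    + apply: integral_like_kernel => //; first by apply/measurable_EFinP/measurable_funTS.
      by move=> x; rewrite lee_fin le_max lexx orbT.
    + move=> h h0; apply: integral_ge0 => x _; rewrite mule_ge0//.
      by rewrite lee_fin le_max lexx orbT.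
    + move=> h h0; apply: integral_ge0 => x _; rewrite mule_ge0//.
        by rewrite lee_fin le_max lexx orbT.
      exact: integral_ge0.
  - move=> A mA.
    have iN x : `|\1_A x : K| <= 1 by rewrite ger0_norm// indicE lern1 leq_b1.
    apply/(key _ _ _ iN) => //; rewrite WE//.
    by apply: eq_Rintegral => t _; rewrite /Rintegral integral_indic// setIT.
  - exact/measurable_EFinP.
  - by move=> x; rewrite lee_fin.
have M0 : 0 <= M by apply: le_trans (fM point).
have cM (x : T) : `|(fun=> M) x| <= M by rewrite ger0_norm.
have f2 x : `|f x + M| <= M + M.
  by apply: le_trans (ler_normD _ _) _; rewrite lerD// ger0_norm.
have fp x : 0 <= f x + M.
  by have := fM x; rewrite ler_norml => /andP[+ _]; rewrite -[in X in _ -> X](opprK M) subr_ge0.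
have mf2 : measurable_fun setT (fun x => f x + M) by apply: measurable_funD.
have mcM : measurable_fun [set: T] (fun=> M) by [].
(* Both f + M and the constant M are nonnegative; the difference of the two instances is the signed
   case. *)
have := pos _ _ mf2 fp f2.
have -> : \int[P]_w (W w * (f (Z w) + M)) =
    \int[P]_w (W w * f (Z w)) + \int[P]_w (W w * (fun=> M) (Z w)).
  rewrite -RintegralD//; last 2 first.
  - exact: bd fM.
  - exact: (bd _ _ _ mW W1 mcM cM).
  by apply: eq_Rintegral => w _; rewrite mulrDr.
rewrite (pos _ _ mcM _ cM)//.
have -> : \int[m]_(t in D) (W' t * \int[k t]_x (f x + M)) =
    \int[m]_(t in D) (W' t * \int[k t]_x f x) +
    \int[m]_(t in D) (W' t * \int[k t]_x (fun=> M) x).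
  rewrite -RintegralD//; last 2 first.
  - exact: bd' fM.
  - exact: (bd' _ _ _ mW' W'1 mcM cM).
  apply: eq_Rintegral => w _; rewrite -mulrDr RintegralD//.
  - exact: (bounded_integrable (@prob_kernel _ _ _ _ _ k _) _ _ fM).
  - exact: (bounded_integrable (@prob_kernel _ _ _ _ _ k _) _ _ cM).
by move/addIr.
Qed.

(** * Characteristic function of the normal law *)

(** A factor |x| is paid for by doubling the variance. With q = x^2 / (4 s^2), the claim reduces to
    |x| <= |s| exp q, and already |x| <= |s| (1 + q) because (|x| / |s| - 2)^2 >= 0. *)
Lemma normal_fun_dominated (K : realType) (s x : K) : s != 0 ->
  `|x| * normal_fun 0 s x <= `|s| * normal_fun 0 (Num.sqrt 2 * s) x.
Proof.
move=> s0; rewrite /normal_fun !subr0.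
have s2 : 0 < s ^+ 2 by rewrite exprn_even_gt0.
have -> : (Num.sqrt 2 * s) ^+ 2 *+ 2 = 4 * s ^+ 2.
  by rewrite exprMn sqr_sqrtr ?ler0n// -mulr_natr; ring.
pose q := x ^+ 2 / (4 * s ^+ 2).
have -> : - x ^+ 2 / (s ^+ 2 *+ 2) = - q - q.
  by rewrite /q -[s ^+ 2 *+ 2]mulr_natr; field.
have -> : - x ^+ 2 / (4 * s ^+ 2) = - q by rewrite /q mulNr.
rewrite expRD mulrA ler_pM2r ?expR_gt0//.
rewrite -ler_pdivlMr ?expR_gt0// -expRN opprK.
apply: (@le_trans _ _ (`|s| * (1 + q))); last first.
  by rewrite ler_wpM2l// expR_ge1Dx.
rewrite -ler_pdivrMl ?normr_gt0//.
have -> : q = (`|s|^-1 * `|x|) ^+ 2 / 4.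
  rewrite /q exprMn exprVn !real_normK ?num_real//.
  by field.
by have := sqr_ge0 (`|s|^-1 * `|x| - 2); nra.
Qed.

Lemma integrable_mul_normal_pdf (K : realType) (s : K) : s != 0 ->
  lebesgue_measure.-integrable [set: K] (fun x => (`|x| * normal_pdf 0 s x)%:E).
Proof.
move=> s0; have s20 : Num.sqrt 2 * s != 0.
  by rewrite mulf_neq0// gt_eqF// sqrtr_gt0.
pose c := `|s| * normal_peak s / normal_peak (Num.sqrt 2 * s).
apply: (@le_integrable _ _ K lebesgue_measure setT measurableT _
    (fun x => (c%:E * (normal_pdf 0 (Num.sqrt 2 * s) x)%:E)%E)).
- apply/measurable_EFinP/measurable_funM; first exact: normr_measurable.
  exact: measurable_normal_pdf.
- move=> x _; rewrite -EFinM lee_fin !normal_pdfE//.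
  rewrite ger0_norm ?mulr_ge0 ?normal_peak_ge0 ?normal_fun_ge0//.
  apply: le_trans (ler_norm _).
  have -> : c * (normal_peak (Num.sqrt 2 * s) * normal_fun 0 (Num.sqrt 2 * s) x) =
      normal_peak s * (`|s| * normal_fun 0 (Num.sqrt 2 * s) x).
    by rewrite /c mulrA divfK ?gt_eqF ?normal_peak_gt0// mulrAC mulrC mulrA.
  rewrite mulrCA ler_wpM2l ?normal_peak_ge0//.
  exact: normal_fun_dominated.
- by apply: integrableZl => //; exact: integrable_normal_pdf.
Qed.

Lemma is_derive_normal_pdf (K : realType) (s x : K) : s != 0 ->
  is_derive x 1 (normal_pdf 0 s) (- (x / s ^+ 2) * normal_pdf 0 s x).
Proof.
move=> s0; rewrite normal_pdfE//.
have -> : (fun x => normal_peak s * normal_fun 0 s x) =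
  normal_peak s *: (expR \o (fun x => - x ^+ 2 / (s ^+ 2 *+ 2))).
  by apply/funext => y; rewrite /normal_fun subr0.
have d : is_derive x 1 (fun x : K => - x ^+ 2 / (s ^+ 2 *+ 2)) (- (x / s ^+ 2)).
  have -> : (fun x : K => - x ^+ 2 / (s ^+ 2 *+ 2)) =
    (- (s ^+ 2 *+ 2)^-1) *: ((fun x => x) ^+ 2).
    by apply/funext => y; rewrite mulNr mulrC -mulNr.
  apply: is_derive_eq; rewrite /GRing.scale/= -mulr_natr.
  by field.
apply: is_derive_eq.
by rewrite /GRing.scale /= /normal_fun subr0; ring.
Qed.


Lemma integrable_normal_mul (K : realType) (s : K) (f : K -> K) (M : K) :
  measurable_fun setT f -> (forall x, `|f x| <= M) ->
  lebesgue_measure.-integrable [set: K] (fun x => (normal_pdf 0 s x * f x)%:E).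
Proof.
move=> mf fM.
apply: (@le_integrable _ _ K lebesgue_measure setT measurableT _
    (fun x => (M%:E * (normal_pdf 0 s x)%:E)%E)).
- apply/measurable_EFinP/measurable_funM => //.
  exact: measurable_normal_pdf.
- move=> x _; rewrite -EFinM lee_fin !normrM mulrC ler_wpM2r//.
  by apply: le_trans (fM x) _; exact: ler_norm.
- by apply: integrableZl => //; exact: integrable_normal_pdf.
Qed.

Lemma integrable_id_normal_mul (K : realType) (s : K) (f : K -> K) (M : K) :
  s != 0 -> measurable_fun setT f -> (forall x, `|f x| <= M) ->
  lebesgue_measure.-integrable [set: K] (fun x => (x * normal_pdf 0 s x * f x)%:E).
Proof.
move=> s0 mf fM.
apply: (@le_integrable _ _ K lebesgue_measure setT measurableT _
    (fun x => (M%:E * (`|x| * normal_pdf 0 s x)%:E)%E)).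
- apply/measurable_EFinP/measurable_funM => //.
  by apply: measurable_funM => //; exact: measurable_normal_pdf.
- move=> x _; rewrite -EFinM lee_fin !normrM normr_id [leLHS]mulrC ler_wpM2r//.
  by apply: le_trans (fM x) _; exact: ler_norm.
- by apply: integrableZl => //; exact: integrable_mul_normal_pdf.
Qed.

Lemma normal_pdf0N (K : realType) (s x : K) : s != 0 ->
  normal_pdf 0 s (- x) = normal_pdf 0 s x.
Proof. by move=> s0; rewrite !normal_pdfE// /normal_fun !subr0 sqrrN. Qed.

Lemma measurable_cosM (K : realType) (z : K) : measurable_fun setT (fun x => cos (z * x)).
Proof.
apply: continuous_measurable_fun => x; apply: continuous_comp; last exact: continuous_cos.
by apply: cvgM; [exact: cvg_cst|exact: cvg_id].
Qed.

Lemma measurable_sinM (K : realType) (z : K) : measurable_fun setT (fun x => sin (z * x)).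
Proof.
apply: continuous_measurable_fun => x; apply: continuous_comp; last exact: continuous_sin.
by apply: cvgM; [exact: cvg_cst|exact: cvg_id].
Qed.

(** Dominated convergence of the truncations by |h|; it carries the fundamental theorem of calculus
    from compact intervals to the whole line. *)
Lemma cvg_Rintegral_sym (K : realType) (h : K -> K) :
  lebesgue_measure.-integrable [set: K] (EFin \o h) ->
  \int[lebesgue_measure]_(x in `[- n%:R, n%:R]) h x @[n --> \oo] -->
  \int[lebesgue_measure]_x h x.
Proof.
move=> ih; have mh : measurable_fun setT h.
  by apply/measurable_EFinP; exact: (measurable_int _ ih).
apply: fine_cvg.
have := @dominated_convergence _ _ _ (@lebesgue_measure K) setT measurableT
  (fun n => (EFin \o h) \_ `[- n%:R, n%:R]) (EFin \o h) (abse \o EFin \o h).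
case.
- move=> n; apply/(measurable_restrictT _ _).1 => //; apply/measurable_EFinP; exact: measurable_funTS.
- exact/measurable_EFinP.
- apply: aeW => x _; apply: cvg_near_cst; near=> n.
  rewrite patchE mem_set//= in_itv/= -ler_norml.
  near: n; exact: nbhs_infty_ger.
- exact: (integrable_abse ih).
- apply: aeW => x n _; rewrite patchE; case: ifP => //= _.
  by rewrite lee_fin normr0.
move=> _ _; under eq_fun do rewrite -integral_mkcond.
rewrite Rintegral_EFin//.
Unshelve. all: by end_near. Qed.

(** Integration by parts. The derivative of [normal_pdf 0 s x * sin (z * x)] is [h], a combination
    of the two integrands, and its integral over the line is 0 since the boundary terms tend to
    0. *)
Lemma integral_normal_parts (K : realType) (s z : K) : s != 0 ->
  \int[lebesgue_measure]_x (x * normal_pdf 0 s x * sin (z * x)) =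
  s ^+ 2 * z * \int[lebesgue_measure]_x (normal_pdf 0 s x * cos (z * x)).
Proof.
move=> s0.
pose g x := normal_pdf 0 s x * sin (z * x).
pose h x := z * (normal_pdf 0 s x * cos (z * x)) - s ^- 2 * (x * normal_pdf 0 s x * sin (z * x)).
have dlin (x : K) : is_derive x 1 (fun y : K => z * y) z.
  have -> : (fun y : K => z * y) = z *: (id : K -> K) by [].
  by apply: is_derive_eq; rewrite /GRing.scale /= mulr1.
have gh (x : K) : is_derive x 1 g (h x).
  have dp := is_derive_normal_pdf x s0.
  have ds : is_derive x 1 (sin \o (fun y : K => z * y)) (z * cos (z * x)).
    by apply: is_derive_eq; rewrite /GRing.scale /= mulrC.
  have -> : g = normal_pdf 0 s * (sin \o (fun y : K => z * y)) by [].
  by apply: is_derive_eq; rewrite /h /GRing.scale/=; ring.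
have clin : continuous (fun x : K => z * x).
  by move=> x; apply: cvgM; [exact: cvg_cst|exact: cvg_id].
have cs : continuous (fun x => sin (z * x)).
  by move=> x; apply: (@continuous_comp _ _ _ (fun x => z * x)); [exact: clin|exact: continuous_sin].
have cc : continuous (fun x => cos (z * x)).
  by move=> x; apply: (@continuous_comp _ _ _ (fun x => z * x)); [exact: clin|exact: continuous_cos].
have cp : continuous (normal_pdf 0 s) by exact: continuous_normal_pdf.
have ch : continuous h.
  move=> x; apply: cvgB; (apply: cvgM; first exact: cvg_cst); apply: cvgM.
  - exact: cp.
  - exact: cc.
  - by apply: cvgM; [exact: cvg_id|exact: cp].
  - exact: cs.
have i1 := @integrable_normal_mul _ s _ 1 (@measurable_cosM _ z) (fun x => cos_max _).
have i2 := integrable_id_normal_mul s0 (@measurable_sinM _ z) (fun x => sin_max (z * x)).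
have iz1 := integrableZl measurableT z i1.
have iz2 := integrableZl measurableT (s ^- 2) i2.
have ih : lebesgue_measure.-integrable setT (EFin \o h).
  exact: (integrableB measurableT iz1 iz2).
have Ih : \int[lebesgue_measure]_x h x =
    z * \int[lebesgue_measure]_x (normal_pdf 0 s x * cos (z * x)) -
    s ^- 2 * \int[lebesgue_measure]_x (x * normal_pdf 0 s x * sin (z * x)).
  by rewrite RintegralB// !RintegralZl.
(* The index n + 1 keeps the interval nondegenerate. *)
have FTC n : \int[lebesgue_measure]_(x in `[- n.+1%:R, n.+1%:R]) h x = g n.+1%:R - g (- n.+1%:R).
  rewrite /Rintegral (@continuous_FTC2 _ h g) => //.
  - by rewrite -subr_gt0 opprK addr_gt0.
  - by apply: continuous_subspaceT => x; exact: ch.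
  - have cg : continuous g.
      by move=> x; apply: differentiable_continuous; apply/derivable1_diffP; case: (gh x).
    split.
    + by move=> x _; case: (gh x).
    + exact/cvg_at_right_filter/cg.
    + exact/cvg_at_left_filter/cg.
  - by move=> x _; rewrite derive1E; case: (gh x).
(* [normal_fun_dominated] at x = n + 1 bounds the density by a multiple of 1 / (n + 1), which is
   enough to kill the boundary terms. *)
have gn n : `|g n.+1%:R - g (- n.+1%:R)| <= (2 * (normal_peak s * `|s|)) / n.+1%:R.
  rewrite /g mulrN sinN mulrN opprK.
  rewrite normal_pdf0N//.
  rewrite -mulr2n -[X in `|X| <= _]mulr_natl normrM ger0_norm// -mulrA ler_pM2l//.
  rewrite normrM (ger0_norm (normal_pdf_ge0 _ _ _)).
  apply: (@le_trans _ _ (normal_pdf 0 s n.+1%:R * 1)).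
    by rewrite ler_wpM2l ?normal_pdf_ge0// sin_max.
  rewrite mulr1 normal_pdfE// -mulrA ler_wpM2l ?normal_peak_ge0//.
  rewrite ler_pdivlMr// mulrC.
  have := normal_fun_dominated n.+1%:R s0; rewrite ger0_norm//.
  move=> /le_trans; apply; rewrite ler_piMr// -[leRHS]expR0 ler_expR.
  by rewrite mulNr oppr_le0 divr_ge0// ?sqr_ge0// mulrn_wge0// sqr_ge0.
have c1 := cvg_Rintegral_sym ih.
have c0 : \int[lebesgue_measure]_(x in `[- n%:R, n%:R]) h x @[n --> \oo] --> (0 : K).
  rewrite -cvg_shiftS /=; under eq_fun do rewrite FTC.
  apply: norm_cvg0.
  apply: (@squeeze_cvgr _ _ _ _ (cst 0) (fun n => (2 * (normal_peak s * `|s|)) / n.+1%:R)).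
  - by apply: nearW => n; rewrite normr_ge0 gn.
  - exact: cvg_cst.
  - rewrite -[X in _ --> X](mulr0 (2 * (normal_peak s * `|s|))).
    by apply: cvgM; [exact: cvg_cst|exact: cvg_harmonic].
have : \int[lebesgue_measure]_x h x = 0 by rewrite -(cvg_lim _ c1)// (cvg_lim _ c0).
rewrite Ih => /eqP; rewrite subr_eq0 => /eqP.
move: (\int[_]_x _) (\int[_]_x _) => a b E.
by rewrite -mulrA E mulrA divff ?mul1r// expf_neq0.
Qed.

(** As a function of z the integral satisfies F' = - s^2 z F, by differentiation under the integral
    sign and [integral_normal_parts]. Hence F(z) exp(s^2 z^2 / 2) is constant, with value 1 at z =
    0. *)
Lemma normal_cf (K : realType) (s z : K) : s != 0 ->
  \int[lebesgue_measure]_x (normal_pdf 0 s x * cos (z * x)) = expR (- (s * z) ^+ 2 / 2).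
Proof.
move=> s0.
pose f (z x : K) := normal_pdf 0 s x * cos (z * x).
pose F (z : K) := \int[lebesgue_measure]_x f z x.
have i1 z' := @integrable_normal_mul _ s _ 1 (@measurable_cosM _ z') (fun x => cos_max _).
have df (x z' : K) : is_derive z' 1 (f ^~ x) (- (x * normal_pdf 0 s x * sin (z' * x))).
  have dlin : is_derive z' 1 (fun y : K => y * x) x.
    have -> : (fun y : K => y * x) = x *: (id : K -> K).
      by apply/funext => y; rewrite mulrC.
    by apply: is_derive_eq; rewrite /GRing.scale /= mulr1.
  have -> : f ^~ x = normal_pdf 0 s x *: (cos \o (fun y : K => y * x)) by [].
  by apply: is_derive_eq; rewrite /GRing.scale /=; ring.
have d1f z' x : partial1of2 f z' x = - (x * normal_pdf 0 s x * sin (z' * x)).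
  by rewrite partial1of2E; case: (df x z') => _ ->.
have dF (z' : K) : is_derive z' 1 F (- (s ^+ 2 * z' * F z')).
  have Iz : `]z' - 1, z' + 1[%classic z'.
    by rewrite /= in_itv/= ltrBlDr ltrDl ltr01 /=.
  have iG := integrable_mul_normal_pdf s0.
  have G0 (y : K) : 0 <= `|y| * normal_pdf 0 s y by rewrite mulr_ge0// normal_pdf_ge0.
  have der (x y : K) : `]z' - 1, z' + 1[%classic x -> setT y -> derivable (f^~ y) x 1.
    by move=> _ _; case: (df y x).
  have bd (x y : K) : `]z' - 1, z' + 1[%classic x -> setT y ->
      `|partial1of2 f x y| <= `|y| * normal_pdf 0 s y.
    move=> _ _; rewrite d1f normrN !normrM (ger0_norm (normal_pdf_ge0 _ _ _)).
    by rewrite ler_piMr ?sin_max.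
  have int1 (x : K) : `]z' - 1, z' + 1[%classic x ->
      lebesgue_measure.-integrable [set: K] (EFin \o f x).
    by move=> _; exact: i1.
  have D := @derivable_under_integral _ _ _ lebesgue_measure f setT measurableT z' _ _
    Iz int1 der _ G0 iG bd.
  have D' := @differentiation_under_integral _ _ _ lebesgue_measure f setT measurableT z' _ _
    Iz int1 der _ G0 iG bd.
  apply: DeriveDef; first exact: D.
  rewrite -derive1E D' /F /f -integral_normal_parts// -mulN1r -RintegralZl//.
    by apply: eq_Rintegral => x _; rewrite /= d1f mulN1r.
  exact: (integrable_id_normal_mul s0 (@measurable_sinM _ z') (fun x => sin_max (z' * x))).
pose G (z : K) := F z * expR (s ^+ 2 / 2 * z ^+ 2).
have dG (z' : K) : is_derive z' 1 G 0.
  have de : is_derive z' 1 (expR \o (fun y : K => s ^+ 2 / 2 * y ^+ 2))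
      (s ^+ 2 * z' * expR (s ^+ 2 / 2 * z' ^+ 2)).
    have dq : is_derive z' 1 (fun y : K => s ^+ 2 / 2 * y ^+ 2) (s ^+ 2 * z').
      have -> : (fun y : K => s ^+ 2 / 2 * y ^+ 2) = (s ^+ 2 / 2) *: ((id : K -> K) ^+ 2) by [].
      by apply: is_derive_eq; rewrite /GRing.scale /=; field.
    by apply: is_derive_eq; rewrite /GRing.scale /= mulrC.
  have -> : G = F * (expR \o (fun y : K => s ^+ 2 / 2 * y ^+ 2)) by [].
  have := dF z' => dFz; apply: is_derive_eq; rewrite /GRing.scale /=.
  move: (F z') => a; ring.
have := is_derive_0_is_cst z 0 dG.
have F0 : F 0 = 1.
  rewrite /F /f; under eq_Rintegral do rewrite mul0r cos0 mulr1.
  by rewrite /Rintegral integral_normal_pdf.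
rewrite /G F0 expr0n/= mulr0 expR0 mulr1 => E.
rewrite -/(f z) -/(F z).
have -> : expR (- (s * z) ^+ 2 / 2) = (expR (s ^+ 2 / 2 * z ^+ 2))^-1.
  by rewrite -expRN; congr expR; field.
have e0 : expR (s ^+ 2 / 2 * z ^+ 2) != 0 by rewrite gt_eqF// expR_gt0.
by rewrite -[LHS](mulfK e0) E mul1r.
Qed.

Lemma integral_normal (K : realType) (mu : {measure set K -> \bar K}) (s : K)
    (f : K -> K) (M : K) :
  mu setT = 1%E -> (forall B, measurable B -> mu B = normal_prob 0 s B) ->
  measurable_fun setT f -> (forall x, `|f x| <= M) ->
  \int[mu]_x f x = \int[lebesgue_measure]_x (normal_pdf 0 s x * f x).
Proof.
move=> n1 muE mf fM.
have pos (g : K -> K) : measurable_fun setT g -> (forall x, 0 <= g x) ->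
    \int[mu]_x g x = \int[lebesgue_measure]_x (normal_pdf 0 s x * g x).
  move=> mg g0; congr fine.
  rewrite (@ge0_integral_density _ _ _ _ _ mu (@lebesgue_measure K) id
    (EFin \o normal_pdf 0 s)) //.
  - by apply/measurable_EFinP; exact: measurable_normal_pdf.
  - by move=> x; rewrite lee_fin normal_pdf_ge0.
  - exact/measurable_EFinP.
have M0 : 0 <= M by apply: le_trans (fM 0).
have bM x : `|(cst M : K -> K) x| <= M by rewrite ger0_norm.
have fM0 x : 0 <= f x + M.
  by have := fM x; rewrite ler_norml => /andP[+ _]; rewrite -[in X in _ -> X](opprK M) subr_ge0.
have := pos _ (measurable_funD mf (measurable_cst M)) fM0.
rewrite RintegralD//; last 2 first.
- exact: (bounded_integrable n1 _ _ fM).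
- exact: (bounded_integrable n1 _ _ bM).
have -> : \int[lebesgue_measure]_x (normal_pdf 0 s x * (f \+ cst M) x) =
    \int[lebesgue_measure]_x (normal_pdf 0 s x * f x) +
    \int[lebesgue_measure]_x (normal_pdf 0 s x * cst M x).
  rewrite -RintegralD//; last 2 first.
  - exact: integrable_normal_mul fM.
  - exact: (integrable_normal_mul _ _ bM).
  by apply: eq_Rintegral => x _; rewrite mulrDr.
by rewrite (pos (cst M))// => /addIr.
Qed.

Lemma Rintegral_lebesgue_odd (K : realType) (f : K -> K) :
  lebesgue_measure.-integrable [set: K] (EFin \o f) -> (forall x, f (- x) = - f x) ->
  \int[lebesgue_measure]_x f x = 0.
Proof.
move=> intf fN; have mf : measurable_fun setT f.
  by apply/measurable_EFinP; exact: (measurable_int _ intf).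
have mN : measurable_fun setT (-%R : measurableTypeR K -> measurableTypeR K) by [].
have E : \int[lebesgue_measure]_x f x = \int[lebesgue_measure]_x f (- x).
  have mEf : measurable_fun [set: measurableTypeR K] (EFin \o f) by exact/measurable_EFinP.
  have iN : lebesgue_measure.-integrable ((-%R : measurableTypeR K -> measurableTypeR K) @^-1` setT)
      ((EFin \o f) \o -%R).
    rewrite preimage_setT.
    have -> : (EFin \o f) \o -%R = (\- (EFin \o f))%E.
      by apply/funext => x /=; rewrite fN.
    exact: integrableN.
  have := integral_pushforward mN mEf iN measurableT.
  rewrite preimage_setT => H; congr fine; rewrite -[RHS]H.
  by apply: eq_measure_integral => A mA _; rewrite [RHS]lebesgue_measureN.
move: E; under [in X in _ = X -> _]eq_Rintegral do rewrite fN -mulN1r.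
rewrite RintegralZl// mulN1r => /eqP; rewrite -addr_eq0 -mulr2n mulrn_eq0/=.
by move/eqP.
Qed.

Lemma measurable_cos (K : realType) : measurable_fun setT (@cos K).
Proof. by apply: continuous_measurable_fun; exact: continuous_cos. Qed.

Lemma measurable_sin (K : realType) : measurable_fun setT (@sin K).
Proof. by apply: continuous_measurable_fun; exact: continuous_sin. Qed.

(** The degenerate case v = 0 is a Dirac mass and is treated apart; it arises as soon as a
    functional annihilates the covariance. *)
Lemma normal_law_cos (K : realType) (v : K) (mu : {measure set K -> \bar K}) :
  mu setT = 1%E -> 0 <= v -> (forall B, measurable B -> mu B = normal_law 0 v B) ->
  \int[mu]_x cos x = expR (- v / 2).
Proof.
move=> mu1 v0 muE; have [ve|vn] := eqVneq v 0.
  rewrite ve oppr0 mul0r expR0 -cos0 /Rintegral.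
  rewrite (eq_measure_integral (\d_(0 : K))).
    rewrite integral_dirac// ?diracT ?mul1e//.
    by apply/measurable_EFinP; exact: measurable_cos.
  by move=> A mA _; rewrite [LHS]muE// /normal_law ve eqxx.
have s0 : Num.sqrt v != 0 by rewrite gt_eqF// sqrtr_gt0 lt0r vn.
have muE' B : measurable B -> mu B = normal_prob 0 (Num.sqrt v) B.
  by move=> mB; rewrite [LHS]muE// /normal_law (negbTE vn).
rewrite (integral_normal mu1 muE' (@measurable_cos _) (@cos_max _)).
have := normal_cf 1 s0; rewrite mulr1 sqr_sqrtr// => <-.
by apply: eq_Rintegral => x _; rewrite mul1r.
Qed.

Lemma normal_law_sin (K : realType) (v : K) (mu : {measure set K -> \bar K}) :
  mu setT = 1%E -> 0 <= v -> (forall B, measurable B -> mu B = normal_law 0 v B) ->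
  \int[mu]_x sin x = 0.
Proof.
move=> mu1 v0 muE; have [ve|vn] := eqVneq v 0.
  rewrite /Rintegral (eq_measure_integral (\d_(0 : K))).
    rewrite integral_dirac// ?diracT ?mul1e//= ?sin0//.
    by apply/measurable_EFinP; exact: measurable_sin.
  by move=> A mA _; rewrite [LHS]muE// /normal_law ve eqxx.
have s0 : Num.sqrt v != 0 by rewrite gt_eqF// sqrtr_gt0 lt0r vn.
have muE' B : measurable B -> mu B = normal_prob 0 (Num.sqrt v) B.
  by move=> mB; rewrite [LHS]muE// /normal_law (negbTE vn).
rewrite (integral_normal mu1 muE' (@measurable_sin _) (@sin_max _)).
apply: Rintegral_lebesgue_odd.
  exact: integrable_normal_mul (@measurable_sin _) (@sin_max _).
by move=> x; rewrite normal_pdf0N// sinN mulrN.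
Qed.

(** The image measure is handed over as an abstract [m], known through its values on sets and its
    integrals. *)
Lemma measurable_image_law (K : realType) (d d' : measure_display)
    (T : measurableType d) (T' : measurableType d')
    (mu : {measure set T -> \bar K}) (l : T -> T') : measurable_fun setT l ->
  exists m : {measure set T' -> \bar K}, (forall B, m B = mu (l @^-1` B)) /\
    forall f : T' -> K, measurable_fun setT f ->
      mu.-integrable setT (EFin \o (f \o l)) -> \int[m]_x f x = \int[mu]_x f (l x).
Proof.
move=> ml; unshelve eexists (pushforward mu l : {measure set T' -> \bar K}).
  exact: ml.
split; first by move=> B; reflexivity.
move=> f mf intf; congr fine.
apply: (integral_pushforward ml _ intf measurableT).
exact/measurable_EFinP.
Qed.

(** Absorbs one conditionally Gaussian component into the characteristic function. [V] is the part
    of the functional already treated, [phi] its conditional characteristic function, and [S] a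
    product of indicators reserved for the components still to come, with conditional expectation
    [S']. The addition formulas separate [V] from [l (Z w)]: given t, the cosine of the new part has
    mean exp(- v / (2 t)) and its sine has mean 0. Sine and cosine of [V] mix in these formulas, so
    both statements have to be carried together. *)
Lemma cos_sin_step (K : realType) (d d1 : measure_display)
    (Om : measurableType d) (T : measurableType d1)
    (P : probability Om K) (m : probability K K) (D : set K) (k : K.-pker K ~> T)
    (Z : Om -> T) (V S : Om -> K) (phi S' : K -> K) (l : T -> K) (v : K) :
  measurable D -> D `<=` [set t | 0 < t] -> measurable_fun setT Z ->
  measurable_fun setT V -> measurable_fun setT S ->
  measurable_fun setT phi -> measurable_fun setT S' -> measurable_fun setT l ->
  (forall w, `|S w| <= 1) -> (forall t, `|S' t| <= 1) -> (forall t, `|phi t| <= 1) ->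
  0 <= v ->
  (forall (t : K) B, 0 < t -> measurable B -> k t (l @^-1` B) = normal_law 0 (v / t) B) ->
  (forall B, measurable B -> \int[P]_w (cos (V w) * S w * \1_B (Z w)) =
     \int[m]_(t in D) (phi t * S' t * fine (k t B))) ->
  (forall B, measurable B -> \int[P]_w (sin (V w) * S w * \1_B (Z w)) = 0) ->
  \int[P]_w (cos (V w + l (Z w)) * S w) =
    \int[m]_(t in D) (phi t * expR (- (v / t) / 2) * S' t) /\
  \int[P]_w (sin (V w + l (Z w)) * S w) = 0.
Proof.
move=> mD Dpos mZ mV mS mphi mS' ml S1 S'1 phi1 v0 kE Hc Hs.
have mcV : measurable_fun setT (cos \o V).
  by apply: measurableT_comp => //; exact: measurable_cos.
have msV : measurable_fun setT (sin \o V).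
  by apply: measurableT_comp => //; exact: measurable_sin.
have mcl : measurable_fun setT (cos \o l).
  by apply: measurableT_comp => //; exact: measurable_cos.
have msl : measurable_fun setT (sin \o l).
  by apply: measurableT_comp => //; exact: measurable_sin.
have mcVS : measurable_fun setT (fun w => cos (V w) * S w).
  exact: measurable_funM.
have msVS : measurable_fun setT (fun w => sin (V w) * S w).
  exact: measurable_funM.
have le1M (a b : K) : `|a| <= 1 -> `|b| <= 1 -> `|a * b| <= 1.
  by move=> a1 b1; rewrite normrM -[leRHS]mulr1 ler_pM.
have bcVS w : `|cos (V w) * S w| <= 1 by apply: le1M => //; exact: cos_max.
have bsVS w : `|sin (V w) * S w| <= 1 by apply: le1M => //; exact: sin_max.
have bphiS t : `|phi t * S' t| <= 1 by exact: le1M.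
have mphiS : measurable_fun setT (fun t => phi t * S' t) by exact: measurable_funM.
have Hs' B : measurable B -> \int[P]_w (sin (V w) * S w * \1_B (Z w)) =
    \int[m]_(t in D) ((fun=> 0 : K) t * fine (k t B)).
  move=> mB; rewrite Hs//; under eq_Rintegral do rewrite mul0r.
  by rewrite Rintegral_cst// mul0r.
have c01 (t : K) : `|(fun=> 0 : K) t| <= 1 by rewrite normr0.
(* The four products in the addition formulas arise from [Hc] and [Hs] when the indicator of [Z] is
   replaced by the cosine or the sine of [l]. *)
have Ecc := kernel_ext mD mZ mcVS mphiS mcl bcVS bphiS (fun x => cos_max (l x)) Hc.
have Ecs := kernel_ext mD mZ mcVS mphiS msl bcVS bphiS (fun x => sin_max (l x)) Hc.
have Esc := kernel_ext mD mZ msVS (measurable_cst (0 : K)) mcl bsVS c01 (fun x => cos_max (l x)) Hs'.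
have Ess := kernel_ext mD mZ msVS (measurable_cst (0 : K)) msl bsVS c01 (fun x => sin_max (l x)) Hs'.
have zint (g : K -> K) : \int[m]_(t in D) ((fun=> 0 : K) t * g t) = 0.
  by under eq_Rintegral do rewrite mul0r; rewrite Rintegral_cst// mul0r.
rewrite zint in Esc; rewrite zint in Ess.
have kcf (t : K) : 0 < t -> \int[k t]_x cos (l x) = expR (- (v / t) / 2) /\
                      \int[k t]_x sin (l x) = 0.
  move=> t0.
  have vt0 : 0 <= v / t by rewrite divr_ge0// ltW.
  have [mu [muE intmu]] := measurable_image_law (k t) ml.
  have mu1 : mu setT = 1%E by rewrite [LHS]muE preimage_setT prob_kernel.
  have muE' B : measurable B -> mu B = normal_law 0 (v / t) B.
    by move=> mB; rewrite [LHS]muE kE.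
  have il (f : K -> K) : measurable_fun setT f -> (forall x, `|f x| <= 1) ->
      (k t).-integrable setT (EFin \o (f \o l)).
    move=> mf f1; apply: (bounded_integrable (M := 1) (@prob_kernel _ _ _ _ _ k t)) => //.
    - exact: measurableT_comp.
    - by move=> x; exact: f1.
  split.
  - by rewrite -intmu ?(normal_law_cos mu1 vt0 muE')//;
      [exact: measurable_cos|apply: il; [exact: measurable_cos|exact: cos_max]].
  - by rewrite -intmu ?(normal_law_sin mu1 vt0 muE')//;
      [exact: measurable_sin|apply: il; [exact: measurable_sin|exact: sin_max]].
have iM (f : Om -> K) (g : T -> K) : measurable_fun setT f -> measurable_fun setT g ->
    (forall w, `|f w| <= 1) -> (forall x, `|g x| <= 1) ->
    P.-integrable setT (EFin \o (fun w => f w * g (Z w))).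
  move=> mf mg f1 g1; apply: (bounded_integrable (M := 1) (probability_setT _)) => //.
    by apply: measurable_funM => //; exact: measurableT_comp.
  by move=> w; exact: le1M.
have icc := iM _ _ mcVS mcl bcVS (fun x => cos_max (l x)).
have ics := iM _ _ mcVS msl bcVS (fun x => sin_max (l x)).
have isc := iM _ _ msVS mcl bsVS (fun x => cos_max (l x)).
have iss := iM _ _ msVS msl bsVS (fun x => sin_max (l x)).
split.
- transitivity (\int[P]_w (cos (V w) * S w * cos (l (Z w)) - sin (V w) * S w * sin (l (Z w)))).
    by apply: eq_Rintegral => w _; rewrite cosD; ring.
  rewrite RintegralB// Ecc Ess subr0.
  apply: eq_Rintegral => t; rewrite inE => /Dpos t0.
  by have [-> _] := kcf t t0; rewrite mulrAC.
- transitivity (\int[P]_w (sin (V w) * S w * cos (l (Z w)) + cos (V w) * S w * sin (l (Z w)))).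
    by apply: eq_Rintegral => w _; rewrite sinD; ring.
  rewrite RintegralD// Esc Ecs add0r.
  transitivity (\int[m]_(t in D) ((fun=> 0) t * (fun=> 0 : K) t)); last exact: zint.
  apply: eq_Rintegral => t; rewrite inE => /Dpos t0.
  by have [_ ->] := kcf t t0; rewrite !mulr0.
Qed.

(** * Vectorization, Kronecker products and whitening *)

Lemma sum_mxtens (V : nmodType) (m n : nat) (F : 'I_(m * n) -> V) :
  \sum_k F k = \sum_(i < m) \sum_(j < n) F (mxtens_index (i, j)).
Proof.
rewrite pair_big; apply: reindex => //=.
exists (@mxtens_unindex m n) => [[i j]|k] _; first by rewrite mxtens_indexK.
by rewrite -surjective_pairing mxtens_unindexK.
Qed.

Lemma vec_mulmx (R : comPzRingType) (a b c d : nat) (A : 'M[R]_(a, b))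
    (X : 'M[R]_(b, c)) (B : 'M[R]_(d, c)) :
  vec (A *m X *m B^T) = (B *t A) *m vec X.
Proof.
apply/colP => k; case: (mxtens_indexP k) => j i {k}.
rewrite !mxE mxtens_indexK /= sum_mxtens.
apply: eq_bigr => q _; rewrite !mxE mulr_suml; apply: eq_bigr => p _.
by rewrite !mxE !mxtens_indexK /=; rewrite mulrC mulrA.
Qed.

Lemma vecD (R : nmodType) (a b : nat) (A B : 'M[R]_(a, b)) :
  vec (A + B) = vec A + vec B.
Proof. by apply/colP => k; rewrite !mxE. Qed.

Lemma vecB (R : zmodType) (a b : nat) (A B : 'M[R]_(a, b)) :
  vec (A - B) = vec A - vec B.
Proof. by apply/colP => k; rewrite !mxE. Qed.

Lemma unvecK (T : Type) (a b : nat) : cancel (@unvec T a b) (@vec T a b).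
Proof. by move=> v; apply/colP => k; rewrite !mxE -surjective_pairing mxtens_unindexK. Qed.

Lemma mxtrace_mul_vec (R : comPzRingType) (a b : nat) (A B : 'M[R]_(a, b)) :
  \tr (A *m B^T) = ((vec A)^T *m vec B) 0 0.
Proof.
rewrite !mxE sum_mxtens exchange_big; apply: eq_bigr => i _.
by rewrite !mxE; apply: eq_bigr => j _; rewrite !mxE !mxtens_indexK.
Qed.

Lemma tensmxDl (R : pzRingType) (m n p q : nat) (A B : 'M[R]_(m, n)) (C : 'M[R]_(p, q)) :
  (A + B) *t C = A *t C + B *t C.
Proof. by apply/matrixP => i j; rewrite !mxE mulrDl. Qed.

Lemma tensmxDr (R : pzRingType) (m n p q : nat) (A : 'M[R]_(m, n)) (B C : 'M[R]_(p, q)) :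
  A *t (B + C) = A *t B + A *t C.
Proof. by apply/matrixP => i j; rewrite !mxE mulrDr. Qed.

Lemma tensmxZr (R : comPzRingType) (m n p q : nat) (A : 'M[R]_(m, n)) (B : 'M[R]_(p, q)) c :
  A *t (c *: B) = c *: (A *t B).
Proof. by apply/matrixP => i j; rewrite !mxE mulrCA. Qed.

Lemma tensmx1 (R : pzRingType) (m n : nat) : (1%:M : 'M[R]_m) *t (1%:M : 'M[R]_n) = 1%:M.
Proof.
apply/matrixP => i j; case: (mxtens_indexP i) => i1 i2; case: (mxtens_indexP j) => j1 j2.
rewrite tensmxE !mxE -natrM mulnb; congr (_%:R).
by rewrite (can_eq (@mxtens_indexK _ _)) xpair_eqE.
Qed.

Lemma mxtrace_tens (R : pzRingType) (m n : nat) (A : 'M[R]_m) (B : 'M[R]_n) :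
  \tr (A *t B) = \tr A * \tr B.
Proof.
rewrite /mxtrace mulr_sum; apply: eq_bigr => k _; by rewrite mxE.
Qed.

Lemma mulmx_dotE (R : pzRingType) (m : nat) (u v : 'cV[R]_m) :
  (u^T *m v) 0 0 = \sum_i u i 0 * v i 0.
Proof. by rewrite mxE; apply: eq_bigr => i _; rewrite mxE. Qed.

Lemma dot_ge0 (R : realDomainType) (m : nat) (v : 'cV[R]_m) : 0 <= (v^T *m v) 0 0.
Proof. by rewrite mulmx_dotE; apply: sumr_ge0 => i _; rewrite -expr2 sqr_ge0. Qed.

Lemma dot_gt0 (R : realDomainType) (m : nat) (v : 'cV[R]_m) : v != 0 -> 0 < (v^T *m v) 0 0.
Proof.
move=> v0; rewrite lt0r dot_ge0 andbT; apply: contraNneq v0 => /eqP.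
rewrite mulmx_dotE psumr_eq0 => [/allP h|i _]; last by rewrite -expr2 sqr_ge0.
apply/eqP/colP => i; rewrite mxE; have := h i (mem_index_enum _).
by rewrite -expr2 sqrf_eq0 => /eqP.
Qed.

Lemma pos_diag_factor (K : realType) (k : nat) (A : 'M[K]_k) : pos_diag A ->
  exists2 S : 'M[K]_k, A = S *m S^T & S \in unitmx.
Proof.
move=> [/is_diag_mxP Ad Ap].
pose s : 'rV[K]_k := \row_i Num.sqrt (A i i).
exists (diag_mx s).
  rewrite tr_diag_mx mulmx_diag; apply/matrixP => i j; rewrite !mxE.
  have [<-|ij] := eqVneq i j; last by rewrite mulr0n Ad.
  by rewrite mulr1n -expr2 sqr_sqrtr// ltW.
rewrite unitmxE det_diag unitfE prodf_seq_neq0; apply/allP => i _ /=.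
by rewrite mxE gt_eqF// sqrtr_gt0.
Qed.

Definition posdef (K : realType) (k : nat) (S : 'M[K]_k) : Prop :=
  S^T = S /\ forall x : 'cV[K]_k, x != 0 -> 0 < (x^T *m S *m x) 0 0.

(** Writing [Psi] as S S' with S invertible makes its contribution strictly positive; L L'
    contributes a nonnegative amount. *)
Lemma posdef_scale (K : realType) (k q : nat) (L : 'M[K]_(k, q)) (Psi : 'M[K]_k) :
  pos_diag Psi -> posdef (L *m L^T + Psi).
Proof.
move=> /pos_diag_factor[S -> uS]; split.
  by rewrite linearD /= !trmx_mul !trmxK.
move=> x x0; rewrite mulmxDr mulmxDl mxE.
have -> : x^T *m (L *m L^T) *m x = (L^T *m x)^T *m (L^T *m x).
  by rewrite trmx_mul trmxK !mulmxA.
have -> : x^T *m (S *m S^T) *m x = (S^T *m x)^T *m (S^T *m x).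
  by rewrite trmx_mul trmxK !mulmxA.
apply: ltr_wpDl; [exact: dot_ge0|apply: dot_gt0].
have uST : S^T \in unitmx by rewrite unitmx_tr.
by apply: contraNneq x0 => Sx0; rewrite -[x](mulKmx uST) Sx0 mulmx0.
Qed.

(** Cholesky elimination by induction on the size. The matrix [E] clears the first row and column
    and leaves the Schur complement [M'], which is again positive definite because x'M'x is the
    value of the form of [S] at E'(0, x). *)
Lemma posdef_whiten (K : realType) (k : nat) (S : 'M[K]_k) : posdef S ->
  exists T : 'M[K]_k, T *m S *m T^T = 1%:M.
Proof.
elim: k S => [|k IH] S.
  by exists 1%:M; apply/matrixP => -[].
move: S; rewrite -[k.+1]/(1 + k)%N => S [Ssym Spos].
have [s [v [M SE]]] : exists (s : K) (v : 'cV[K]_k) (M : 'M[K]_k),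
    S = block_mx s%:M v^T v M :> 'M[K]_(1 + k).
  exists (S 0 0), (@dlsubmx _ 1 k 1 k S), (@drsubmx _ 1 k 1 k S).
  rewrite -[LHS](@submxK _ 1 k 1 k); congr block_mx.
    rewrite [LHS]mx11_scalar; congr (_%:M); rewrite !mxE.
    by congr (S _ _); apply: val_inj.
  by rewrite -[in RHS]Ssym trmx_dlsub trmxK.
have Msym : M^T = M.
  by move: Ssym; rewrite SE tr_block_mx => /eq_block_mx[_ _ _].
have s0 : 0 < s.
  have := Spos (col_mx 1%:M 0 : 'cV_(1 + k)).
  rewrite SE tr_col_mx mul_row_block mul_row_col !trmx0 !trmx1 !mul0mx !mulmx0.
  rewrite !mul1mx !mulmx1 !addr0 mxE eqxx mulr1n; apply.
  apply/eqP => /(congr1 (@usubmx _ 1 k 1)); rewrite col_mxKu => /matrixP/(_ 0 0).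
  by rewrite !mxE => /eqP; rewrite oner_eq0.
pose E : 'M[K]_(1 + k) := block_mx 1%:M 0 (- s^-1 *: v) 1%:M.
pose M' := M - s^-1 *: (v *m v^T).
have ESE : E *m S *m E^T = block_mx s%:M 0 0 M'.
  rewrite /E SE tr_block_mx !mulmx_block !trmx1 !trmx0 !mul1mx !mul0mx.
  rewrite !mulmx1 !mulmx0 !addr0.
  have Ev : - s^-1 *: v *m s%:M + v = 0.
    by rewrite mul_mx_scalar scalerA mulrN divff ?gt_eqF// scaleN1r addNr.
  have Ev' : s%:M *m (- s^-1 *: v)^T + v^T = 0.
    by rewrite mul_scalar_mx linearZ /= scalerA mulrN divff ?gt_eqF// scaleN1r addNr.
  rewrite Ev Ev' mul0mx add0r -scalemxAl.
  by congr block_mx; rewrite /M' scaleNr addrC.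
have pM' : posdef M'.
  split.
    by rewrite /M' linearB linearZ /= trmx_mul trmxK Msym.
  move=> x x0; pose y : 'cV[K]_(1 + k) := E^T *m col_mx 0 x.
  have := Spos y; rewrite /y trmx_mul trmxK.
  have -> : (col_mx 0 x)^T *m E *m S *m (E^T *m col_mx 0 x) =
            (col_mx 0 x)^T *m (E *m S *m E^T) *m (col_mx 0 x : 'cV_(1 + k)).
    by rewrite !mulmxA.
  rewrite ESE tr_col_mx mul_row_block mul_row_col !trmx0 !mul0mx !mulmx0.
  rewrite !add0r; apply.
  apply: contraNneq x0; rewrite /E tr_block_mx mul_block_col !mulmx0 !trmx1.
  rewrite mul1mx !add0r => /(congr1 (@dsubmx _ 1 k 1)).
  by rewrite col_mxKd => ->; apply/eqP/matrixP => i j; rewrite !mxE.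
have [T' T'E] := IH _ pM'.
pose T0 : 'M[K]_(1 + k) := block_mx (Num.sqrt s)^-1%:M 0 0 T'.
exists (T0 *m E).
rewrite trmx_mul !mulmxA -[T0 *m E *m S]mulmxA -[T0 *m _ *m E^T]mulmxA ESE.
rewrite /T0 tr_block_mx !mulmx_block !trmx0 !mul0mx !mulmx0 !addr0 !add0r.
rewrite ?mul0mx ?mulmx0 ?addr0 ?add0r T'E tr_scalar_mx -!scalar_mxM.
have -> : (Num.sqrt s)^-1 * s * (Num.sqrt s)^-1 = 1.
  rewrite mulrAC -expr2 exprVn sqr_sqrtr ?ltW// mulVf ?gt_eqF//.
by rewrite -scalar_mx_block.
Qed.

Lemma posdef_det (K : realType) (k : nat) (S : 'M[K]_k) : posdef S -> 0 < \det S.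
Proof.
move=> /posdef_whiten[T /(congr1 determinant)]; rewrite !det_mulmx det_tr det1.
rewrite mulrAC -expr2 => E.
have := sqr_ge0 (\det T); rewrite le0r => /orP[/eqP T0|T0].
  by move: E; rewrite T0 mul0r => /eqP; rewrite eq_sym oner_eq0.
by rewrite -(pmulr_rgt0 _ T0) E.
Qed.

(** Both factors of an identity product are invertible. The factorization T'T yields the symmetry
    and positivity of the inverse and turns the form of [invmx S] at e into |T e|^2. *)
Lemma whiten_invmx (K : realType) (k : nat) (S T : 'M[K]_k) :
  T *m S *m T^T = 1%:M -> invmx S = T^T *m T.
Proof.
move=> TST; have [uTS uT] := mulmx1_unit TST.
have ST1 : S *m (T^T *m T) = 1%:M.
  rewrite mulmxA; apply: mulmx1C; rewrite mulmxA; exact: TST.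
have [uS _] := mulmx1_unit ST1.
by rewrite -[LHS]mulmx1 -ST1 mulKmx.
Qed.

(** * Characteristic function of the model *)

(** Inversion agrees with [powR] at exponent -1 on the nonnegative half-line, 0 included, and with
    its odd reflection on the other, so measurability of powers suffices. *)
Lemma measurable_invr (K : realType) : measurable_fun [set: K] (@GRing.inv K).
Proof.
have -> : @GRing.inv K = fun x => if 0 <= x then x `^ (-1) else - ((- x) `^ (-1)).
  apply/funext => x; case: (leP 0 x) => x0; first by rewrite powR_inv1.
  by rewrite powR_inv1 ?oppr_ge0 ?ltW// invrN opprK.
apply: measurable_fun_ifT.
- exact: measurable_fun_ler.
- exact: measurable_powR.
- apply: measurableT_comp => //; apply: (measurableT_comp (@measurable_powR _ (-1))).
  exact: oppr_measurable.
Qed.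

Lemma measurable_mx_coord (K : realType) (a b : nat) (i : 'I_a) (j : 'I_b) :
  measurable_fun setT (fun z : borel_mx K a b => (z : 'M[K]_(a, b)) i j).
Proof.
apply: (measurability (@RGenOpens.G K)).
  exact: RGenOpens.measurableE.
move=> _ [_ [x [y ->]] <-]; rewrite setTI.
apply: sub_sigma_algebra.
apply: open_comp; last exact: interval_open.
by move=> z _; exact: coord_continuous.
Qed.

Lemma measurable_linear_vec (K : realType) (a b : nat) (u : 'cV[K]_(b * a)) :
  measurable_fun setT (fun z : borel_mx K a b => (u^T *m vec (z : 'M[K]_(a, b))) 0 0).
Proof.
under eq_fun do rewrite mulmx_dotE.
apply: measurable_sum => k; apply: measurable_funM => //.
by under eq_fun do rewrite mxE; exact: measurable_mx_coord.
Qed.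


Lemma matrix_normal_image (K : realType) (a b : nat) (U : 'M[K]_a) (V : 'M[K]_b)
    (mu : set 'M[K]_(a, b) -> \bar K) (u : 'cV[K]_(b * a)) (B : set K) :
  is_matrix_normal 0 U V mu -> measurable B ->
  mu ((fun z => (u^T *m vec z) 0 0) @^-1` B) =
  normal_law 0 ((u^T *m (V *t U) *m u) 0 0) B.
Proof.
move=> H mB; have := H u B mB.
have -> : vec (0 : 'M[K]_(a, b)) = 0 by apply/colP => k; rewrite !mxE.
by rewrite mulmx0 mxE.
Qed.

Lemma quad_factor_ge0 (K : realType) (m n : nat) (M : 'M[K]_(m, n)) (u : 'cV[K]_m) :
  0 <= (u^T *m (M *m M^T) *m u) 0 0.
Proof.
have -> : u^T *m (M *m M^T) *m u = (M^T *m u)^T *m (M^T *m u).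
  by rewrite trmx_mul trmxK !mulmxA.
exact: dot_ge0.
Qed.

(** The functional of X - W is the sum of four functionals [l1], ..., [l4] of Z, eps_r, eps_c and
    eps. Their conditional variances are v1/t, ..., v4/t, and expanding the Kronecker product of the
    two sums R R' + Psi_r and C C' + Psi_c shows that v1 + v2 + v3 + v4 = v. The four components are
    absorbed one after the other by [cos_sin_step]. *)
Lemma tBFA_cf (K : realType) (d : measure_display) (Om : measurableType d)
    (P : probability Om K) (dc dr qc qr : nat) (W : 'M[K]_(dc, dr))
    (C : 'M[K]_(dc, qc)) (Psic : 'M[K]_dc) (R : 'M[K]_(dr, qr))
    (Psir : 'M[K]_dr) (nu : K) (X : Om -> 'M[K]_(dc, dr)) :
  pos_diag Psic -> pos_diag Psir ->
  tBFA P W C Psic R Psir nu X ->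
  exists2 m : probability K K, is_gamma (nu / 2) (nu / 2) m &
    forall u : 'cV[K]_(dr * dc),
    let y w := (u^T *m vec (X w - W)) 0 0 in
    let v := (u^T *m ((R *m R^T + Psir) *t (C *m C^T + Psic)) *m u) 0 0 in
    \int[P]_w cos (y w) = \int[m]_(t in `]0, +oo[) expR (- (v / t) / 2) /\
    \int[P]_w sin (y w) = 0.
Proof.
move=> /pos_diag_factor[Dc -> _] /pos_diag_factor[Dr -> _].
move=> [tau [Z [er [ec [e [kZ [kr [kc [ke [gam indep kE XE]]]]]]]]]].
exists (distribution P tau) => // u y v.
set m := distribution P tau.
pose D : set K := `]0, +oo[%classic.
have mD : measurable D by exact: measurable_itv.
have Dpos : D `<=` [set t | 0 < t] by move=> t; rewrite /D /= in_itv/= andbT.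
pose u1 := (R *t C)^T *m u; pose u2 := ((1%:M : 'M[K]_dr) *t C)^T *m u.
pose u3 := (R *t (1%:M : 'M[K]_dc))^T *m u.
pose l1 (z : 'M[K]_(qc, qr)) := (u1^T *m vec z) 0 0.
pose l2 (z : 'M[K]_(qc, dr)) := (u2^T *m vec z) 0 0.
pose l3 (z : 'M[K]_(dc, qr)) := (u3^T *m vec z) 0 0.
pose l4 (z : 'M[K]_(dc, dr)) := (u^T *m vec z) 0 0.
pose V1 w := l1 (Z w); pose V2 w := V1 w + l2 (er w).
pose V3 w := V2 w + l3 (ec w); pose V4 w := V3 w + l4 (e w).
have addE (A B : 'M[K]_1) : (A + B) 0 0 = A 0 0 + B 0 0 by rewrite mxE.
have yE w : y w = V4 w.
  rewrite /y /V4 /V3 /V2 /V1 /l1 /l2 /l3 /l4 /u1 /u2 /u3 XE.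
  have -> : C *m (Z w : 'M[K]_(qc, qr)) *m R^T + W + C *m (er w : 'M[K]_(qc, dr)) +
     (ec w : 'M[K]_(dc, qr)) *m R^T + (e w : 'M[K]_(dc, dr)) - W =
     C *m (Z w : 'M[K]_(qc, qr)) *m R^T + C *m (er w : 'M[K]_(qc, dr)) *m (1%:M)^T +
     1%:M *m (ec w : 'M[K]_(dc, qr)) *m R^T + (e w : 'M[K]_(dc, dr)).
    rewrite trmx1 mulmx1 mul1mx addrAC; congr (_ + _).
    by rewrite addrAC; congr (_ + _); rewrite addrAC addrK.
  rewrite !vecD !vec_mulmx !mulmxDr !addE.
  by rewrite !trmx_mul !trmxK !mulmxA.
pose v1 := (u^T *m ((R *m R^T) *t (C *m C^T)) *m u) 0 0.
pose v2 := (u^T *m ((Dr *m Dr^T) *t (C *m C^T)) *m u) 0 0.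
pose v3 := (u^T *m ((R *m R^T) *t (Dc *m Dc^T)) *m u) 0 0.
pose v4 := (u^T *m ((Dr *m Dr^T) *t (Dc *m Dc^T)) *m u) 0 0.
have vE : v = v1 + v2 + v3 + v4.
  rewrite /v tensmxDl !tensmxDr !mulmxDr !mulmxDl !addE /v1 /v2 /v3 /v4.
  by rewrite -!addrA; congr (_ + _); rewrite addrCA.
have v_ge0 (p q p' q' : nat) (A : 'M[K]_(p, q)) (B : 'M[K]_(p', q')) (x : 'cV[K]_(p * p')) :
    0 <= (x^T *m ((A *m A^T) *t (B *m B^T)) *m x) 0 0.
  by rewrite -tensmx_mul -trmx_tens; exact: quad_factor_ge0.
(* The conditional laws are prescribed for t > 0 only, so this event is kept as a factor from the
   start. *)
pose S0 w : K := \1_D (tau w).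
have mS0 : measurable_fun setT S0.
  by apply: measurableT_comp => //; exact: measurable_indic.
have ind1 (T : Type) (A : set T) (x : T) : `|\1_A x : K| <= 1.
  by rewrite ger0_norm// indicE lern1 leq_b1.
have fk (d' : measure_display) (T : measurableType d') (k : K.-pker K ~> T) (t : K) B : measurable B ->
    `|fine (k t B)| <= 1 /\ k t B = (fine (k t B))%:E.
  move=> mB.
  have k1 : (k t B <= 1)%E.
    rewrite -(@prob_kernel _ _ _ _ _ k t); apply: le_measure; rewrite ?inE//.
  have kf : k t B \is a fin_num.
    by rewrite ge0_fin_numE// (le_lt_trans k1)// ltry.
  rewrite fineK//; split => //; rewrite ger0_norm ?fine_ge0//.
  by rewrite -lee_fin fineK.
have mk (d' : measure_display) (T : measurableType d') (k : K.-pker K ~> T) B :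
    measurable B -> measurable_fun setT (fun t => fine (k t B)).
  by move=> mB; apply: measurableT_comp => //; exact: measurable_kernel.
have le1M (a b : K) : `|a| <= 1 -> `|b| <= 1 -> `|a * b| <= 1.
  by move=> a1 b1; rewrite normrM -[leRHS]mulr1 ler_pM.
have mi (d' : measure_display) (T : measurableType d') (f : {mfun Om >-> T}) (B : set T) :
   measurable B -> measurable_fun setT (fun w => \1_B (f w) : K).
  by move=> mB; apply: measurableT_comp => //; exact: measurable_indic.
have base B1 B2 B3 B4 : measurable B1 -> measurable B2 -> measurable B3 -> measurable B4 ->
   \int[P]_w (S0 w * \1_B2 (er w) * \1_B3 (ec w) * \1_B4 (e w) * \1_B1 (Z w)) =
   \int[m]_(t in D) (fine (kr t B2) * fine (kc t B3) * fine (ke t B4) * fine (kZ t B1)).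
  move=> m1 m2 m3 m4; congr fine.
  transitivity (P (tau @^-1` D `&` Z @^-1` B1 `&` er @^-1` B2 `&` ec @^-1` B3 `&` e @^-1` B4)).
    have mA : measurable (tau @^-1` D `&` Z @^-1` B1 `&` er @^-1` B2 `&` ec @^-1` B3 `&` e @^-1` B4).
      by repeat apply: measurableI; rewrite -[X in measurable X]setTI; exact: measurable_funP.
    set A := (X in measurable X) in mA.
    transitivity (\int[P]_w (\1_A w)%:E)%E; last by rewrite integral_indic// setIT.
    apply: eq_integral => w _; congr (_%:E).
    rewrite /S0 /A !indicI /=.
    have pre (T : Type) (f : Om -> T) (B : set T) : \1_(f @^-1` B) w = \1_B (f w) :> K.
      by rewrite !indicE; congr (nat_of_bool _)%:R; apply/idP/idP; rewrite !inE.
    by rewrite !pre; ring.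
  rewrite indep//; apply: eq_integral => t _.
  have [_ ->] := fk _ _ kZ t _ m1; have [_ ->] := fk _ _ kr t _ m2.
  have [_ ->] := fk _ _ kc t _ m3; have [_ ->] := fk _ _ ke t _ m4.
  by rewrite -!EFinM /=; congr (_%:E); ring.
have quadE (p : nat) (M : 'M[K]_(dr * dc, p)) (B : 'M[K]_p) (t : K) :
    ((M^T *m u)^T *m (t^-1 *: B) *m (M^T *m u)) 0 0 =
    (u^T *m (M *m B *m M^T) *m u) 0 0 / t.
  rewrite trmx_mul trmxK -scalemxAr -scalemxAl [LHS]mxE mulrC !mulmxA.
  by [].
have law1 (t : K) B : 0 < t -> measurable B -> kZ t (l1 @^-1` B) = normal_law 0 (v1 / t) B.
  move=> /kE[k1 _ _ _] mB; rewrite [LHS](matrix_normal_image u1 k1 mB).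
  rewrite -(scalemx1 _ t^-1) tensmxZr tensmx1 /u1 quadE mulmx1 trmx_tens tensmx_mul.
  by [].
have law2 (t : K) B : 0 < t -> measurable B -> kr t (l2 @^-1` B) = normal_law 0 (v2 / t) B.
  move=> /kE[_ k1 _ _] mB; rewrite [LHS](matrix_normal_image u2 k1 mB).
  rewrite -(scalemx1 _ t^-1) tensmxZr /u2 quadE trmx_tens !tensmx_mul mulmx1 mul1mx trmx1 mulmx1.
  by [].
have law3 (t : K) B : 0 < t -> measurable B -> kc t (l3 @^-1` B) = normal_law 0 (v3 / t) B.
  move=> /kE[_ _ k1 _] mB; rewrite [LHS](matrix_normal_image u3 k1 mB).
  rewrite tensmxZr /u3 quadE trmx_tens !tensmx_mul mulmx1 mul1mx trmx1 mulmx1.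
  by [].
have law4 (t : K) B : 0 < t -> measurable B -> ke t (l4 @^-1` B) = normal_law 0 (v4 / t) B.
  move=> /kE[_ _ _ k1] mB; rewrite [LHS](matrix_normal_image u k1 mB).
  have := quadE _ 1%:M ((Dr *m Dr^T) *t (Dc *m Dc^T)) t.
  by rewrite trmx1 !mul1mx mulmx1 tensmxZr => ->.
have ml1 : measurable_fun setT (l1 : borel_mx K qc qr -> K) by exact: measurable_linear_vec.
have ml2 : measurable_fun setT (l2 : borel_mx K qc dr -> K) by exact: measurable_linear_vec.
have ml3 : measurable_fun setT (l3 : borel_mx K dc qr -> K) by exact: measurable_linear_vec.
have ml4 : measurable_fun setT (l4 : borel_mx K dc dr -> K) by exact: measurable_linear_vec.
have mlf (T : measurableType _) (f : {mfun Om >-> T}) (l : T -> K) :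
    measurable_fun setT l -> measurable_fun setT (fun w => l (f w)).
  by move=> ml; exact: measurableT_comp.
have mV1 : measurable_fun setT V1 by exact: measurableT_comp.
have mV2 : measurable_fun setT V2.
  by apply: measurable_funD => //; exact: measurableT_comp.
have mV3 : measurable_fun setT V3.
  by apply: measurable_funD => //; exact: measurableT_comp.
(* Conditional characteristic function of an accumulated part of variance s / t; the value 0 off t >
   0 makes the bound by 1 hold for every t. *)
pose ph (s t : K) : K := if 0 < t then expR (- (s / t) / 2) else 0.
have mph s : measurable_fun setT (ph s).
  apply: measurable_fun_ifT => //.
    by apply: measurable_fun_ltr.
  apply: measurableT_comp => //; apply: measurable_funM => //.
  by apply: measurableT_comp => //; apply: measurable_funM => //; exact: measurable_invr.
have ph1 s t : 0 <= s -> `|ph s t| <= 1.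
  move=> s0; rewrite /ph; case: ifP => [t0|_]; last by rewrite normr0.
  rewrite ger0_norm ?expR_ge0// -[leRHS]expR0 ler_expR.
  by rewrite mulNr oppr_le0 divr_ge0// divr_ge0// ltW.
have v10 : 0 <= v1 by exact: v_ge0.
have v20 : 0 <= v2 by exact: v_ge0.
have v30 : 0 <= v3 by exact: v_ge0.
have v40 : 0 <= v4 by exact: v_ge0.
have phD s s' (g : K -> K) : \int[m]_(t in D) (ph s t * expR (- (s' / t) / 2) * g t) =
    \int[m]_(t in D) (ph (s + s') t * g t).
  apply: eq_Rintegral => t; rewrite inE => /Dpos /= t0; congr (_ * _).
  by rewrite /ph t0 -expRD; congr expR; ring.
have mZ0 : measurable_fun setT Z by exact: measurable_funP.
have mer0 : measurable_fun setT er by exact: measurable_funP.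
have mec0 : measurable_fun setT ec by exact: measurable_funP.
have me0 : measurable_fun setT e by exact: measurable_funP.
have b0 w : `|S0 w| <= 1 by exact: ind1.
have st1 B2 B3 B4 : measurable B2 -> measurable B3 -> measurable B4 ->
   \int[P]_w (cos (V1 w) * (S0 w * \1_B3 (ec w) * \1_B4 (e w)) * \1_B2 (er w)) =
   \int[m]_(t in D) (ph v1 t * (fine (kc t B3) * fine (ke t B4)) * fine (kr t B2)) /\
   \int[P]_w (sin (V1 w) * (S0 w * \1_B3 (ec w) * \1_B4 (e w)) * \1_B2 (er w)) = 0.
  move=> m2 m3 m4.
  pose S w := S0 w * \1_B2 (er w) * \1_B3 (ec w) * \1_B4 (e w).
  pose S' t := fine (kr t B2) * fine (kc t B3) * fine (ke t B4).
  have mS : measurable_fun setT S.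
    apply: measurable_funM; last exact: mi.
    by apply: measurable_funM; [apply: measurable_funM; [exact: mS0|exact: mi]|exact: mi].
  have mS' : measurable_fun setT S'.
    by apply: measurable_funM; [apply: measurable_funM; exact: mk|exact: mk].
  have S1 w : `|S w| <= 1.
    by apply: (le1M); [apply: (le1M); [apply: (le1M); [exact: (b0)|exact: ind1]|exact: ind1]|exact: ind1].
  have S'1 t : `|S' t| <= 1.
    apply: (le1M); [apply: (le1M)|].
    - by case: (fk _ _ kr t _ m2).
    - by case: (fk _ _ kc t _ m3).
    - by case: (fk _ _ ke t _ m4).
  (* The recursion starts from V = 0, whose conditional characteristic function [ph 0] equals 1 for
     t > 0. *)
  have Hc B : measurable B -> \int[P]_w (cos ((fun=> 0 : K) w) * S w * \1_B (Z w)) =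
     \int[m]_(t in D) (ph 0 t * S' t * fine (kZ t B)).
    move=> mB; under eq_Rintegral do rewrite cos0 mul1r.
    rewrite base//; apply: eq_Rintegral => t; rewrite inE => /Dpos /= t0.
    by rewrite /ph t0 mul0r oppr0 mul0r expR0 mul1r.
  have Hs B : measurable B -> \int[P]_w (sin ((fun=> 0 : K) w) * S w * \1_B (Z w)) = 0.
    move=> mB; under eq_Rintegral do rewrite sin0 !mul0r.
    by rewrite Rintegral_cst// mul0r.
  have [] := @cos_sin_step K _ _ Om _ P m D kZ Z (fun=> 0) S (ph 0) S' l1 v1 mD Dpos mZ0
    (measurable_cst (0 : K)) mS (mph 0) mS' ml1 S1 S'1 (fun t => ph1 0 t (lexx 0)) v10 law1 Hc Hs.
  rewrite phD add0r => E1 E2; split.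
    transitivity (\int[m]_(t in D) (ph v1 t * S' t)); last first.
      by apply: eq_Rintegral => t _; rewrite /S'; ring.
    by rewrite -E1; apply: eq_Rintegral => w _; rewrite add0r /S; ring.
  by rewrite -[RHS]E2; apply: eq_Rintegral => w _; rewrite add0r /S; ring.
have st2 B3 B4 : measurable B3 -> measurable B4 ->
   \int[P]_w (cos (V2 w) * (S0 w * \1_B4 (e w)) * \1_B3 (ec w)) =
   \int[m]_(t in D) (ph (v1 + v2) t * fine (ke t B4) * fine (kc t B3)) /\
   \int[P]_w (sin (V2 w) * (S0 w * \1_B4 (e w)) * \1_B3 (ec w)) = 0.
  move=> m3 m4.
  pose S w := S0 w * \1_B3 (ec w) * \1_B4 (e w).
  pose S' t := fine (kc t B3) * fine (ke t B4).
  have mS : measurable_fun setT S.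
    by apply: measurable_funM; [apply: measurable_funM; [exact: mS0|exact: mi]|exact: mi].
  have mS' : measurable_fun setT S' by apply: measurable_funM; exact: mk.
  have S1 w : `|S w| <= 1.
    by apply: (le1M); [apply: (le1M); [exact: (b0)|exact: ind1]|exact: ind1].
  have S'1 t : `|S' t| <= 1.
    apply: (le1M).
    - by case: (fk _ _ kc t _ m3).
    - by case: (fk _ _ ke t _ m4).
  have [] := @cos_sin_step K _ _ Om _ P m D kr er V1 S (ph v1) S' l2 v2 mD Dpos mer0
    mV1 mS (mph _) mS' ml2 S1 S'1 (fun t => ph1 _ t v10) v20 law2
    (fun B mB => (st1 B B3 B4 mB m3 m4).1) (fun B mB => (st1 B B3 B4 mB m3 m4).2).
  rewrite phD => E1 E2; split.
    transitivity (\int[m]_(t in D) (ph (v1 + v2) t * S' t)); last first.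
      by apply: eq_Rintegral => t _; rewrite /S'; ring.
    by rewrite -E1; apply: eq_Rintegral => w _; rewrite /S; ring.
  by rewrite -[RHS]E2; apply: eq_Rintegral => w _; rewrite /S; ring.
have st3 B4 : measurable B4 ->
   \int[P]_w (cos (V3 w) * S0 w * \1_B4 (e w)) =
   \int[m]_(t in D) (ph (v1 + v2 + v3) t * 1 * fine (ke t B4)) /\
   \int[P]_w (sin (V3 w) * S0 w * \1_B4 (e w)) = 0.
  move=> m4.
  pose S w := S0 w * \1_B4 (e w).
  pose S' t := fine (ke t B4).
  have mS : measurable_fun setT S.
    by apply: measurable_funM; [exact: mS0|exact: mi].
  have mS' : measurable_fun setT S' by exact: mk.
  have S1 w : `|S w| <= 1 by apply: (le1M); [exact: (b0)|exact: ind1].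
  have S'1 t : `|S' t| <= 1 by case: (fk _ _ ke t _ m4).
  have v120 : 0 <= v1 + v2 by exact: addr_ge0.
  have [] := @cos_sin_step K _ _ Om _ P m D kc ec V2 S (ph (v1 + v2)) S' l3 v3 mD Dpos mec0
    mV2 mS (mph _) mS' ml3 S1 S'1 (fun t => ph1 _ t v120) v30 law3
    (fun B mB => (st2 B B4 mB m4).1) (fun B mB => (st2 B B4 mB m4).2).
  rewrite phD => E1 E2; split.
    transitivity (\int[m]_(t in D) (ph (v1 + v2 + v3) t * S' t)); last first.
      by apply: eq_Rintegral => t _; rewrite mulr1.
    by rewrite -E1; apply: eq_Rintegral => w _; rewrite /S mulrA.
  by rewrite -[RHS]E2; apply: eq_Rintegral => w _; rewrite /S mulrA.
have v1230 : 0 <= v1 + v2 + v3 by rewrite !addr_ge0.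
have c1 (t : K) : `|(fun=> 1 : K) t| <= 1 by rewrite normr1.
have [] := @cos_sin_step K _ _ Om _ P m D ke e V3 S0 (ph (v1 + v2 + v3)) (fun=> 1) l4 v4 mD Dpos me0
    mV3 mS0 (mph _) (measurable_cst (1 : K)) ml4 b0 c1 (fun t => ph1 _ t v1230) v40 law4
    (fun B mB => (st3 B mB).1) (fun B mB => (st3 B mB).2).
rewrite phD -vE => E1 E2.
have S0ae : P (~` (tau @^-1` D)) = 0%E.
  have -> : P (~` (tau @^-1` D)) = distribution P tau (~` D) by [].
  rewrite gam; last exact: measurableC.
  apply: integral0_eq => t /=; rewrite /D /= in_itv/= andbT => /negP.
  by rewrite -leNgt /gamma_pdf => t0; rewrite ltNge t0.
have mV4 : measurable_fun setT V4.
  by apply: measurable_funD; [exact: mV3|exact: mlf].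
have drop (f : K -> K) : measurable_fun setT f ->
   \int[P]_w (f (y w)) = \int[P]_w (f (V4 w) * S0 w).
  move=> mf; congr fine; apply: ae_eq_integral => //.
  - apply/measurable_EFinP; rewrite (_ : (fun w => f (y w)) = f \o V4).
      exact: measurableT_comp.
    by apply/funext => w /=; rewrite yE.
  - apply/measurable_EFinP; apply: measurable_funM => //.
    exact: measurableT_comp.
  - exists (~` (tau @^-1` D)); split => //.
      apply: measurableC; rewrite -[X in measurable X]setTI; exact: measurable_funP.
    move=> w /= H Dw; apply: H => _; rewrite yE /S0 indicE mem_set ?mulr1//.
split.
  rewrite drop; last exact: measurable_cos.
  rewrite E1; apply: eq_Rintegral => t; rewrite inE => /Dpos /= t0.
  by rewrite /ph t0 mulr1.
by rewrite drop//; exact: measurable_sin.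
Qed.

(** * Gaussian tilting *)

Lemma Fubini_normal (K : realType) (d : measure_display) (T : measurableType d)
    (P : probability T K) (s M : K) (F : T -> K -> K) :
  measurable_fun setT (fun x : T * measurableTypeR K => F x.1 x.2) ->
  (forall w g, `|F w g| <= M) ->
  \int[P]_w \int[lebesgue_measure]_g (normal_pdf 0 s g * F w g) =
  \int[lebesgue_measure]_g (normal_pdf 0 s g * \int[P]_w F w g).
Proof.
move=> mF FM.
pose f (x : T * measurableTypeR K) : \bar K := (normal_pdf 0 s x.2 * F x.1 x.2)%:E.
have mpdf : measurable_fun setT (fun x : T * measurableTypeR K => normal_pdf 0 s x.2).
  by apply: (measurableT_comp (@measurable_normal_pdf K 0 s)); exact: measurable_snd.
have mf : measurable_fun setT f by apply/measurable_EFinP; exact: measurable_funM.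
have mFw w : measurable_fun setT (F w).
  exact: (measurableT_comp mF (pair1_measurable w)).
have mFg g : measurable_fun setT (F ^~ g).
  exact: (measurableT_comp mF (pair2_measurable g)).
have iw w : lebesgue_measure.-integrable [set: K] (fun g => (normal_pdf 0 s g * F w g)%:E).
  by apply: integrable_normal_mul; [exact: mFw|exact: FM].
have imf : (P \x lebesgue_measure)%E.-integrable setT f.
  apply/integrable12ltyP => //.
  apply: (@le_lt_trans _ _ (\int[P]_w M%:E)%E); last first.
    rewrite integral_cst// [X in (_ * X)%E](_ : _ = 1%E) ?mule1 ?ltry//.
    exact: probability_setT.
  apply: ge0_le_integral => //.
  - by move=> w _; exact: integral_ge0.
  - apply: (measurable_fun_fubini_tonelli_F (abse \o f)).
    + exact: measurableT_comp.
    + by move=> x; exact: abse_ge0.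
  - move=> w _.
    apply: (@le_trans _ _ (\int[lebesgue_measure]_g (M%:E * (normal_pdf 0 s g)%:E))%E).
      apply: ge0_le_integral => //.
      + by apply: measurableT_comp => //; exact: (measurable_int _ (iw w)).
      + apply/measurable_EFinP; apply: measurable_funM => //.
        exact: measurable_normal_pdf.
      + move=> g _; rewrite /f/= lee_fin normrM ger0_norm ?normal_pdf_ge0// mulrC.
        by rewrite ler_wpM2r ?normal_pdf_ge0.
    rewrite integralZl//; last exact: integrable_normal_pdf.
    by rewrite integral_normal_pdf mule1.
have := Fubini imf; rewrite /f /=.
have -> : (\int[P]_x \int[lebesgue_measure]_y (normal_pdf 0 s y * F x y)%:E =
   \int[P]_x (\int[lebesgue_measure]_y (normal_pdf 0 s y * F x y))%:E)%E.
  by apply: eq_integral => w _; rewrite (Rintegral_EFin measurableT (iw w)).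
have -> : (\int[lebesgue_measure]_y \int[P]_x (normal_pdf 0 s y * F x y)%:E =
   \int[lebesgue_measure]_y (normal_pdf 0 s y * \int[P]_x F x y)%:E)%E.
  apply: eq_integral => g _; rewrite Rintegral_EFin//.
    rewrite RintegralZl//.
    by apply: (bounded_integrable (probability_setT _)) => //; exact: mFg.
  apply: (bounded_integrable (probability_setT _) (M := normal_pdf 0 s g * M)) => //.
    by apply: measurable_funM => //; exact: mFg.
  by move=> w; rewrite normrM ger0_norm ?normal_pdf_ge0// ler_wpM2l ?normal_pdf_ge0.
by rewrite /Rintegral => ->.
Qed.

(** Completing the square in g: the product of the two exponentials is a Gaussian of variance [s2] =
    u t / (t + u) centred at - b u / (t + u), times a factor free of g. The ratio of the peaks is
    sqrt (t / (t + u)). *)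
Lemma normal_gauss (K : realType) (u t b : K) : 0 < u -> 0 < t ->
  \int[lebesgue_measure]_g (normal_pdf 0 (Num.sqrt u) g * expR (- ((b + g) ^+ 2 / t) / 2)) =
  Num.sqrt (t / (t + u)) * expR (- (b ^+ 2 / (t + u)) / 2).
Proof.
move=> u0 t0; have tu0 : 0 < t + u by exact: addr_gt0.
pose s2 := u * t / (t + u).
have s20 : 0 < s2 by rewrite divr_gt0// mulr_gt0.
have su0 : Num.sqrt u != 0 by rewrite gt_eqF// sqrtr_gt0.
have ss0 : Num.sqrt s2 != 0 by rewrite gt_eqF// sqrtr_gt0.
have peak : normal_peak (Num.sqrt u) =
    normal_peak (Num.sqrt s2) * Num.sqrt (t / (t + u)).
  have E : s2 * pi *+ 2 = (u * pi *+ 2) * (t / (t + u)).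
    by rewrite /s2 !mulr2n; field; rewrite gt_eqF.
  have up : 0 <= u * pi *+ 2 by rewrite mulrn_wge0// mulr_ge0 ?ltW// pi_gt0.
  have r0 : Num.sqrt (t / (t + u)) != 0 by rewrite gt_eqF// sqrtr_gt0 divr_gt0.
  rewrite /normal_peak !sqr_sqrtr ?ltW// E sqrtrM//.
  by rewrite invfM -mulrA mulVf ?mulr1.
transitivity (\int[lebesgue_measure]_g
    (Num.sqrt (t / (t + u)) * expR (- (b ^+ 2 / (t + u)) / 2) *
     normal_pdf (- (b * u / (t + u))) (Num.sqrt s2) g)).
  apply: eq_Rintegral => g _; rewrite !normal_pdfE// peak.
  rewrite /normal_fun subr0 !sqr_sqrtr ?ltW//.
  have E2 : expR (- g ^+ 2 / (u *+ 2)) * expR (- ((b + g) ^+ 2 / t) / 2) =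
     expR (- (b ^+ 2 / (t + u)) / 2) *
     expR (- (g - - (b * u / (t + u))) ^+ 2 / (s2 *+ 2)).
    rewrite -!expRD; congr expR; rewrite /s2 !mulr2n; field.
    by rewrite !gt_eqF ?addr_gt0 ?mulr_gt0.
  by rewrite -[LHS]mulrA E2; ring.
rewrite RintegralZl//; last exact: integrable_normal_pdf.
by rewrite /Rintegral integral_normal_pdf mulr1.
Qed.

(** By the addition formulas only the mean of cos (z g) survives, the mean of sin (z g) being 0 by
    oddness. A Gaussian shift along one coordinate thus multiplies both functions by exp(- u z^2 /
    2). *)
Lemma normal_cos_shift (K : realType) (u a z : K) : 0 < u ->
  \int[lebesgue_measure]_g (normal_pdf 0 (Num.sqrt u) g * cos (a + g * z)) =
    cos a * expR (- (u * z ^+ 2) / 2) /\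
  \int[lebesgue_measure]_g (normal_pdf 0 (Num.sqrt u) g * sin (a + g * z)) =
    sin a * expR (- (u * z ^+ 2) / 2).
Proof.
move=> u0; have s0 : Num.sqrt u != 0 by rewrite gt_eqF// sqrtr_gt0.
set s := Num.sqrt u in s0 *.
have c := normal_cf z s0; rewrite exprMn sqr_sqrtr ?ltW// in c.
have ic := integrable_normal_mul s (@measurable_cosM _ z) (fun x => cos_max (z * x)).
have is' := integrable_normal_mul s (@measurable_sinM _ z) (fun x => sin_max (z * x)).
have sn : \int[lebesgue_measure]_g (normal_pdf 0 s g * sin (z * g)) = 0.
  apply: Rintegral_lebesgue_odd => //.
  by move=> x; rewrite normal_pdf0N// mulrN sinN mulrN.
split.
- transitivity (\int[lebesgue_measure]_g (cos a * (normal_pdf 0 s g * cos (z * g)) -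
     sin a * (normal_pdf 0 s g * sin (z * g)))).
    by apply: eq_Rintegral => g _; rewrite cosD [g * z]mulrC; ring.
  rewrite RintegralB//; last 2 first.
  + exact: (integrableZl measurableT (cos a) ic).
  + exact: (integrableZl measurableT (sin a) is').
  by rewrite !RintegralZl// c sn mulr0 subr0.
- transitivity (\int[lebesgue_measure]_g (sin a * (normal_pdf 0 s g * cos (z * g)) +
     cos a * (normal_pdf 0 s g * sin (z * g)))).
    by apply: eq_Rintegral => g _; rewrite sinD [g * z]mulrC; ring.
  rewrite RintegralD//; last 2 first.
  + exact: (integrableZl measurableT (sin a) ic).
  + exact: (integrableZl measurableT (cos a) is').
  by rewrite !RintegralZl// c sn mulr0 addr0.
Qed.

Lemma measurable_sqrt (K : realType) : measurable_fun [set: K] (@Num.sqrt K).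
Proof. by apply: continuous_measurable_fun; exact: sqrt_continuous. Qed.

(* Laplace transform in [u] of the squares of the coordinates listed in [s],
   jointly with the characteristic function at [b], of N(0, I / t). *)
Definition tilt (K : realType) (p : nat) (u : K) (s : seq 'I_p) (b : 'I_p -> K) (t : K) : K :=
  if 0 < t then Num.sqrt (t / (t + u)) ^+ size s *
    expR (- (\sum_k b k ^+ 2 / (t + (k \in s)%:R * u)) / 2) else 0.

Lemma tilt_bound (K : realType) (p : nat) (u : K) (s : seq 'I_p) (b : 'I_p -> K) (t : K) :
  0 < u -> `|tilt u s b t| <= 1.
Proof.
move=> u0; rewrite /tilt; case: ifP => [t0|_]; last by rewrite normr0.
have tu0 : 0 < t + u by exact: addr_gt0.
rewrite ger0_norm ?mulr_ge0 ?expR_ge0 ?exprn_ge0 ?sqrtr_ge0//.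
rewrite -[leRHS]mulr1 ler_pM ?expR_ge0 ?exprn_ge0 ?sqrtr_ge0//.
  rewrite exprn_ile1 ?sqrtr_ge0// -[leRHS]sqrtr1 ler_sqrt//.
  by rewrite ler_pdivrMr// mul1r lerDl ltW.
rewrite -[leRHS]expR0 ler_expR mulNr oppr_le0 divr_ge0// sumr_ge0// => k _.
by rewrite divr_ge0 ?sqr_ge0// addr_ge0 ?(ltW t0)// mulr_ge0// ltW.
Qed.

(** Only the summand at [k0] depends on g, and its denominator is still t because [k0] is not in
    [s]. By [normal_gauss] the denominator becomes t + u and one more factor sqrt (t / (t + u))
    appears. *)
Lemma tilt_step (K : realType) (p : nat) (u : K) (s : seq 'I_p) (k0 : 'I_p)
    (b : 'I_p -> K) (t : K) : 0 < u -> k0 \notin s ->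
  \int[lebesgue_measure]_g (normal_pdf 0 (Num.sqrt u) g *
    tilt u s (fun k => b k + g * (k == k0)%:R) t) = tilt u (k0 :: s) b t.
Proof.
move=> u0 k0s; rewrite /tilt; case: ifP => t0; last first.
  by under eq_Rintegral do rewrite mulr0; rewrite Rintegral_cst// mul0r.
pose A := Num.sqrt (t / (t + u)) ^+ size s *
  expR (- (\sum_(k | k != k0) b k ^+ 2 / (t + (k \in s)%:R * u)) / 2).
transitivity (\int[lebesgue_measure]_g (A *
   (normal_pdf 0 (Num.sqrt u) g * expR (- ((b k0 + g) ^+ 2 / t) / 2)))).
  apply: eq_Rintegral => g _; rewrite [in LHS](bigD1 k0)//= eqxx mulr1 (negbTE k0s).
  rewrite mul0r addr0 (eq_bigr (fun k => b k ^+ 2 / (t + (k \in s)%:R * u))).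
    by rewrite opprD mulrDl expRD /A; ring.
  by move=> k /negbTE ->; rewrite mulr0 addr0.
rewrite RintegralZl//; last first.
  apply: (@integrable_normal_mul _ _ (fun g => expR (- ((b k0 + g) ^+ 2 / t) / 2)) 1).
    apply: continuous_measurable_fun => g; apply: continuous_comp; last exact: continuous_expR.
    apply: cvgM; last exact: cvg_cst; apply: cvgN; apply: cvgM; last exact: cvg_cst.
    by apply: cvgM; apply: cvgD; (exact: cvg_cst || exact: cvg_id).
  move=> g; rewrite ger0_norm ?expR_ge0// -[leRHS]expR0 ler_expR mulNr oppr_le0.
  by rewrite divr_ge0// divr_ge0 ?sqr_ge0// ltW.
rewrite normal_gauss// /A [in RHS](bigD1 k0)//= inE eqxx mul1r [_ ^+ (size s).+1]exprS.
rewrite [in RHS](eq_bigr (fun k => b k ^+ 2 / (t + (k \in s)%:R * u))).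
  by rewrite opprD mulrDl expRD; move: (_ ^+ size s) => X; ring.
by move=> k /negbTE kk0; rewrite inE kk0.
Qed.

Lemma measurable_tilt (K : realType) (p : nat) (d : measure_display) (T : measurableType d)
   (u : K) (s : seq 'I_p) (b : T -> 'I_p -> K) (t : T -> K) :
  measurable_fun setT t -> (forall k, measurable_fun setT (b ^~ k)) ->
  measurable_fun setT (fun x => tilt u s (b x) (t x)).
Proof.
move=> mt mb; apply: measurable_fun_ifT => //; first exact: measurable_fun_ltr.
apply: measurable_funM.
  apply: measurable_funX; apply: (measurableT_comp (@measurable_sqrt K)).
  apply: measurable_funM => //; apply: (measurableT_comp (@measurable_invr K)).
  exact: measurable_funD.
apply: measurableT_comp => //; apply: measurable_funM => //; apply: measurableT_comp => //.
apply: measurable_sum => k; apply: measurable_funM.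
  exact: measurable_funX.
by apply: (measurableT_comp (@measurable_invr K)); exact: measurable_funD.
Qed.

(** Induction on the list of tilted coordinates. The induction hypothesis, taken at b + g e_k0, is
    averaged over g of law N(0, u). After exchanging the integrals, the left side acquires exp(- u
    z_k0^2 / 2) by [normal_cos_shift] and the right side is [tilt_step]. Uniqueness of [s] lets each
    coordinate be tilted once. *)
Lemma cf_tilt (K : realType) (d : measure_display) (Om : measurableType d)
    (P : probability Om K) (m : probability K K) (p : nat) (z : Om -> 'I_p -> K) (u : K) :
  0 < u -> (forall k, measurable_fun setT (z ^~ k)) ->
  (forall b : 'I_p -> K,
    \int[P]_w cos (\sum_k b k * z w k) = \int[m]_t tilt u [::] b t /\
    \int[P]_w sin (\sum_k b k * z w k) = 0) ->
  forall s b, uniq s ->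
  \int[P]_w (cos (\sum_k b k * z w k) * expR (- (\sum_(k <- s) u * z w k ^+ 2) / 2)) =
    \int[m]_t tilt u s b t /\
  \int[P]_w (sin (\sum_k b k * z w k) * expR (- (\sum_(k <- s) u * z w k ^+ 2) / 2)) = 0.
Proof.
move=> u0 mz cf; elim=> [|k0 s IH] b /=.
  move=> _; have [cE sE] := cf b; split.
    by rewrite -cE; apply: eq_Rintegral => w _; rewrite big_nil oppr0 mul0r expR0 mulr1.
  by rewrite -[RHS]sE; apply: eq_Rintegral => w _; rewrite big_nil oppr0 mul0r expR0 mulr1.
move=> /andP[k0s us].
pose bg g k := b k + g * (k == k0)%:R.
pose e w := expR (- (\sum_(k <- s) u * z w k ^+ 2) / 2).
have bgE g w : \sum_k bg g k * z w k = \sum_k b k * z w k + g * z w k0.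
  rewrite /bg; under eq_bigr do rewrite mulrDl; rewrite big_split/=; congr (_ + _).
  rewrite (bigD1 k0)//= eqxx mulr1 big1 ?addr0// => k /negbTE ->.
  by rewrite mulr0 mul0r.
have e1 w : `|e w| <= 1.
  rewrite /e ger0_norm ?expR_ge0// -[leRHS]expR0 ler_expR mulNr oppr_le0 divr_ge0//.
  by rewrite sumr_ge0// => k _; rewrite mulr_ge0 ?sqr_ge0// ltW.
have me : measurable_fun setT e.
  apply: measurableT_comp => //; apply: measurable_funM => //; apply: measurableT_comp => //.
  by apply: measurable_sum => k; apply: measurable_funM => //; exact: measurable_funX.
have mlin (c : 'I_p -> K) : measurable_fun setT (fun w => \sum_k c k * z w k).
  by apply: measurable_sum => k; apply: measurable_funM.
have mcomp (f : K -> K) : measurable_fun setT f ->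
    measurable_fun setT (fun x : Om * measurableTypeR K =>
      f (\sum_k bg x.2 k * z x.1 k) * e x.1).
  move=> mf; apply: measurable_funM; last exact: (measurableT_comp me measurable_fst).
  apply: (measurableT_comp mf).
  under eq_fun do rewrite bgE.
  apply: measurable_funD.
    exact: (measurableT_comp (mlin b) measurable_fst).
  apply: measurable_funM; first exact: measurable_snd.
  exact: (measurableT_comp (mz k0) measurable_fst).
have bcomp (f : K -> K) : (forall x, `|f x| <= 1) ->
    forall w g, `|f (\sum_k bg g k * z w k) * e w| <= 1.
  by move=> f1 w g; rewrite normrM -[leRHS]mulr1 ler_pM.
have split_exp w : expR (- (\sum_(k <- k0 :: s) u * z w k ^+ 2) / 2) =
    expR (- (u * z w k0 ^+ 2) / 2) * e w.
  by rewrite big_cons opprD mulrDl expRD.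
have inner (f : K -> K) w :
    \int[lebesgue_measure]_g (normal_pdf 0 (Num.sqrt u) g * (f (\sum_k bg g k * z w k) * e w)) =
    \int[lebesgue_measure]_g (normal_pdf 0 (Num.sqrt u) g * f (\sum_k b k * z w k + g * z w k0) * e w).
  by apply: eq_Rintegral => g _; rewrite bgE mulrA.
split.
- transitivity (\int[P]_w \int[lebesgue_measure]_g (normal_pdf 0 (Num.sqrt u) g *
    (cos (\sum_k bg g k * z w k) * e w))).
    apply: eq_Rintegral => w _; rewrite inner RintegralZr//.
      have [-> _] := normal_cos_shift (\sum_k b k * z w k) (z w k0) u0.
      by rewrite split_exp mulrA.
    apply: (@integrable_normal_mul _ _ (fun g => cos (\sum_k b k * z w k + g * z w k0)) 1).
      apply: (measurableT_comp (@measurable_cos K)).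
      by apply: measurable_funD => //; exact: measurable_funM.
    by move=> g; exact: cos_max.
  rewrite (@Fubini_normal _ _ _ P (Num.sqrt u) 1 (fun w g => cos (\sum_k bg g k * z w k) * e w)); last 2 first.
  + exact: mcomp (@measurable_cos K).
  + exact: bcomp (@cos_max K).
  transitivity (\int[lebesgue_measure]_g (normal_pdf 0 (Num.sqrt u) g * \int[m]_t tilt u s (bg g) t)).
    by apply: eq_Rintegral => g _; have [-> _] := IH (bg g) us.
  rewrite -(@Fubini_normal _ _ _ m (Num.sqrt u) 1 (fun t g => tilt u s (bg g) t)); last 2 first.
  + apply: (@measurable_tilt K p _ _ u s (fun x => bg x.2) fst); first exact: measurable_fst.
    move=> k; apply: measurable_funD => //; apply: measurable_funM => //.
  + by move=> t g; exact: tilt_bound.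
  by apply: eq_Rintegral => t _; rewrite tilt_step.
- transitivity (\int[P]_w \int[lebesgue_measure]_g (normal_pdf 0 (Num.sqrt u) g *
    (sin (\sum_k bg g k * z w k) * e w))).
    apply: eq_Rintegral => w _; rewrite inner RintegralZr//.
      have [_ ->] := normal_cos_shift (\sum_k b k * z w k) (z w k0) u0.
      by rewrite split_exp mulrA.
    apply: (@integrable_normal_mul _ _ (fun g => sin (\sum_k b k * z w k + g * z w k0)) 1).
      apply: (measurableT_comp (@measurable_sin K)).
      by apply: measurable_funD => //; exact: measurable_funM.
    by move=> g; exact: sin_max.
  rewrite (@Fubini_normal _ _ _ P (Num.sqrt u) 1 (fun w g => sin (\sum_k bg g k * z w k) * e w)); last 2 first.
  + exact: mcomp (@measurable_sin K).
  + exact: bcomp (@sin_max K).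
  transitivity (\int[@lebesgue_measure K]_g (cst (0 : K) g)).
    by apply: eq_Rintegral => g _; have [_ ->] := IH (bg g) us; rewrite mulr0.
  by rewrite Rintegral_cst// mul0r.
Qed.

Lemma bounded_convergence (K : realType) (d : measure_display) (T : measurableType d)
    (P : probability T K) (f : nat -> T -> K) (g : T -> K) (M : K) :
  (forall n, measurable_fun setT (f n)) -> measurable_fun setT g ->
  (forall n x, `|f n x| <= M) -> (forall x, f ^~ x @ \oo --> g x) ->
  (fun n => \int[P]_x f n x) @ \oo --> \int[P]_x g x.
Proof.
move=> mf mg fM fg; apply: fine_cvg.
have gM x : `|g x| <= M.
  have c : (fun n => `|f n x|) @ \oo --> `|g x| by apply: cvg_norm; exact: fg.
  rewrite -(cvg_lim _ c)//; apply: limr_le.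
    by apply/cvg_ex; eexists; exact: c.
  by apply: nearW => n; exact: fM.
rewrite -Rintegral_EFin//; last exact: (bounded_integrable (probability_setT _) _ _ gM).
have [] := @dominated_convergence _ _ _ P setT measurableT
  (fun n => EFin \o f n) (EFin \o g) (EFin \o cst M).
- by move=> n; exact/measurable_EFinP.
- exact/measurable_EFinP.
- by apply: aeW => x _; apply: cvg_EFin; [exact: nearW|exact: fg].
- exact: finite_measure_integrable_cst.
- by apply: aeW => x n _; rewrite lee_fin fM.
- by move=> _ _.
Qed.

Lemma cvg_seq_derive (K : realType) (f : K -> K) (l : K) (e : nat -> K) :
  is_derive (0 : K) 1 f l -> f 0 = 0 -> (forall n, e n != 0) -> e @ \oo --> (0 : K) ->
  (fun n => f (e n) / e n) @ \oo --> l.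
Proof.
move=> [df fl] f0 en0 e0.
have := df; rewrite /derivable => /cvg_ex[l' cl'].
have ll' : l = l' by rewrite -fl; exact: cvg_lim.
rewrite ll'; move/cvgr_dnbhsP: cl' => /(_ e (conj en0 e0)) H.
have -> : (fun n => f (e n) / e n) =
    (fun n => (e n)^-1 *: ((f \o shift 0) (e n *: 1) - f 0)).
  by apply/funext => n; rewrite f0 subr0 /= addr0 /GRing.scale /= mulr1 mulrC.
exact: H.
Qed.

Lemma ler_norm_sin (K : realType) (x : K) : `|sin x| <= `|x|.
Proof.
wlog x0 : x / 0 <= x.
  move=> H; case: (leP 0 x) => [|/ltW x0]; first exact: H.
  by rewrite -normrN -sinN -[leRHS]normrN; apply: H; rewrite oppr_ge0.
rewrite [leRHS]ger0_norm//.
have [->|xn0] := eqVneq x 0; first by rewrite sin0 normr0.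
have xp : 0 < x by rewrite lt0r xn0.
have [c _] := @MVT _ sin cos 0 x xp (fun x _ => is_derive_sin x)
  (continuous_subspaceT (@continuous_sin K)).
rewrite sin0 !subr0 => ->; rewrite normrM (ger0_norm x0) ler_piMl//.
exact: cos_max.
Qed.

(** Step h of the difference quotients: a positive sequence tending to 0, since bounded convergence
    works along sequences. *)
Definition inv_nat (K : realType) (n : nat) : K := n.+1%:R^-1.

Lemma inv_nat_gt0 (K : realType) n : 0 < inv_nat K n.
Proof. by rewrite invr_gt0. Qed.

Lemma cvg_sin_quot (K : realType) (x : K) :
  (fun n => sin (inv_nat K n * x) / inv_nat K n) @ \oo --> x.
Proof.
apply: (@cvg_seq_derive _ (fun h => sin (h * x))).
- have dlin : is_derive (0 : K) 1 (fun y : K => y * x) x.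
    have -> : (fun y : K => y * x) = x *: (id : K -> K).
      by apply/funext => y; rewrite mulrC.
    by apply: is_derive_eq; rewrite /GRing.scale /= mulr1.
  have : is_derive (0 : K) 1 (sin \o (fun y : K => y * x)) x.
    by apply: is_derive_eq; rewrite /GRing.scale /= mul0r cos0 mul1r.
  by [].
- by rewrite mul0r sin0.
- by move=> n; rewrite gt_eqF ?inv_nat_gt0.
- exact: cvg_harmonic.
Qed.

Lemma cvg_expR_quot (K : realType) (y : K) :
  (fun n => (1 - expR (- (inv_nat K n ^+ 2 * y))) / inv_nat K n ^+ 2) @ \oo --> y.
Proof.
apply: (@cvg_seq_derive _ (fun h => 1 - expR (- (h * y))) _ (fun n => inv_nat K n ^+ 2)).
- have dlin : is_derive (0 : K) 1 (fun h : K => - (h * y)) (- y).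
    have -> : (fun h : K => - (h * y)) = (- y) *: (id : K -> K).
      by apply/funext => h; rewrite mulrC -mulNr.
    by apply: is_derive_eq; rewrite /GRing.scale /= mulr1.
  have : is_derive (0 : K) 1 (cst 1 - (expR \o (fun h : K => - (h * y)))) y.
    by apply: is_derive_eq; rewrite /GRing.scale /= mul0r oppr0 expR0; ring.
  by [].
- by rewrite mul0r oppr0 expR0 subrr.
- by move=> n; rewrite expf_neq0// gt_eqF ?inv_nat_gt0.
- rewrite -[X in _ --> X](expr0n K 2).
  by apply: (@continuous_cvg _ _ _ _ _ _ (fun x : K => x ^+ 2)); [exact: exprn_continuous|exact: cvg_harmonic].
Qed.

(** This identity and the next two write powers of the sine as combinations of sines or cosines at
    multiples of x. Taken at h x and divided by h^2, h^3 or h^4, they are finite differences tending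
    to 4 x^2, 4 x^3 and 16 x^4. *)
Lemma trig_sq (K : realType) (x : K) : 2 - 2 * cos (x + x) = (2 * sin x) ^+ 2.
Proof. by rewrite cosD; have := cos2Dsin2 x; lra. Qed.

Lemma trig_cube (K : realType) (x : K) : 3 * sin x - sin (x + x + x) = 4 * sin x ^+ 3.
Proof.
rewrite !sinD !cosD.
have c2 : cos x ^+ 2 = 1 - sin x ^+ 2 by have := cos2Dsin2 x; lra.
transitivity (3 * sin x - (3 * sin x * cos x ^+ 2 - sin x ^+ 3)); first by ring.
by rewrite c2; ring.
Qed.

Lemma trig_fourth (K : realType) (x : K) :
  6 - 8 * cos (x + x) + 2 * cos (x + x + (x + x)) = ((2 * sin x) ^+ 2) ^+ 2.
Proof.
rewrite -trig_sq [cos (x + x + (x + x))]cosD.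
have := cos2Dsin2 (x + x).
move: (cos (x + x)) (sin (x + x)) => c s; nra.
Qed.

(** After a square root the claim is (1 + S) exp(- u S / 4) <= 1 + 4 / u. It follows from exp y >= 1
    + y at y = u S / 4, because (1 + 4 / u) (1 + u S / 4) >= 1 + S. *)
Lemma tilt_weight_bound (K : realType) (u S : K) : 0 < u -> 0 <= S ->
  (1 + S) ^+ 2 * expR (- (u * S) / 2) <= (1 + 4 / u) ^+ 2.
Proof.
move=> u0 S0; have u0' := ltW u0.
have -> : expR (- (u * S) / 2) = expR (- (u * S / 4)) ^+ 2.
  by rewrite -expRM_natl; congr expR; field.
rewrite -exprMn ler_sqr ?nnegrE ?mulr_ge0 ?expR_ge0 ?addr_ge0 ?divr_ge0//.
rewrite expRN ler_pdivrMr ?expR_gt0//.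
apply: (@le_trans _ _ ((1 + 4 / u) * (1 + u * S / 4))).
  have -> : (1 + 4 / u) * (1 + u * S / 4) = 1 + S + (u * S / 4 + 4 / u).
    by field; rewrite gt_eqF.
  by rewrite lerDl addr_ge0// divr_ge0 ?mulr_ge0.
rewrite ler_pM2l; first exact: expR_ge1Dx.
by rewrite addr_gt0// divr_gt0.
Qed.

(** With A = (1 + k) (1 + S) one has |x|^2 <= A and A >= 1, so that A^2 serves as a common bound for
    all powers up to the fourth. *)
Lemma norm_expn_bound (K : realType) (x k S : K) (q : nat) :
  0 <= k -> 0 <= S -> x ^+ 2 <= k * S -> (q <= 4)%N ->
  `|x| ^+ q <= ((1 + k) * (1 + S)) ^+ 2.
Proof.
move=> k0 S0 xkS q4.
have xA : `|x| ^+ 2 <= (1 + k) * (1 + S) by rewrite real_normK ?num_real//; nra.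
have x0 := normr_ge0 x.
set A := (1 + k) * (1 + S) in xA *.
have A1 : 1 <= A by rewrite /A; nra.
move: (`|x|) x0 xA => y y0 yA.
have yA1 : y <= A by case: (leP y 1) => y1; nra.
have A0 : 0 <= A by exact: le_trans A1.
case: q q4 => [|[|[|[|[|//]]]]] _; rewrite ?expr0 ?expr1.
- by rewrite exprn_ege1.
- by apply: (le_trans yA1); rewrite expr2 ler_peMl.
- by apply: (le_trans yA); rewrite [leRHS]expr2 ler_peMl.
- by rewrite exprSr [leRHS]expr2 ler_pM// exprn_ge0.
- by rewrite (exprM _ 2 2) ler_sqr ?nnegrE ?exprn_ge0.
Qed.

Lemma sin_quot_le (K : realType) (n : nat) (x : K) :
  `|sin (inv_nat K n * x) / inv_nat K n| <= `|x|.
Proof.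
have e0 := inv_nat_gt0 K n.
rewrite normrM normfV (gtr0_norm e0) ler_pdivrMr//.
by apply: le_trans (ler_norm_sin _) _; rewrite normrM gtr0_norm// mulrC.
Qed.

(** Mixing integrand for a moment of degree 2 q: expanding exp(- c^2 k / (2 (t + u))) at c = 0
    brings one factor 1 / (t + u) for every two degrees in c. *)
Definition tilt_power (K : realType) (p : nat) (u : K) (q : nat) (t : K) : K :=
  if 0 < t then Num.sqrt (t / (t + u)) ^+ p / (t + u) ^+ q else 0.

(** The moments are Taylor coefficients at c = 0 of the given transforms. They are reached through
    the quotients s_n = sin (h x) / h, which are dominated by |x|. Powers of s_n are combinations of
    the known transforms at multiples of h, and bounded convergence passes to the limit both under
    [P] and under [m]. *)
Lemma tilted_moments (K : realType) (d : measure_display) (Om : measurableType d)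
    (P : probability Om K) (m : probability K K) (p : nat) (u k : K) (x S : Om -> K) :
  0 < u -> 0 <= k -> measurable_fun setT x -> measurable_fun setT S ->
  (forall w, 0 <= S w) -> (forall w, x w ^+ 2 <= k * S w) ->
  (forall c, \int[P]_w (cos (c * x w) * expR (- (u * S w) / 2)) =
     \int[m]_t (if 0 < t then Num.sqrt (t / (t + u)) ^+ p *
        expR (- (c ^+ 2 * k / (t + u)) / 2) else 0) /\
     \int[P]_w (sin (c * x w) * expR (- (u * S w) / 2)) = 0) ->
  [/\ \int[P]_w (x w * expR (- (u * S w) / 2)) = 0,
      \int[P]_w (x w ^+ 3 * expR (- (u * S w) / 2)) = 0,
      \int[P]_w (x w ^+ 2 * expR (- (u * S w) / 2)) = k * \int[m]_t tilt_power p u 1 t &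
      \int[P]_w (x w ^+ 4 * expR (- (u * S w) / 2)) =
        3 * k ^+ 2 * \int[m]_t tilt_power p u 2 t].
Proof.
move=> u0 k0 mx mS S0 xS cs.
pose e w := expR (- (u * S w) / 2).
have me : measurable_fun setT e.
  apply: measurableT_comp => //; apply: measurable_funM => //; apply: measurableT_comp => //.
  exact: measurable_funM.
have e1 w : `|e w| <= 1.
  rewrite /e ger0_norm ?expR_ge0// -[leRHS]expR0 ler_expR mulNr oppr_le0 divr_ge0//.
  by rewrite mulr_ge0// ltW.
pose B := (1 + k) ^+ 2 * (1 + 4 / u) ^+ 2.
have bnd q w : (q <= 4)%N -> `|x w| ^+ q * e w <= B.
  move=> q4; apply: (@le_trans _ _ (((1 + k) * (1 + S w)) ^+ 2 * e w)).
    by rewrite ler_wpM2r ?expR_ge0// norm_expn_bound.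
  by rewrite exprMn -mulrA ler_wpM2l ?sqr_ge0// tilt_weight_bound.
pose s n w := sin (inv_nat K n * x w) / inv_nat K n.
have ms n : measurable_fun setT (s n).
  apply: measurable_funM => //; apply: (measurableT_comp (@measurable_sin K)).
  exact: measurable_funM.
have sx n w : `|s n w| <= `|x w| by exact: sin_quot_le.
have s_cvg w : s ^~ w @ \oo --> x w by exact: cvg_sin_quot.
have i0 n : inv_nat K n != 0 by rewrite gt_eqF// inv_nat_gt0.
have ie c : P.-integrable setT (EFin \o (fun w => cos (c * x w) * e w)).
  apply: (bounded_integrable (probability_setT _) (M := 1)) => //.
    apply: measurable_funM => //; apply: (measurableT_comp (@measurable_cos K)).
    exact: measurable_funM.
  by move=> w; rewrite normrM -[leRHS]mulr1 ler_pM// cos_max.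
have ise c : P.-integrable setT (EFin \o (fun w => sin (c * x w) * e w)).
  apply: (bounded_integrable (probability_setT _) (M := 1)) => //.
    apply: measurable_funM => //; apply: (measurableT_comp (@measurable_sin K)).
    exact: measurable_funM.
  by move=> w; rewrite normrM -[leRHS]mulr1 ler_pM// sin_max.
pose T c t := if 0 < t then Num.sqrt (t / (t + u)) ^+ p *
        expR (- (c ^+ 2 * k / (t + u)) / 2) else 0 : K.
have rho_ge0 t : 0 < t -> 0 <= Num.sqrt (t / (t + u)) ^+ p.
  by move=> t0; rewrite exprn_ge0 ?sqrtr_ge0.
have rho_le1 t : 0 < t -> Num.sqrt (t / (t + u)) ^+ p <= 1.
  move=> t0; rewrite exprn_ile1 ?sqrtr_ge0// -[leRHS]sqrtr1 ler_sqrt//.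
  by rewrite ler_pdivrMr ?addr_gt0// mul1r lerDl ltW.
have minvtu : measurable_fun setT (fun t : K => (t + u)^-1).
  by apply: (measurableT_comp (@measurable_invr K)); exact: measurable_funD.
have mrho : measurable_fun setT (fun t : K => Num.sqrt (t / (t + u)) ^+ p).
  apply: measurable_funX; apply: (measurableT_comp (@measurable_sqrt K)).
  exact: measurable_funM.
have mlt0 : measurable_fun setT (fun t : K => 0 < t) by exact: measurable_fun_ltr.
have mT c : measurable_fun setT (T c).
  apply: measurable_fun_ifT => //; apply: measurable_funM => //.
  apply: measurableT_comp => //; apply: measurable_funM => //; apply: measurableT_comp => //.
  exact: measurable_funM.
have T1 c t : `|T c t| <= 1.
  rewrite /T; case: ifP => [t0|_]; last by rewrite normr0.
  rewrite ger0_norm ?mulr_ge0 ?expR_ge0 ?rho_ge0//.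
  rewrite -[leRHS]mulr1 ler_pM ?expR_ge0 ?rho_ge0 ?rho_le1//.
  have tu0 : 0 <= t + u by rewrite ltW// addr_gt0.
  rewrite -[leRHS]expR0 ler_expR mulNr oppr_le0; apply: divr_ge0 => //.
  by apply: divr_ge0 => //; apply: mulr_ge0 => //; exact: sqr_ge0.
have iT c : m.-integrable setT (EFin \o T c).
  exact: (bounded_integrable (probability_setT _) _ _ (T1 c)).
have lim_P (q : nat) (f : K -> K) (c : K) : (q <= 4)%N -> 0 <= c -> continuous f ->
    measurable_fun setT f -> (forall a b : K, `|a| <= `|b| -> `|f a| <= c * `|b| ^+ q) ->
    (fun n => \int[P]_w (f (s n w) * e w)) @ \oo --> \int[P]_w (f (x w) * e w).
  move=> q4 c0 cf mf fq; apply: (@bounded_convergence _ _ _ _ _ _ (c * B)).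
  - by move=> n; apply: measurable_funM => //; exact: measurableT_comp.
  - by apply: measurable_funM => //; exact: measurableT_comp.
  - move=> n w; rewrite normrM [X in _ * X]ger0_norm ?expR_ge0//.
    apply: (@le_trans _ _ (c * `|x w| ^+ q * e w)).
      by rewrite ler_wpM2r ?expR_ge0// fq.
    by rewrite -mulrA ler_wpM2l// bnd.
  - move=> w; apply: cvgM; last exact: cvg_cst.
    by apply: continuous_cvg; [exact: cf|exact: s_cvg].
have cX (n : nat) : continuous (fun a : K => a ^+ n) by exact: exprn_continuous.
have M1 : \int[P]_w (x w * e w) = 0.
  have c1 : (fun n => \int[P]_w (s n w * e w)) @ \oo --> \int[P]_w (x w * e w).
    apply: (lim_P 1%N id 1) => //; first by move=> a; exact: cvg_id.
    by move=> a b ab; rewrite mul1r expr1.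
  have E n : \int[P]_w (s n w * e w) = 0.
    transitivity (\int[P]_w ((inv_nat K n)^-1 * (sin (inv_nat K n * x w) * e w))).
      by apply: eq_Rintegral => w _; rewrite /s; ring.
    by rewrite RintegralZl//; have [_ ->] := cs (inv_nat K n); rewrite mulr0.
  rewrite -(cvg_lim _ c1)//; apply: cvg_lim => //.
  by under eq_fun do rewrite E; exact: cvg_cst.
have M3 : \int[P]_w (x w ^+ 3 * e w) = 0.
  have c1 : (fun n => \int[P]_w (s n w ^+ 3 * e w)) @ \oo --> \int[P]_w (x w ^+ 3 * e w).
    apply: (lim_P 3%N (fun a => a ^+ 3) 1) => //.
    by move=> a b ab; rewrite mul1r normrX lerXn2r ?nnegrE.
  have E n : \int[P]_w (s n w ^+ 3 * e w) = 0.
    transitivity (\int[P]_w ((3 / 4) / inv_nat K n ^+ 3 * (sin (inv_nat K n * x w) * e w) -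
        (1 / 4) / inv_nat K n ^+ 3 * (sin ((3 * inv_nat K n) * x w) * e w))).
      apply: eq_Rintegral => w _; rewrite /s exprMn exprVn.
      have -> : 3 * inv_nat K n * x w = inv_nat K n * x w + inv_nat K n * x w + inv_nat K n * x w by ring.
      have := trig_cube (inv_nat K n * x w).
      set a := sin (inv_nat K n * x w); set b := sin (_ + _) => E3.
      have -> : a ^+ 3 = (3 * a - b) / 4 by rewrite E3; field.
      by ring.
    rewrite RintegralB//; last 2 first.
    - exact: (integrableZl measurableT _ (ise _)).
    - exact: (integrableZl measurableT _ (ise _)).
    rewrite !RintegralZl//.
    have [_ ->] := cs (inv_nat K n); have [_ ->] := cs (3 * inv_nat K n).
    by rewrite !mulr0 subrr.
  rewrite -(cvg_lim _ c1)//; apply: cvg_lim => //.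
  by under eq_fun do rewrite E; exact: cvg_cst.
pose rho t := Num.sqrt (t / (t + u)) ^+ p.
(* At c = 2 h the exponent c^2 k / (2 (t + u)) equals h^2 y, and at c = 4 h it equals 4 h^2 y. *)
pose y t := 2 * (k / (t + u)).
pose E n t := expR (- (inv_nat K n ^+ 2 * y t)).
pose g n t := (1 - E n t) / inv_nat K n ^+ 2.
have y0 t : 0 < t -> 0 <= y t.
  by move=> t0; apply: mulr_ge0 => //; apply: divr_ge0 => //; rewrite ltW// addr_gt0.
have yu t : 0 < t -> y t <= 2 * (k / u).
  move=> t0; rewrite ler_pM2l// ler_wpM2l// lef_pV2 ?posrE ?addr_gt0//.
  by rewrite lerDr ltW.
have en2 n : 0 < inv_nat K n ^+ 2 by rewrite exprn_gt0// inv_nat_gt0.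
have E0 n t : 0 <= E n t by exact: expR_ge0.
have E1 n t : 0 < t -> E n t <= 1.
  move=> t0; rewrite -[leRHS]expR0 ler_expR.
  by rewrite oppr_le0; apply: mulr_ge0; [exact: ltW|exact: y0].
have g0 n t : 0 < t -> 0 <= g n t.
  by move=> t0; rewrite /g divr_ge0 ?(ltW (en2 n))// subr_ge0 E1.
have gy n t : 0 < t -> g n t <= y t.
  move=> t0; rewrite /g ler_pdivrMr// lerBlDr -lerBlDl.
  by apply: le_trans (expR_ge1Dx _); rewrite mulrC.
have g_cvg t : g ^~ t @ \oo --> y t by exact: cvg_expR_quot.
have my : measurable_fun setT y by apply: measurable_funM => //; exact: measurable_funM.
have mE n : measurable_fun setT (E n).
  by apply: measurableT_comp => //; apply: measurableT_comp => //; exact: measurable_funM.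
have mg n : measurable_fun setT (g n).
  by apply: measurable_funM => //; exact: measurable_funB.
have TE n t : 0 < t -> T (2 * inv_nat K n) t = rho t * E n t.
  move=> t0; rewrite /T t0 /rho /E /y; congr (_ * expR _); field.
  by rewrite gt_eqF// addr_gt0.
have TE4 n t : 0 < t -> T (4 * inv_nat K n) t = rho t * E n t ^+ 4.
  move=> t0; rewrite /T t0 /rho /E /y -expRM_natl; congr (_ * expR _); field.
  by rewrite gt_eqF// addr_gt0.
have T0E t : 0 < t -> T 0 t = rho t.
  by move=> t0; rewrite /T t0 expr0n/= !mul0r oppr0 mul0r expR0 mulr1.
have PT c : \int[P]_w (cos (c * x w) * e w) = \int[m]_t T c t by have [] := cs c.
have rho1 t : 0 < t -> `|rho t| <= 1.
  by move=> t0; rewrite ger0_norm ?rho_ge0 ?rho_le1.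
have M2 : \int[P]_w (x w ^+ 2 * e w) = k * \int[m]_t tilt_power p u 1 t.
  have c1 : (fun n => \int[P]_w ((2 * s n w) ^+ 2 * e w)) @ \oo -->
      \int[P]_w ((2 * x w) ^+ 2 * e w).
    apply: (lim_P 2%N (fun a => (2 * a) ^+ 2) 4) => //.
    - have -> : (fun a : K => (2 * a) ^+ 2) = (fun a => 2 ^+ 2 * a ^+ 2).
        by apply/funext => a; rewrite exprMn.
      by move=> a; apply: cvgM; [exact: cvg_cst|exact: cX].
    - by apply: measurable_funX; exact: measurable_funM.
    - move=> a b ab; rewrite exprMn normrM [`|a ^+ _|]normrX [`|2 ^+ _|]ger0_norm// -natrX.
      by rewrite ler_pM2l// lerXn2r ?nnegrE.
  have EP n : \int[P]_w ((2 * s n w) ^+ 2 * e w) =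
      \int[m]_t (if 0 < t then rho t * (2 * g n t) else 0).
    transitivity (\int[P]_w (2 / inv_nat K n ^+ 2 * (cos (0 * x w) * e w) -
        2 / inv_nat K n ^+ 2 * (cos (2 * inv_nat K n * x w) * e w))).
      apply: eq_Rintegral => w _; rewrite mul0r cos0.
      have -> : 2 * inv_nat K n * x w = inv_nat K n * x w + inv_nat K n * x w by ring.
      have -> : (2 * s n w) ^+ 2 = (2 * sin (inv_nat K n * x w)) ^+ 2 / inv_nat K n ^+ 2.
        by rewrite /s mulrA expr_div_n.
      by rewrite -trig_sq; ring.
    rewrite RintegralB//; last 2 first.
    - exact: (integrableZl measurableT _ (ie _)).
    - exact: (integrableZl measurableT _ (ie _)).
    rewrite !RintegralZl// !PT -!RintegralZl// -RintegralB//; last 2 first.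
    - exact: (integrableZl measurableT _ (iT _)).
    - exact: (integrableZl measurableT _ (iT _)).
    apply: eq_Rintegral => t _; case: ifPn => [t0|t0]; last first.
      by rewrite /T (negbTE t0) !mulr0 subrr.
    by rewrite TE// T0E// /g; ring.
  have c2 : (fun n => \int[m]_t (if 0 < t then rho t * (2 * g n t) else 0)) @ \oo -->
      \int[m]_t (if 0 < t then rho t * (2 * y t) else 0).
    apply: (@bounded_convergence _ _ _ _ _ _ (2 * (2 * (k / u)))).
    - by move=> n; apply: measurable_fun_ifT => //; apply: measurable_funM => //; exact: measurable_funM.
    - by apply: measurable_fun_ifT => //; apply: measurable_funM => //; exact: measurable_funM.
    - move=> n t; case: ifP => t0; last first.
        rewrite normr0; apply: mulr_ge0 => //; apply: mulr_ge0 => //.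
        by apply: divr_ge0 => //; exact: ltW.
      rewrite normrM -[leRHS]mul1r ler_pM ?rho1// ger0_norm; last by apply: mulr_ge0 => //; exact: g0.
      by rewrite ler_pM2l// (le_trans (gy n _ t0)) ?yu.
    - move=> t; case: ifP => t0; last exact: cvg_cst.
      by apply: cvgM; [exact: cvg_cst|apply: cvgM; [exact: cvg_cst|exact: g_cvg]].
  have EL : \int[P]_w ((2 * x w) ^+ 2 * e w) = 4 * \int[P]_w (x w ^+ 2 * e w).
    rewrite -RintegralZl//; first by apply: eq_Rintegral => w _; ring.
    apply: (bounded_integrable (probability_setT _) (M := B)) => //.
      by apply: measurable_funM => //; exact: measurable_funX.
    by move=> w; rewrite normrM [X in _ * X]ger0_norm ?expR_ge0// normrX bnd.
  have itp : m.-integrable setT (EFin \o tilt_power p u 1).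
    apply: (bounded_integrable (probability_setT _) (M := u^-1)) => //.
      by apply: measurable_fun_ifT => //; apply: measurable_funM.
    move=> t; rewrite /tilt_power; case: ifP => t0; last by rewrite normr0 invr_ge0 ltW.
    rewrite normrM -[leRHS]mul1r ler_pM ?rho1// expr1 ger0_norm ?invr_ge0 ?(ltW (addr_gt0 t0 u0))//.
    by rewrite lef_pV2 ?posrE ?addr_gt0// lerDr ltW.
  have ER : \int[m]_t (if 0 < t then rho t * (2 * y t) else 0) =
      4 * (k * \int[m]_t tilt_power p u 1 t).
    rewrite mulrA -RintegralZl//; apply: eq_Rintegral => t _.
    rewrite /tilt_power /rho /y; case: ifP => t0; last by rewrite mulr0.
    by rewrite expr1; ring.
  have : 4 * \int[P]_w (x w ^+ 2 * e w) = 4 * (k * \int[m]_t tilt_power p u 1 t).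
    rewrite -EL -ER -(cvg_lim _ c1)// -(cvg_lim _ c2)//.
    by congr (limn _); apply/funext => n; exact: EP.
  by apply: mulfI; rewrite pnatr_eq0.
have M4 : \int[P]_w (x w ^+ 4 * e w) = 3 * k ^+ 2 * \int[m]_t tilt_power p u 2 t.
  have c1 : (fun n => \int[P]_w ((2 * s n w) ^+ 4 * e w)) @ \oo -->
      \int[P]_w ((2 * x w) ^+ 4 * e w).
    apply: (lim_P 4%N (fun a => (2 * a) ^+ 4) 16) => //.
    - have -> : (fun a : K => (2 * a) ^+ 4) = (fun a => 2 ^+ 4 * a ^+ 4).
        by apply/funext => a; rewrite exprMn.
      by move=> a; apply: cvgM; [exact: cvg_cst|exact: cX].
    - by apply: measurable_funX; exact: measurable_funM.
    - move=> a b ab; rewrite exprMn normrM [`|a ^+ _|]normrX [`|2 ^+ _|]ger0_norm// -natrX.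
      by rewrite ler_pM2l// lerXn2r ?nnegrE.
  (* The combination 6 - 8 E + 2 E^4 factors as 2 (1 - E)^2 (E^2 + 2 E + 3). The double zero at E =
     1 absorbs h^4, and the limit is 12 y^2. *)
  have EP n : \int[P]_w ((2 * s n w) ^+ 4 * e w) =
      \int[m]_t (if 0 < t then rho t * (2 * g n t ^+ 2 * (E n t ^+ 2 + 2 * E n t + 3)) else 0).
    transitivity (\int[P]_w (6 / inv_nat K n ^+ 4 * (cos (0 * x w) * e w) -
        8 / inv_nat K n ^+ 4 * (cos (2 * inv_nat K n * x w) * e w) +
        2 / inv_nat K n ^+ 4 * (cos (4 * inv_nat K n * x w) * e w))).
      apply: eq_Rintegral => w _; rewrite mul0r cos0.
      have -> : 2 * inv_nat K n * x w = inv_nat K n * x w + inv_nat K n * x w by ring.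
      have -> : 4 * inv_nat K n * x w = inv_nat K n * x w + inv_nat K n * x w + (inv_nat K n * x w + inv_nat K n * x w) by ring.
      have -> : (2 * s n w) ^+ 4 = ((2 * sin (inv_nat K n * x w)) ^+ 2) ^+ 2 / inv_nat K n ^+ 4.
        by rewrite /s mulrA expr_div_n -exprM.
      by rewrite -trig_fourth; ring.
    have i1 := integrableZl measurableT (6 / inv_nat K n ^+ 4) (ie 0).
    have i2 := integrableZl measurableT (8 / inv_nat K n ^+ 4) (ie (2 * inv_nat K n)).
    have i3 := integrableZl measurableT (2 / inv_nat K n ^+ 4) (ie (4 * inv_nat K n)).
    rewrite RintegralD//; last exact: (integrableB measurableT i1 i2).
    rewrite RintegralB//.
    have j1 := integrableZl measurableT (6 / inv_nat K n ^+ 4) (iT 0).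
    have j2 := integrableZl measurableT (8 / inv_nat K n ^+ 4) (iT (2 * inv_nat K n)).
    have j3 := integrableZl measurableT (2 / inv_nat K n ^+ 4) (iT (4 * inv_nat K n)).
    rewrite !RintegralZl// !PT -!RintegralZl// -RintegralB// -RintegralD//; last first.
      exact: (integrableB measurableT j1 j2).
    apply: eq_Rintegral => t _; case: ifPn => [t0|t0]; last first.
      by rewrite /T (negbTE t0) !mulr0 subrr add0r.
    rewrite TE// TE4// T0E// /g; field.
    exact: i0.
  have c2 : (fun n => \int[m]_t (if 0 < t then rho t * (2 * g n t ^+ 2 * (E n t ^+ 2 + 2 * E n t + 3)) else 0)) @ \oo -->
      \int[m]_t (if 0 < t then rho t * (2 * y t ^+ 2 * (1 ^+ 2 + 2 * 1 + 3)) else 0).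
    apply: (@bounded_convergence _ _ _ _ _ _ (2 * (2 * (k / u)) ^+ 2 * 6)).
    - move=> n; apply: measurable_fun_ifT => //; apply: measurable_funM => //; apply: measurable_funM.
        by apply: measurable_funM => //; exact: measurable_funX.
      apply: measurable_funD => //; apply: measurable_funD; first exact: measurable_funX.
      exact: measurable_funM.
    - apply: measurable_fun_ifT => //; apply: measurable_funM => //; apply: measurable_funM => //.
      by apply: measurable_funM => //; exact: measurable_funX.
    - move=> n t; case: ifP => t0; last first.
        rewrite normr0; apply: mulr_ge0 => //; apply: mulr_ge0 => //.
        exact: sqr_ge0.
      have Ep := E0 n t; have E1' := E1 n t t0.
      have b6 : E n t ^+ 2 + 2 * E n t + 3 <= 6.
        have : E n t ^+ 2 <= 1 by rewrite exprn_ile1.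
        by move: (E n t) E1' {Ep} => a; lra.
      have p6 : 0 <= E n t ^+ 2 + 2 * E n t + 3 by apply: addr_ge0 => //; apply: addr_ge0; [exact: sqr_ge0|exact: mulr_ge0].
      have p2 : 0 <= 2 * g n t ^+ 2 by apply: mulr_ge0 => //; exact: sqr_ge0.
      rewrite normrM -[leRHS]mul1r ler_pM ?rho1// ger0_norm; last exact: mulr_ge0.
      apply: ler_pM => //; rewrite ler_pM2l//; apply: lerXn2r; rewrite ?nnegrE.
      - exact: g0.
      - exact: le_trans (y0 _ t0) (yu _ t0).
      - exact: le_trans (gy n _ t0) (yu _ t0).
    - move=> t; case: ifP => t0; last exact: cvg_cst.
      have Ecvg : E ^~ t @ \oo --> (1 : K).
        have -> : (E^~ t) = (fun n => 1 - g n t * inv_nat K n ^+ 2).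
          by apply/funext => n; rewrite /g divfK ?gt_eqF// opprB addrC subrK.
        have e20 : (fun n => inv_nat K n ^+ 2) @ \oo --> (0 : K).
          rewrite -[X in _ --> X](expr0n K 2).
          by apply: (@continuous_cvg _ _ _ _ _ _ (fun x : K => x ^+ 2)); [exact: exprn_continuous|exact: cvg_harmonic].
        have H : (fun n => 1 - g n t * inv_nat K n ^+ 2) @ \oo --> (1 - y t * 0 : K).
          by apply: cvgB; [exact: cvg_cst|apply: cvgM; [exact: g_cvg|exact: e20]].
        by rewrite mulr0 subr0 in H.
      have sq (h : nat -> K) (l : K) : h @ \oo --> l -> (fun n => h n ^+ 2) @ \oo --> l ^+ 2.
        by move=> hl; apply: (@continuous_cvg _ _ _ _ _ _ (fun x : K => x ^+ 2)); [exact: exprn_continuous|exact: hl].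
      apply: cvgM; first exact: cvg_cst.
      apply: cvgM; first by apply: cvgM; [exact: cvg_cst|apply: sq; exact: g_cvg].
      apply: cvgD; last exact: cvg_cst.
      by apply: cvgD; [apply: sq; exact: Ecvg|apply: cvgM; [exact: cvg_cst|exact: Ecvg]].
  have EL : \int[P]_w ((2 * x w) ^+ 4 * e w) = 16 * \int[P]_w (x w ^+ 4 * e w).
    rewrite -RintegralZl//; first by apply: eq_Rintegral => w _; ring.
    apply: (bounded_integrable (probability_setT _) (M := B)) => //.
      by apply: measurable_funM => //; exact: measurable_funX.
    by move=> w; rewrite normrM [X in _ * X]ger0_norm ?expR_ge0// normrX bnd.
  have itp : m.-integrable setT (EFin \o tilt_power p u 2).
    apply: (bounded_integrable (probability_setT _) (M := u^-1 ^+ 2)) => //.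
      apply: measurable_fun_ifT => //; apply: measurable_funM => //.
      under eq_fun do rewrite -exprVn.
      exact: measurable_funX.
    move=> t; rewrite /tilt_power; case: ifP => t0; last by rewrite normr0 sqr_ge0.
    have tu0 := addr_gt0 t0 u0.
    rewrite normrM -[leRHS]mul1r ler_pM ?rho1// -exprVn normrX lerXn2r ?nnegrE ?invr_ge0 ?(ltW u0)//.
    rewrite ger0_norm ?invr_ge0 ?(ltW tu0)//.
    by rewrite lef_pV2 ?posrE// lerDr ltW.
  have ER : \int[m]_t (if 0 < t then rho t * (2 * y t ^+ 2 * (1 ^+ 2 + 2 * 1 + 3)) else 0) =
      16 * (3 * k ^+ 2 * \int[m]_t tilt_power p u 2 t).
    rewrite [in RHS]mulrA -RintegralZl//; apply: eq_Rintegral => t _.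
    rewrite /tilt_power /rho /y; case: ifP => t0; last by rewrite mulr0.
    by rewrite expr1n exprMn expr_div_n; ring.
  have : 16 * \int[P]_w (x w ^+ 4 * e w) = 16 * (3 * k ^+ 2 * \int[m]_t tilt_power p u 2 t).
    rewrite -EL -ER -(cvg_lim _ c1)// -(cvg_lim _ c2)//.
    by congr (limn _); apply/funext => n; exact: EP.
  by apply: mulfI; rewrite pnatr_eq0.
by split.
Qed.

(** * Moments of ratios under a Gamma mixture *)

Lemma ge0_integral_shift (K : realType) (t : K) (g : K -> \bar K) :
  measurable_fun setT g -> (forall x, 0 <= g x)%E ->
  (\int[lebesgue_measure]_u g (t + u)%R = \int[lebesgue_measure]_v g v)%E.
Proof.
move=> mg g0.
have mt : measurable_fun setT ((fun u => t + u) : measurableTypeR K -> measurableTypeR K).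
  exact: measurable_funD.
have := @ge0_integral_pushforward _ _ (measurableTypeR K) (measurableTypeR K) K _ mt
  (@lebesgue_measure K) setT g measurableT mg (fun x _ => g0 x).
rewrite preimage_setT => <-.
apply: eq_measure_integral => A mA _; apply/esym.
apply: lebesgue_measure_unique => //= _ [[a b]] _ <-.
rewrite /pushforward.
have -> : (fun u => t + u) @^-1` `]a, b]%classic = `]a - t, b - t]%classic.
  by apply/seteqP; split => x /=; rewrite !in_itv/= ltrBlDl lerBrDl.
rewrite !lebesgue_measure_itv/= !lte_fin ltrD2r.
by rewrite -!EFinB opprB addrA subrK.
Qed.

Lemma integral_exp_weight (K : realType) (c : K) : 0 < c ->
  (\int[lebesgue_measure]_u (if (0 < u)%R then 1 / 2 * expR (- (u * c) / 2) else 0)%:E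
   = (c^-1)%:E)%E.
Proof.
move=> c0; have c2 : 0 < c / 2 by rewrite divr_gt0.
have Epdf := @integral_exponential_pdf K _ c2.
transitivity (\int[lebesgue_measure]_u ((c^-1)%:E * (exponential_pdf (c / 2) u)%:E))%E; last first.
  rewrite ge0_integralZl//; last 3 first.
  - by apply/measurable_EFinP; exact: measurable_exponential_pdf.
  - by move=> x _; rewrite lee_fin exponential_pdf_ge0// ltW.
  - by rewrite lee_fin invr_ge0 ltW.
  by rewrite Epdf mule1.
apply: ae_eq_integral => //.
- apply/measurable_EFinP; apply: measurable_fun_ifT => //; first exact: measurable_fun_ltr.
  apply: measurable_funM => //; apply: measurableT_comp => //; apply: measurable_funM => //.
  by apply: measurableT_comp => //; exact: measurable_funM.
- apply/measurable_EFinP; apply: measurable_funM => //.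
  exact: measurable_exponential_pdf.
(* The two integrands can differ at 0 only, where the exponential density is positive and the
   cut-off one is 0. *)
exists [set 0]; split; [exact: measurable_set1|exact: lebesgue_measure_set1|].
move=> x /= H; apply: contrapT => x0; apply: H => _.
rewrite -EFinM; congr (_%:E); case: ifPn => [xp|xn].
  rewrite exponential_pdfE; last exact: ltW.
  have -> : - (x * c) / 2 = - (c / 2) * x by field.
  by field; rewrite gt_eqF.
rewrite lt0_exponential_pdf ?mulr0//.
by rewrite lt_neqAle leNgt xn andbT; apply/eqP.
Qed.

(** The integrand is singular at 0 when a < 1, so the interval is exhausted by [v exp(- n), v]. With
    this choice the lower endpoint contributes v^a exp(- a)^n / a, a geometric sequence tending to
    0. *)
Lemma integral_powR_itv (K : realType) (a v : K) : 0 < a -> 0 < v ->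
  (\int[lebesgue_measure]_(t in `]0%R, v]) (t `^ (a - 1))%:E = (v `^ a / a)%:E)%E.
Proof.
move=> a0 v0; pose e n := v * expR (- n%:R).
have e0 n : 0 < e n by rewrite mulr_gt0// expR_gt0.
have -> : `]0, v]%classic = \bigcup_n `[e n, v]%classic.
  apply/seteqP; split => x /=.
    rewrite in_itv/= => /andP[x0 xv].
    have xv0 : 0 < v / x by rewrite divr_gt0.
    exists (Num.truncn `|ln (v / x)|).+1 => //; rewrite /= in_itv/= xv andbT.
    have : ln (v / x) <= (Num.truncn `|ln (v / x)|).+1%:R.
      by apply: le_trans (ler_norm _) _; exact/ltW/truncnS_gt.
    rewrite -ler_expR lnK ?posrE// /e expRN ler_pdivrMr ?expR_gt0//.
    by rewrite ler_pdivrMr// mulrC.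
  move=> [n _] /=; rewrite !in_itv/= => /andP[ex ->]; rewrite andbT.
  exact: lt_le_trans (e0 n) ex.
have mpow : measurable_fun setT (fun t : K => (t `^ (a - 1))%:E).
  by apply/measurable_EFinP; exact: measurable_powR.
have nd : nondecreasing_seq (fun n => `[e n, v]%classic).
  move=> m n mn; apply/subsetPset => x /=; rewrite !in_itv/= => /andP[ex ->]; rewrite andbT.
  by apply: le_trans ex; rewrite ler_pM2l// ler_expR lerN2 ler_nat.
have c1 := @ge0_nondecreasing_set_cvg_integral _ (measurableTypeR K) K (fun n => `[e n, v]%classic)
  (fun t => (t `^ (a - 1))%:E) (@lebesgue_measure K) nd (fun n => measurable_itv _)
  (fun n => measurable_funTS mpow) (fun n x _ => powR_ge0 x (a - 1)).
rewrite -(cvg_lim _ c1)//; apply: cvg_lim => //.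
have FTC n : (\int[lebesgue_measure]_(t in `[e n, v]) (t `^ (a - 1))%:E =
    (v `^ a / a * (1 - expR (- a) ^+ n))%:E)%E.
  have E : e n `^ a = v `^ a * expR (- a) ^+ n.
    rewrite /e powRM ?expR_ge0 ?ltW//; congr (_ * _).
    by rewrite -expRM_natl /powR gt_eqF ?expR_gt0// expRK; congr expR; ring.
  have [->|en0] := eqVneq n 0%N.
    rewrite expr0 subrr mulr0 /e oppr0 expR0 mulr1 set_itv1 integral_set1//.
  have env : e n < v.
    by rewrite /e gtr_pMr// expR_lt1 oppr_lt0 ltr0n lt0n.
  have d (x : K) : 0 < x -> is_derive x 1 (fun t : K => t `^ a / a) (x `^ (a - 1)).
    move=> x0; have -> : (fun t : K => t `^ a / a) = a^-1 *: ((fun t => t `^ a) : K -> K).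
      by apply/funext => t; rewrite mulrC.
    have := is_derive1_powR a x0 => dp.
    by apply: is_derive_eq; rewrite /GRing.scale/= mulrA mulVf ?mul1r// gt_eqF.
  have pc (x b : K) : 0 < x -> {for x, continuous (fun t : K => t `^ b)}.
    move=> x0; apply: differentiable_continuous; apply/derivable1_diffP.
    by have [] := is_derive1_powR b x0.
  have ex0 x : e n <= x -> 0 < x by exact: lt_le_trans.
  rewrite (@continuous_FTC2 _ (fun t => t `^ (a - 1)) (fun t => t `^ a / a))//.
  - by rewrite E -EFinB; congr (_%:E); ring.
  - apply: continuous_in_subspaceT => x; rewrite inE /= in_itv/= => /andP[ex _].
    by apply: pc; exact: ex0.
  - split.
    + by move=> x; rewrite in_itv/= => /andP[/ltW/ex0/d[]].
    + apply: cvg_at_right_filter; apply: cvgM; last exact: cvg_cst.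
      exact: pc.
    + apply: cvg_at_left_filter; apply: cvgM; last exact: cvg_cst.
      exact: pc.
  - move=> x; rewrite in_itv/= => /andP[/ltW/ex0/d dx _].
    by rewrite derive1E; case: dx.
under eq_fun do rewrite FTC.
apply: cvg_EFin; first exact: nearW.
have H : (fun n => v `^ a / a * (1 - expR (- a) ^+ n)) @ \oo --> (v `^ a / a * (1 - 0) : K).
  apply: cvgM; first exact: cvg_cst.
  apply: cvgB; first exact: cvg_cst.
  by apply: cvg_expr; rewrite ger0_norm ?expR_ge0// expR_lt1 oppr_lt0.
by rewrite subr0 mulr1 in H.
Qed.

(** The substitution v = t + u turns the quadrant into the region 0 < t < v, where the inner
    integral of t^(a - 1) is v^a / a. Nonnegativity allows both exchanges by Tonelli. *)
Lemma integral_powR_shift (K : realType) (a : K) (g : K -> K) : 0 < a ->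
  measurable_fun setT g -> (forall v, 0 <= g v) ->
  (\int[lebesgue_measure]_u \int[lebesgue_measure]_t
     (if (0 < u)%R && (0 < t)%R then t `^ (a - 1) * g (t + u)%R else 0)%:E =
   \int[lebesgue_measure]_v (if (0 < v)%R then v `^ a / a * g v else 0)%:E)%E.
Proof.
move=> a0 mg g0.
have mlt (d : measure_display) (T : measurableType d) (f h : T -> K) :
  measurable_fun setT f -> measurable_fun setT h -> measurable_fun setT (fun x => f x < h x).
  by move=> mf mh; exact: measurable_fun_ltr.
have mfst : measurable_fun setT (fun x : measurableTypeR K * measurableTypeR K => x.1 : K).
  exact: measurable_fst.
have msnd : measurable_fun setT (fun x : measurableTypeR K * measurableTypeR K => x.2 : K).
  exact: measurable_snd.
pose f (x : measurableTypeR K * measurableTypeR K) : \bar K :=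
  (if (0 < x.1) && (0 < x.2) then x.2 `^ (a - 1) * g (x.2 + x.1) else 0)%:E.
have mf : measurable_fun setT f.
  apply/measurable_EFinP; apply: measurable_fun_ifT => //.
    by apply: measurable_and; exact: mlt.
  apply: measurable_funM; first exact: (measurableT_comp (@measurable_powR K (a - 1))).
  by apply: (measurableT_comp mg); exact: measurable_funD.
have f0 x : (0 <= f x)%E.
  by rewrite lee_fin; case: ifP => // _; rewrite mulr_ge0 ?powR_ge0.
rewrite [LHS](fubini_tonelli f mf f0).
pose h (x : measurableTypeR K * measurableTypeR K) : \bar K :=
  (if (0 < x.1) && (x.1 < x.2) then x.1 `^ (a - 1) * g x.2 else 0)%:E.
have mh : measurable_fun setT h.
  apply/measurable_EFinP; apply: measurable_fun_ifT => //.
    by apply: measurable_and; exact: mlt.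
  apply: measurable_funM; first exact: (measurableT_comp (@measurable_powR K (a - 1))).
  exact: (measurableT_comp mg).
have h0 x : (0 <= h x)%E.
  by rewrite lee_fin; case: ifP => // _; rewrite mulr_ge0 ?powR_ge0.
transitivity (\int[lebesgue_measure]_t \int[lebesgue_measure]_v h (t, v))%E.
  apply: eq_integral => t _.
  rewrite -(@ge0_integral_shift K t (fun v => h (t, v))); last 2 first.
  - exact: (measurableT_comp mh (pair1_measurable t)).
  - by move=> x; exact: h0.
  by apply: eq_integral => u _; rewrite /f /h /= ltrDl andbC.
rewrite (fubini_tonelli h mh h0); apply: eq_integral => v _; rewrite /h /=.
case: ifPn => [v0|]; last first.
  rewrite -leNgt => v0; rewrite integral0_eq// => t _; case: ifP => // /andP[t0 tv].
  by move: (lt_trans t0 tv); rewrite ltNge v0.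
transitivity (\int[lebesgue_measure]_(t in `]0%R, v[) ((g v)%:E * (t `^ (a - 1))%:E))%E.
  rewrite [RHS]integral_mkcond; apply: eq_integral => t _; rewrite patchE mem_setE in_itv/=.
  by case: ifP => // _; rewrite mulrC EFinM.
have mp : measurable_fun setT (fun t : K => (t `^ (a - 1))%:E).
  by apply/measurable_EFinP; exact: measurable_powR.
rewrite ge0_integralZl//; last 3 first.
- exact: measurable_funTS.
- by move=> x _; rewrite lee_fin powR_ge0.
- by rewrite lee_fin.
rewrite integral_itv_bndo_bndc; last exact: measurable_funTS.
by rewrite integral_powR_itv// -EFinM mulrC.
Qed.

(** Exponential kernel of total mass 1 / c in u, extended by 0 so that all integrals run over the
    whole line. *)
Definition exp_weight (K : realType) (c u : K) : K :=
  if 0 < u then 1 / 2 * expR (- (u * c) / 2) else 0.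

Lemma exp_weight_ge0 (K : realType) (c u : K) : 0 <= exp_weight c u.
Proof. by rewrite /exp_weight; case: ifP => // _; rewrite mulr_ge0// expR_ge0. Qed.

Lemma measurable_exp_weight (K : realType) (d : measure_display) (T : measurableType d)
    (c u : T -> K) : measurable_fun setT c -> measurable_fun setT u ->
  measurable_fun setT (fun x => exp_weight (c x) (u x)).
Proof.
move=> mc mu; apply: measurable_fun_ifT => //; first exact: measurable_fun_ltr.
apply: measurable_funM => //; apply: measurableT_comp => //; apply: measurable_funM => //.
by apply: measurableT_comp => //; exact: measurable_funM.
Qed.

Lemma integral_div_exp (K : realType) (d : measure_display) (T : measurableType d)
    (P : probability T K) (h c : T -> K) :
  measurable_fun setT h -> measurable_fun setT c ->
  (forall w, 0 <= h w) -> (forall w, 0 < c w) ->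
  (\int[P]_w (h w / c w)%:E =
   \int[lebesgue_measure]_u \int[P]_w (h w * exp_weight (c w) u)%:E)%E.
Proof.
move=> mh mc h0 c0.
pose f (x : T * measurableTypeR K) : \bar K := (h x.1 * exp_weight (c x.1) x.2)%:E.
have mf : measurable_fun setT f.
  apply/measurable_EFinP; apply: measurable_funM.
    exact: (measurableT_comp mh measurable_fst).
  apply: measurable_exp_weight; last exact: measurable_snd.
  exact: (measurableT_comp mc measurable_fst).
have f0 x : (0 <= f x)%E by rewrite lee_fin mulr_ge0 ?exp_weight_ge0.
transitivity (\int[P]_w \int[lebesgue_measure]_u f (w, u))%E.
  apply: eq_integral => w _; rewrite /f/=.
  transitivity ((h w)%:E * \int[lebesgue_measure]_u (exp_weight (c w) u)%:E)%E.
    by rewrite integral_exp_weight// -EFinM.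
  rewrite -ge0_integralZl//.
  - by apply/measurable_EFinP; exact: measurable_exp_weight.
  - by move=> u _; rewrite lee_fin exp_weight_ge0.
  - by rewrite lee_fin.
by rewrite (fubini_tonelli f mf f0).
Qed.

(** Each of the two factors 1 / c receives its own exponential variable. *)
Lemma integral_div_sqr_exp (K : realType) (d : measure_display) (T : measurableType d)
    (P : probability T K) (h c : T -> K) :
  measurable_fun setT h -> measurable_fun setT c ->
  (forall w, 0 <= h w) -> (forall w, 0 < c w) ->
  (\int[P]_w (h w / c w ^+ 2)%:E = \int[lebesgue_measure]_v \int[lebesgue_measure]_u
     \int[P]_w (h w * exp_weight (c w) v * exp_weight (c w) u)%:E)%E.
Proof.
move=> mh mc h0 c0.
have mic : measurable_fun setT (fun w => (c w)^-1).
  exact: (measurableT_comp (@measurable_invr K) mc).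
transitivity (\int[P]_w ((h w / c w) / c w)%:E)%E.
  by apply: eq_integral => w _; rewrite -exprVn expr2 mulrA.
rewrite integral_div_exp//; last 2 first.
- exact: measurable_funM.
- by move=> w; rewrite divr_ge0// ltW.
apply: eq_integral => v _.
transitivity (\int[P]_w ((h w * exp_weight (c w) v) / c w)%:E)%E.
  by apply: eq_integral => w _; rewrite mulrAC.
rewrite integral_div_exp//.
- by apply: measurable_funM => //; exact: measurable_exp_weight.
- by move=> w; rewrite mulr_ge0// exp_weight_ge0.
Qed.

(** The part of the tilted Gamma density that depends on v = t + u alone. *)
Definition gamma_tail (K : realType) (nu : K) (p q : nat) (v : K) : K :=
  expR (- (nu * v) / 2) * v `^ (- (p%:R / 2) - q%:R).

Lemma gamma_tail_ge0 (K : realType) (nu : K) (p q : nat) (v : K) :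
  0 <= gamma_tail nu p q v.
Proof. by rewrite mulr_ge0 ?expR_ge0 ?powR_ge0. Qed.

Lemma measurable_gamma_tail (K : realType) (nu : K) (p q : nat) :
  measurable_fun setT (gamma_tail nu p q).
Proof.
apply: measurable_funM; last exact: measurable_powR.
apply: measurableT_comp => //; apply: measurable_funM => //.
by apply: measurableT_comp => //; exact: measurable_funM.
Qed.

Definition gamma_cst (K : realType) (nu : K) : K := (nu / 2) `^ (nu / 2) / Gamma (nu / 2).

Lemma Gamma_ge0 (K : realType) (x : K) : 0 <= Gamma x.
Proof.
by apply: Rintegral_ge0 => t _; rewrite mulr_ge0 ?powR_ge0 ?expR_ge0.
Qed.

Lemma gamma_cst_ge0 (K : realType) (nu : K) : 0 <= gamma_cst nu.
Proof. by rewrite divr_ge0 ?powR_ge0 ?Gamma_ge0. Qed.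

Lemma powR_pos (K : realType) (x a : K) : 0 < x -> x `^ a = expR (a * ln x).
Proof. by move=> x0; rewrite /powR gt_eqF. Qed.

Lemma sqrt_expn (K : realType) (x : K) (n : nat) : 0 < x ->
  Num.sqrt x ^+ n = expR (n%:R / 2 * ln x).
Proof.
move=> x0; rewrite -powR12_sqrt ?ltW// powR_pos// -expRM_natl; congr expR.
by field.
Qed.

(** The Gamma law and the exponential weight share the rate nu / 2, so their exponentials combine
    into one of t + u. Apart from it, t enters only through the power (nu + p) / 2 - 1. *)
Lemma gamma_tilt_power (K : realType) (nu u t : K) (p q : nat) :
  0 < u -> 0 < t ->
  gamma_pdf (nu / 2) (nu / 2) t * tilt_power p u q t * expR (- (u * nu) / 2) =
  gamma_cst nu * (t `^ ((nu + p%:R) / 2 - 1) * gamma_tail nu p q (t + u)).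
Proof.
move=> u0 t0; have tu0 := addr_gt0 t0 u0.
rewrite /gamma_pdf t0 /tilt_power t0 /gamma_tail -/(gamma_cst nu).
rewrite sqrt_expn ?divr_gt0// !powR_pos// ln_div ?posrE//.
have -> : (t + u) ^+ q = expR (q%:R * ln (t + u)).
  by rewrite expRM_natl lnK// posrE.
rewrite -expRN -!mulrA; congr (_ * (_ * _)); rewrite -!expRD; congr expR; ring.
Qed.

(** The powers p / 2 and q cancel and the Gamma density reappears; as its total mass is 1, no value
    of the Gamma function has to be computed. *)
Lemma gamma_tail_power (K : realType) (nu v : K) (p q : nat) : 0 < v ->
  gamma_cst nu * (v `^ ((nu + p%:R) / 2 - 1 + q%:R) * gamma_tail nu p q v) =
  gamma_pdf (nu / 2) (nu / 2) v.
Proof.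
move=> v0; rewrite /gamma_pdf v0 /gamma_tail -/(gamma_cst nu) !powR_pos//.
by rewrite -!mulrA; congr (_ * (_ * _)); rewrite -!expRD; congr expR; ring.
Qed.

Lemma ge0_integral2Zl (K : realType) (f : measurableTypeR K * measurableTypeR K -> \bar K)
    (c : K) : measurable_fun setT f -> (forall y, (0 <= f y)%E) -> 0 <= c ->
  (\int[lebesgue_measure]_v \int[lebesgue_measure]_u (c%:E * f (v, u)) =
   c%:E * \int[lebesgue_measure]_v \int[lebesgue_measure]_u f (v, u))%E.
Proof.
move=> mf f0 c0.
have mI := @measurable_fun_fubini_tonelli_F _ _ (measurableTypeR K) (measurableTypeR K) K
  lebesgue_measure f mf f0.
have mfv v : measurable_fun setT (fun u => f (v, u)).
  exact: (measurableT_comp mf (pair1_measurable v)).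
rewrite -(@ge0_integralZl _ _ _ lebesgue_measure _ measurableT (fubini_F lebesgue_measure f) mI) ?lee_fin//.
  by apply: eq_integral => v _; rewrite ge0_integralZl ?lee_fin.
by move=> v _; apply: integral_ge0.
Qed.

Section ratio_moments.
Context (K : realType) (m : probability K K) (nu : K) (p : nat)
  (nu0 : 0 < nu) (gam : is_gamma (nu / 2) (nu / 2) m).

Let a := (nu + p%:R) / 2.

Let a0 : 0 < a.
Proof. by rewrite divr_gt0// ltr_wpDr. Qed.

Lemma measurable_gamma_pdf : measurable_fun setT (gamma_pdf (nu / 2) (nu / 2)).
Proof.
apply: measurable_fun_ifT => //; first exact: measurable_fun_ltr.
apply: measurable_funM; first by apply: measurable_funM => //; exact: measurable_powR.
by apply: measurableT_comp => //; apply: measurableT_comp => //; exact: measurable_funM.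
Qed.

Lemma gamma_pdf_ge0 (t : K) : 0 <= gamma_pdf (nu / 2) (nu / 2) t.
Proof.
rewrite /gamma_pdf; case: ifP => // _.
by rewrite mulr_ge0 ?expR_ge0// mulr_ge0 ?powR_ge0// gamma_cst_ge0.
Qed.

Lemma measurable_tilt_power (u : K) (q : nat) : measurable_fun setT (tilt_power p u q).
Proof.
apply: measurable_fun_ifT => //; first exact: measurable_fun_ltr.
apply: measurable_funM.
  apply: measurable_funX; apply: (measurableT_comp (@measurable_sqrt K)).
  apply: measurable_funM => //; apply: (measurableT_comp (@measurable_invr K)).
  exact: measurable_funD.
apply: (measurableT_comp (@measurable_invr K)); apply: measurable_funX.
exact: measurable_funD.
Qed.

Lemma tilt_power_ge0 (u t : K) (q : nat) : 0 < u -> 0 <= tilt_power p u q t.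
Proof.
move=> u0; rewrite /tilt_power; case: ifP => // t0.
by rewrite divr_ge0 ?exprn_ge0 ?sqrtr_ge0// ltW// addr_gt0.
Qed.

Lemma tilt_power_le (u t : K) (q : nat) : 0 < u -> tilt_power p u q t <= u ^- q.
Proof.
move=> u0; rewrite /tilt_power; case: ifP => t0; last by rewrite invr_ge0 exprn_ge0// ltW.
have tu0 := addr_gt0 t0 u0.
rewrite -[leRHS]mul1r; apply: ler_pM.
- by rewrite exprn_ge0// sqrtr_ge0.
- by rewrite invr_ge0 exprn_ge0// ltW.
- rewrite exprn_ile1 ?sqrtr_ge0// -[leRHS]sqrtr1 ler_sqrt//.
  by rewrite ler_pdivrMr// mul1r lerDl ltW.
- rewrite lef_pV2 ?posrE ?exprn_gt0//; apply: lerXn2r; rewrite ?nnegrE ?ltW//.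
  by rewrite ltrDr.
Qed.

Let J (q : nat) (u : K) : \bar K := (\int[lebesgue_measure]_t
  (if (0 < u)%R && (0 < t)%R then t `^ (a - 1) * gamma_tail nu p q (t + u)%R else 0)%:E)%E.

Lemma tilt_power_gamma (u : K) (q : nat) : 0 < u ->
  (expR (- (u * nu) / 2) * \int[m]_t tilt_power p u q t)%:E =
  ((gamma_cst nu)%:E * J q u)%E.
Proof.
move=> u0.
have ti : m.-integrable setT (EFin \o tilt_power p u q).
  apply: (bounded_integrable (probability_setT _) (M := u ^- q)) => //.
    exact: measurable_tilt_power.
  by move=> t; rewrite ger0_norm ?tilt_power_ge0 ?tilt_power_le.
rewrite EFinM -Rintegral_EFin//.
rewrite (@ge0_integral_density _ _ _ _ _ m (@lebesgue_measure K) id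
    (EFin \o gamma_pdf (nu / 2) (nu / 2))) //; last 4 first.
- by apply/measurable_EFinP; exact: measurable_gamma_pdf.
- by move=> x; rewrite lee_fin gamma_pdf_ge0.
- by apply/measurable_EFinP; exact: measurable_tilt_power.
- by move=> x; rewrite lee_fin tilt_power_ge0.
rewrite -ge0_integralZl//; last 2 first.
- apply: emeasurable_funM.
    by apply/measurable_EFinP; exact: measurable_gamma_pdf.
  by apply/measurable_EFinP; exact: measurable_tilt_power.
- by move=> x _; rewrite -EFinM lee_fin mulr_ge0 ?gamma_pdf_ge0 ?tilt_power_ge0.
rewrite /J -ge0_integralZl//; last 3 first.
- apply/measurable_EFinP; apply: measurable_fun_ifT => //.
    by apply: measurable_and => //; exact: measurable_fun_ltr.
  apply: measurable_funM; first exact: measurable_powR.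
  by apply: (measurableT_comp (@measurable_gamma_tail K nu p q)); exact: measurable_funD.
- by move=> t _; rewrite lee_fin; case: ifP => // _; rewrite mulr_ge0 ?powR_ge0 ?gamma_tail_ge0.
- by rewrite lee_fin gamma_cst_ge0.
apply: eq_integral => t _; rewrite u0 /= -!EFinM; congr (_%:E).
case: ifPn => t0; last by rewrite /gamma_pdf (negbTE t0) mul0r !mulr0.
by rewrite -gamma_tilt_power// mulrC.
Qed.

Lemma integral_gamma_pdf : (\int[lebesgue_measure]_t (gamma_pdf (nu / 2) (nu / 2) t)%:E = 1)%E.
Proof. by rewrite -(gam measurableT) probability_setT. Qed.

Lemma integral_gamma_tail (q : nat) (b : K) : b = a - 1 + q%:R ->
  ((gamma_cst nu)%:E * \int[lebesgue_measure]_v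
    (if (0 < v)%R then v `^ b * gamma_tail nu p q v else 0)%:E = 1)%E.
Proof.
move=> ->; rewrite -integral_gamma_pdf -ge0_integralZl//; last 3 first.
- apply/measurable_EFinP; apply: measurable_fun_ifT => //; first exact: measurable_fun_ltr.
  by apply: measurable_funM; [exact: measurable_powR|exact: measurable_gamma_tail].
- by move=> t _; rewrite lee_fin; case: ifP => // _; rewrite mulr_ge0 ?powR_ge0 ?gamma_tail_ge0.
- by rewrite lee_fin gamma_cst_ge0.
apply: eq_integral => v _; rewrite -EFinM; congr (_%:E).
case: ifPn => v0; last by rewrite mulr0 /gamma_pdf (negbTE v0).
exact: gamma_tail_power.
Qed.

Let mJ (q : nat) : measurable_fun setT (J q).
Proof.
apply: (@measurable_fun_fubini_tonelli_F _ _ (measurableTypeR K) (measurableTypeR K) K lebesgue_measure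
  (fun x => (if (0 < x.1)%R && (0 < x.2)%R then x.2 `^ (a - 1) * gamma_tail nu p q (x.2 + x.1)%R else 0)%:E)).
- apply/measurable_EFinP; apply: measurable_fun_ifT => //.
    by apply: measurable_and; apply: measurable_fun_ltr.
  apply: measurable_funM.
    by apply: (measurableT_comp (@measurable_powR K (a - 1))); exact: measurable_snd.
  apply: (measurableT_comp (@measurable_gamma_tail K nu p q)).
  by apply: measurable_funD; [exact: measurable_snd|exact: measurable_fst].
- by move=> t; rewrite lee_fin; case: ifP => // _; rewrite mulr_ge0 ?powR_ge0 ?gamma_tail_ge0.
Qed.

Let J_ge0 (q : nat) (u : K) : (0 <= J q u)%E.
Proof.
apply: integral_ge0 => t _; rewrite lee_fin; case: ifP => // _.
by rewrite mulr_ge0 ?powR_ge0 ?gamma_tail_ge0.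
Qed.

(** [integral_powR_shift] produces v^a / a, and v^a times the tail is proportional to the Gamma
    density. This 1 / a is the source of 1 / (nu + p) in the second moment. *)
Let integral_J1 : ((gamma_cst nu)%:E * \int[lebesgue_measure]_u J 1 u = (a^-1)%:E)%E.
Proof.
rewrite /J (@integral_powR_shift K a (gamma_tail nu p 1)) //; last 2 first.
- exact: measurable_gamma_tail.
- by move=> v; exact: gamma_tail_ge0.
have -> : (\int[lebesgue_measure]_v (if (0 < v)%R then v `^ a / a * gamma_tail nu p 1 v else 0)%:E =
   (a^-1)%:E * \int[lebesgue_measure]_v (if (0 < v)%R then v `^ a * gamma_tail nu p 1 v else 0)%:E)%E.
  rewrite -ge0_integralZl//; last 3 first.
  - apply/measurable_EFinP; apply: measurable_fun_ifT => //; first exact: measurable_fun_ltr.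
    by apply: measurable_funM; [exact: measurable_powR|exact: measurable_gamma_tail].
  - by move=> t _; rewrite lee_fin; case: ifP => // _; rewrite mulr_ge0 ?powR_ge0 ?gamma_tail_ge0.
  - by rewrite lee_fin invr_ge0 ltW.
  apply: eq_integral => v _; rewrite -EFinM; congr (_%:E).
  by case: ifP => _; [ring|rewrite mulr0].
by rewrite muleCA integral_gamma_tail ?mule1// subrK.
Qed.

(** [integral_powR_shift] is used twice: the exponent a - 1 is raised to a at the cost of 1 / a,
    then to a + 1 at the cost of 1 / (a + 1). *)
Let integral_J2 : ((gamma_cst nu)%:E * \int[lebesgue_measure]_v \int[lebesgue_measure]_u
   (if (0 < v)%R && (0 < u)%R then J 2 (v + u)%R else 0) = ((a * (a + 1))^-1)%:E)%E.
Proof.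
have a1 : 0 < a + 1 by exact: addr_gt0.
pose G (v : K) := (\int[lebesgue_measure]_t (if (0 < v)%R && (0 < t)%R then
    t `^ (a + 1 - 1) * gamma_tail nu p 2 (t + v)%R else 0)%:E)%E.
have G0 v : (0 <= G v)%E.
  apply: integral_ge0 => t _; rewrite lee_fin; case: ifP => // _.
  by rewrite mulr_ge0 ?powR_ge0 ?gamma_tail_ge0.
have GE v : (\int[lebesgue_measure]_u (if (0 < v)%R && (0 < u)%R then J 2 (v + u)%R else 0) =
    (a^-1)%:E * G v)%E.
  case: (ltP 0 v) => v0 /=; last first.
    rewrite integral0_eq//; rewrite /G integral0_eq ?mule0//.
    by move=> t _; rewrite ltNge v0.
  have mg : measurable_fun setT (fun y : K => gamma_tail nu p 2 (y + v)).
    by apply: (measurableT_comp (@measurable_gamma_tail K nu p 2)); exact: measurable_funD.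
  have := @integral_powR_shift K a (fun y : K => gamma_tail nu p 2 (y + v)) a0 mg
    (fun y : K => gamma_tail_ge0 _ _ _ _).
  have -> : (\int[lebesgue_measure]_u (if (0 < u)%R then J 2 (v + u)%R else 0) =
     \int[lebesgue_measure]_u \int[lebesgue_measure]_t (if (0 < u)%R && (0 < t)%R
        then t `^ (a - 1) * gamma_tail nu p 2 (t + u + v) else 0)%:E)%E.
    apply: eq_integral => u _; case: ifPn => u0 /=; last by rewrite integral0_eq.
    rewrite /J; apply: eq_integral => t _; rewrite addr_gt0//=.
    by rewrite addrA addrAC.
  move=> ->; rewrite /G v0 /= -ge0_integralZl//; last 3 first.
  - apply/measurable_EFinP; apply: measurable_fun_ifT => //; first exact: measurable_fun_ltr.
    by apply: measurable_funM; [exact: measurable_powR|exact: mg].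
  - by move=> t _; rewrite lee_fin; case: ifP => // _; rewrite mulr_ge0 ?powR_ge0 ?gamma_tail_ge0.
  - by rewrite lee_fin invr_ge0 ltW.
  apply: eq_integral => y _; rewrite -EFinM; congr (_%:E).
  by case: ifP => _; [rewrite addrK; ring|rewrite mulr0].
under eq_integral do rewrite GE.
have mG : measurable_fun setT G.
  apply: (@measurable_fun_fubini_tonelli_F _ _ (measurableTypeR K) (measurableTypeR K) K lebesgue_measure
    (fun x => (if (0 < x.1)%R && (0 < x.2)%R then x.2 `^ (a + 1 - 1) * gamma_tail nu p 2 (x.2 + x.1)%R else 0)%:E)).
  - apply/measurable_EFinP; apply: measurable_fun_ifT => //.
      by apply: measurable_and; apply: measurable_fun_ltr.
    apply: measurable_funM.
      by apply: (measurableT_comp (@measurable_powR K (a + 1 - 1))); exact: measurable_snd.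
    apply: (measurableT_comp (@measurable_gamma_tail K nu p 2)).
    by apply: measurable_funD; [exact: measurable_snd|exact: measurable_fst].
  - by move=> t; rewrite lee_fin; case: ifP => // _; rewrite mulr_ge0 ?powR_ge0 ?gamma_tail_ge0.
rewrite ge0_integralZl//; last by rewrite lee_fin invr_ge0 ltW.
rewrite /G (@integral_powR_shift K (a + 1) (gamma_tail nu p 2)) //; last 2 first.
- exact: measurable_gamma_tail.
- by move=> v; exact: gamma_tail_ge0.
have -> : (\int[lebesgue_measure]_v (if (0 < v)%R then v `^ (a + 1) / (a + 1) * gamma_tail nu p 2 v else 0)%:E =
   ((a + 1)^-1)%:E * \int[lebesgue_measure]_v (if (0 < v)%R then v `^ (a + 1) * gamma_tail nu p 2 v else 0)%:E)%E.
  rewrite -ge0_integralZl//; last 3 first.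
  - apply/measurable_EFinP; apply: measurable_fun_ifT => //; first exact: measurable_fun_ltr.
    by apply: measurable_funM; [exact: measurable_powR|exact: measurable_gamma_tail].
  - by move=> t _; rewrite lee_fin; case: ifP => // _; rewrite mulr_ge0 ?powR_ge0 ?gamma_tail_ge0.
  - by rewrite lee_fin invr_ge0 ltW.
  apply: eq_integral => v _; rewrite -EFinM; congr (_%:E).
  by case: ifP => _; [ring|rewrite mulr0].
rewrite muleCA [X in (a^-1%:E * X)%E]muleCA.
rewrite integral_gamma_tail ?mule1 -?EFinM ?invfM//.
by ring.
Qed.

Context (d : measure_display) (Om : measurableType d) (P : probability Om K)
  (k : K) (x S : Om -> K) (k0 : 0 <= k) (mx : measurable_fun setT x)
  (mS : measurable_fun setT S) (S0 : forall w, 0 <= S w)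
  (xS : forall w, x w ^+ 2 <= k * S w).

Let c0 w : 0 < nu + S w.
Proof. by rewrite ltr_pwDl. Qed.

Let mc : measurable_fun setT (fun w => nu + S w).
Proof. exact: measurable_funD. Qed.

Let mic : measurable_fun setT (fun w => (nu + S w)^-1).
Proof. exact: (measurableT_comp (@measurable_invr K) mc). Qed.

Let ratio1 w : (1 + S w) / (nu + S w) <= 1 + nu^-1.
Proof.
rewrite ler_pdivrMr//.
have -> : (1 + nu^-1) * (nu + S w) = 1 + S w + (nu + S w / nu).
  by field; rewrite gt_eqF.
by rewrite lerDl addr_ge0 ?divr_ge0// ltW.
Qed.

(** Since x^2 <= k S, a numerator of degree at most 2 j is dominated by a multiple of (nu + S)^j.
    The ratio is bounded, hence integrable for every nu > 0. *)
Lemma integrable_ratio (h : Om -> K) (q j : nat) : measurable_fun setT h ->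
  (forall w, `|h w| <= `|x w| ^+ q) -> (q <= j.*2)%N -> (j <= 2)%N ->
  P.-integrable setT (EFin \o (fun w => h w / (nu + S w) ^+ j)).
Proof.
move=> mh hx qj j2.
pose B := ((1 + k) * (1 + nu^-1)) ^+ j.
apply: (bounded_integrable (probability_setT _) (M := B)) => //.
  by apply: measurable_funM => //; under eq_fun do rewrite -exprVn; exact: measurable_funX.
move=> w; rewrite normrM normfV normrX [`|nu + S w|]gtr0_norm// ler_pdivrMr ?exprn_gt0//.
rewrite /B -exprMn; apply: (le_trans (hx w)).
have A0 : 0 <= (1 + k) * (1 + S w) by rewrite mulr_ge0// addr_ge0.
apply: (@le_trans _ _ (((1 + k) * (1 + S w)) ^+ j)).
  have xA : `|x w| ^+ 2 <= (1 + k) * (1 + S w).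
    rewrite real_normK ?num_real//; apply: (le_trans (xS w)).
    by have := S0 w; move: (S w) => s s0; have := k0; nra.
  have A1 : 1 <= (1 + k) * (1 + S w).
    by have := S0 w; move: (S w) => s s0; have := k0; nra.
  move: (normr_ge0 (x w)) xA A1 A0; move: (`|x w|) ((1 + k) * (1 + S w)) => y A y0 yA A1 A0.
  apply: (@le_trans _ _ (y ^+ q)) => //.
  have [y1|/ltW y1] := leP y 1.
    by apply: (@le_trans _ _ 1); [rewrite exprn_ile1|rewrite exprn_ege1].
  apply: (@le_trans _ _ (y ^+ j.*2)); first by rewrite ler_weXn2l.
  by rewrite -mul2n exprM lerXn2r ?nnegrE ?exprn_ge0.
apply: lerXn2r; rewrite ?nnegrE//.
  by rewrite mulr_ge0 ?(ltW (c0 w))// mulr_ge0 ?addr_ge0// invr_ge0 ltW.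
rewrite -mulrA ler_wpM2l ?addr_ge0//.
by rewrite -ler_pdivrMr.
Qed.

Let e (u : K) w := expR (- (u * S w) / 2).

Let me u : measurable_fun setT (e u).
Proof.
apply: measurableT_comp => //; apply: measurable_funM => //; apply: measurableT_comp => //.
exact: measurable_funM.
Qed.

Lemma integrable_tilted (h : Om -> K) (q : nat) (u : K) : 0 < u ->
  measurable_fun setT h -> (forall w, `|h w| <= `|x w| ^+ q) -> (q <= 4)%N ->
  P.-integrable setT (EFin \o (fun w => h w * e u w)).
Proof.
move=> u0 mh hx q4.
apply: (bounded_integrable (probability_setT _) (M := (1 + k) ^+ 2 * (1 + 4 / u) ^+ 2)) => //.
  exact: measurable_funM.
move=> w; rewrite normrM [X in _ * X]ger0_norm ?expR_ge0//.
apply: (@le_trans _ _ (((1 + k) * (1 + S w)) ^+ 2 * e u w)).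
  rewrite ler_wpM2r ?expR_ge0// (le_trans (hx w))//.
  exact: norm_expn_bound.
by rewrite exprMn -mulrA ler_wpM2l ?sqr_ge0// tilt_weight_bound.
Qed.

Let weight1 (h : Om -> K) (q : nat) (u : K) : measurable_fun setT h ->
  (forall w, `|h w| <= `|x w| ^+ q) -> (q <= 4)%N ->
  (\int[P]_w (h w * exp_weight (nu + S w) u)%:E =
   if (0 < u)%R then (1 / 2 * expR (- (u * nu) / 2) * \int[P]_w (h w * e u w))%:E else 0)%E.
Proof.
move=> mh hx q4; case: ifPn => u0; last first.
  by apply: integral0_eq => w _; rewrite /exp_weight (negbTE u0) mulr0.
have ih := integrable_tilted u0 mh hx q4.
rewrite -RintegralZl// -Rintegral_EFin//; last exact: (integrableZl measurableT _ ih).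
apply: eq_integral => w _; congr (_%:E); rewrite /exp_weight u0 /e.
rewrite [expR (- (u * (nu + S w)) / 2)](_ : _ = expR (- (u * nu) / 2) * expR (- (u * S w) / 2)).
  by ring.
by rewrite -expRD; congr expR; ring.
Qed.

Let weight2 (h : Om -> K) (q : nat) (u v : K) : measurable_fun setT h ->
  (forall w, `|h w| <= `|x w| ^+ q) -> (q <= 4)%N ->
  (\int[P]_w (h w * exp_weight (nu + S w) v * exp_weight (nu + S w) u)%:E =
   if (0 < v)%R && (0 < u)%R then
     (1 / 4 * expR (- ((v + u) * nu) / 2) * \int[P]_w (h w * e (v + u) w))%:E else 0)%E.
Proof.
move=> mh hx q4; case: ifPn => uv0; last first.
  apply: integral0_eq => w _; rewrite /exp_weight; move: uv0; rewrite negb_and.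
  by move=> /orP[/negbTE ->|/negbTE ->]; rewrite ?mulr0 ?mul0r.
move: uv0 => /andP[v0 u0].
have ih := integrable_tilted (addr_gt0 v0 u0) mh hx q4.
rewrite -RintegralZl// -Rintegral_EFin//; last exact: (integrableZl measurableT _ ih).
apply: eq_integral => w _; congr (_%:E); rewrite /exp_weight u0 v0 /e.
transitivity (h w * (1 / 4) * (expR (- (v * (nu + S w)) / 2) * expR (- (u * (nu + S w)) / 2))).
  by field.
transitivity (h w * (1 / 4) * (expR (- ((v + u) * nu) / 2) * expR (- ((v + u) * S w) / 2))).
  by congr (_ * _); rewrite -!expRD; congr expR; ring.
by ring.
Qed.

(** The exponential representation rests on Tonelli, so h is split into its positive and negative
    parts. Vanishing tilted means say that the two parts have equal tilted integrals, hence equal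
    ratio integrals. *)
Lemma odd_ratio (h : Om -> K) (q j : nat) : measurable_fun setT h ->
  (forall w, `|h w| <= `|x w| ^+ q) -> (q <= j.*2)%N -> (0 < j <= 2)%N ->
  (forall u, 0 < u -> \int[P]_w (h w * e u w) = 0) ->
  \int[P]_w (h w / (nu + S w) ^+ j) = 0.
Proof.
move=> mh hx qj /andP[j0 j2] h0.
have q4 : (q <= 4)%N by apply: (leq_trans qj); rewrite -[4%N]/(2.*2) leq_double.
pose hp w := Num.max (h w) 0; pose hm w := Num.max (- h w) 0.
have mhp : measurable_fun setT hp by apply: measurable_maxr.
have mhm : measurable_fun setT hm.
  by apply: measurable_maxr => //; exact: measurableT_comp.
have hB w : h w = hp w - hm w.
  rewrite /hp /hm; move: (h w) => y.
  by case: (leP y 0) => y0; case: (leP (- y) 0) => y0'; lra.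
have max_norm (y : K) : `|Num.max y 0| <= `|y|.
  by case: (leP y 0) => // _; rewrite normr0.
have hpx w : `|hp w| <= `|x w| ^+ q by apply: le_trans (max_norm _) (hx w).
have hmx w : `|hm w| <= `|x w| ^+ q.
  by apply: le_trans (max_norm _) _; rewrite normrN.
have hp0 w : 0 <= hp w by rewrite le_max lexx orbT.
have hm0 w : 0 <= hm w by rewrite le_max lexx orbT.
have hpm u : 0 < u -> \int[P]_w (hp w * e u w) = \int[P]_w (hm w * e u w).
  move=> u0; apply/eqP; rewrite -subr_eq0 -RintegralB//; last 2 first.
  - exact: integrable_tilted u0 mhp hpx q4.
  - exact: integrable_tilted u0 mhm hmx q4.
  rewrite -[X in _ == X](h0 u u0); apply/eqP; apply: eq_Rintegral => w _.
  by rewrite -mulrBl -hB.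
have E : (\int[P]_w (hp w / (nu + S w) ^+ j)%:E = \int[P]_w (hm w / (nu + S w) ^+ j)%:E)%E.
  case: j j0 j2 {qj} => [//|[|[|//]]] _ _.
    under eq_integral do rewrite expr1; under [RHS]eq_integral do rewrite expr1.
    rewrite (integral_div_exp P mhp mc hp0 c0) (integral_div_exp P mhm mc hm0 c0); apply: eq_integral => u _.
    rewrite (weight1 u mhp hpx q4) (weight1 u mhm hmx q4).
    by case: ifP => // u0; rewrite hpm.
  rewrite (integral_div_sqr_exp P mhp mc hp0 c0) (integral_div_sqr_exp P mhm mc hm0 c0); apply: eq_integral => v _; apply: eq_integral => u _.
  rewrite (weight2 u v mhp hpx q4) (weight2 u v mhm hmx q4).
  by case: ifP => // /andP[v0 u0]; rewrite hpm// addr_gt0.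
transitivity (\int[P]_w (hp w / (nu + S w) ^+ j) - \int[P]_w (hm w / (nu + S w) ^+ j)).
  rewrite -RintegralB//; last 2 first.
  - exact: integrable_ratio mhp hpx qj j2.
  - exact: integrable_ratio mhm hmx qj j2.
  by apply: eq_Rintegral => w _; rewrite -mulrBl -hB.
by rewrite /Rintegral E subrr.
Qed.

Lemma even_ratio1 :
  (forall u, 0 < u -> \int[P]_w (x w ^+ 2 * e u w) = k * \int[m]_t tilt_power p u 1 t) ->
  \int[P]_w (x w ^+ 2 / (nu + S w)) = k / (nu + p%:R).
Proof.
move=> H; rewrite /Rintegral integral_div_exp//; last 2 first.
- exact: measurable_funX.
- by move=> w; exact: sqr_ge0.
transitivity (fine (\int[lebesgue_measure]_u ((k / 2)%:E * ((gamma_cst nu)%:E * J 1 u))%E)).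
  congr fine; apply: eq_integral => u _.
  rewrite (@weight1 (fun w => x w ^+ 2) 2 u (measurable_funX _ mx) _ isT); last first.
    by move=> w; rewrite normrX.
  case: ifPn => u0; last first.
    rewrite /J integral0_eq ?mule0// => t _.
    by rewrite (negbTE u0).
  by rewrite H// -tilt_power_gamma// -EFinM; congr (_%:E); ring.
have k2 : 0 <= k / 2 by exact: divr_ge0.
rewrite ge0_integralZl//; last 2 first.
- by apply: measurable_funeM; exact: mJ.
- by move=> u _; rewrite mule_ge0// lee_fin gamma_cst_ge0.
rewrite ge0_integralZl//; last 2 first.
- exact: mJ.
- by rewrite lee_fin gamma_cst_ge0.
rewrite integral_J1 /= /a; field.
by rewrite gt_eqF// ltr_wpDr.
Qed.

Lemma even_ratio2 :
  (forall u, 0 < u -> \int[P]_w (x w ^+ 4 * e u w) = 3 * k ^+ 2 * \int[m]_t tilt_power p u 2 t) ->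
  \int[P]_w (x w ^+ 4 / (nu + S w) ^+ 2) =
    3 * k ^+ 2 / ((nu + p%:R) * (nu + p%:R + 2)).
Proof.
move=> H; rewrite /Rintegral integral_div_sqr_exp//; last 2 first.
- exact: measurable_funX.
- by move=> w; rewrite -[4%N]/(2 * 2)%N exprM sqr_ge0.
pose JJ v u := (if (0 < v)%R && (0 < u)%R then J 2 (v + u)%R else 0)%E.
have JJ0 v u : (0 <= JJ v u)%E by rewrite /JJ; case: ifP.
have mJJ : measurable_fun setT (fun y : measurableTypeR K * measurableTypeR K => JJ y.1 y.2).
  apply: measurable_fun_ifT => //.
    by apply: measurable_and; apply: measurable_fun_ltr.
  apply: (measurableT_comp (mJ 2)); apply: measurable_funD; [exact: measurable_fst|exact: measurable_snd].
have c40 : 0 <= 3 * k ^+ 2 / 4 by rewrite divr_ge0// mulr_ge0// sqr_ge0.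
have cgk : 0 <= 3 * k ^+ 2 / 4 * gamma_cst nu by rewrite mulr_ge0 ?gamma_cst_ge0.
have E := ge0_integral2Zl mJJ (fun y => JJ0 y.1 y.2) cgk.
rewrite /JJ EFinM -[RHS]muleA integral_J2 in E.
transitivity (fine ((3 * k ^+ 2 / 4)%:E * ((a * (a + 1))^-1)%:E)%E).
  rewrite -E; congr fine; apply: eq_integral => v _; apply: eq_integral => u _.
  rewrite (@weight2 (fun w => x w ^+ 4) 4 u v (measurable_funX _ mx) _ isT); last first.
    by move=> w; rewrite normrX.
  case: ifPn => uv0; last by rewrite !mule0.
  move: uv0 => /andP[v0 u0]; have vu0 := addr_gt0 v0 u0.
  rewrite H// EFinM -muleA -tilt_power_gamma// -EFinM; congr (_%:E); by field.
rewrite /= /a; field.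
have n0 : 0 < nu + p%:R by rewrite ltr_wpDr.
by rewrite !gt_eqF// addr_gt0.
Qed.
End ratio_moments.

(** Integrability travels with the value, so that linear combinations of means carry no side
    conditions. *)
Definition has_mean (K : realType) (d : measure_display) (Om : measurableType d)
    (P : probability Om K) (f : Om -> K) (a : K) : Prop :=
  P.-integrable setT (EFin \o f) /\ \int[P]_w f w = a.

Section has_mean.
Context (K : realType) (d : measure_display) (Om : measurableType d)
  (P : probability Om K).
Implicit Types (f g : Om -> K) (a b c : K).

Lemma eq_has_mean f g a b : has_mean P f a -> f =1 g -> a = b -> has_mean P g b.
Proof. by move=> + /funext <- <-. Qed.

Lemma has_mean_cst c : has_mean P (fun=> c) c.
Proof.
split.
  apply: (bounded_integrable (probability_setT _) (M := `|c|)) => //.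
rewrite Rintegral_cst//.
exact: (etrans (congr1 (fun y => c * fine y) (probability_setT P)) (mulr1 c)).
Qed.

Lemma has_meanD f g a b :
  has_mean P f a -> has_mean P g b -> has_mean P (fun w => f w + g w) (a + b).
Proof.
move=> [fi <-] [gi <-]; split; last by rewrite RintegralD.
exact: (integrableD measurableT fi gi).
Qed.

Lemma has_meanZ c f a : has_mean P f a -> has_mean P (fun w => c * f w) (c * a).
Proof.
move=> [fi <-]; split; last by rewrite RintegralZl.
exact: (integrableZl measurableT c fi).
Qed.

Lemma has_mean_sum (I : Type) (s : seq I) (f : I -> Om -> K) (a : I -> K) :
  (forall i, has_mean P (f i) (a i)) ->
  has_mean P (fun w => \sum_(i <- s) f i w) (\sum_(i <- s) a i).
Proof.
move=> H; elim: s => [|i s IH].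
  apply: (eq_has_mean (has_mean_cst 0)) => [w|]; by rewrite big_nil.
apply: (eq_has_mean (has_meanD (H i) IH)) => [w|]; by rewrite big_cons.
Qed.
End has_mean.

(** With A = |a|^2, B = a.z and C = |z|^2, the squared norm of A z - B a is A (A C - B^2). *)
Lemma cauchy_schwarz_mx (R : realFieldType) (p : nat) (a z : 'cV[R]_p) :
  (a^T *m z) 0 0 ^+ 2 <= (a^T *m a) 0 0 * (z^T *m z) 0 0.
Proof.
set A := (a^T *m a) 0 0; set B := (a^T *m z) 0 0; set C := (z^T *m z) 0 0.
have [a0|a0] := eqVneq a 0.
  by rewrite /B /A a0 trmx0 !mul0mx !mxE expr0n/= mul0r.
have A0 : 0 < A by exact: dot_gt0.
rewrite -subr_ge0 -(pmulr_rge0 _ A0).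
have <- : ((A *: z - B *: a)^T *m (A *: z - B *: a)) 0 0 = A * (A * C - B ^+ 2).
  have H s t : ((s *: z - t *: a)^T *m (s *: z - t *: a)) 0 0 =
      s ^+ 2 * (z^T *m z) 0 0 + (- (2 * s * t) * (a^T *m z) 0 0 + t ^+ 2 * (a^T *m a) 0 0).
    rewrite !mulmx_dotE !mulr_sumr -!big_split/=.
    by apply: eq_bigr => i _; rewrite !mxE; ring.
  by rewrite H -/A -/B -/C; ring.
exact: dot_ge0.
Qed.

(** * Means of quadratics and of their products for a standardized t vector *)

Section t_moments.
Context (K : realType) (d : measure_display) (Om : measurableType d)
  (P : probability Om K) (m : probability K K) (nu : K) (p : nat)
  (nu0 : 0 < nu) (gam : is_gamma (nu / 2) (nu / 2) m)
  (z : Om -> 'cV[K]_p) (mz : forall k, measurable_fun setT (fun w => z w k 0)).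
Hypothesis z_cf : forall b : 'cV[K]_p,
  \int[P]_w cos ((b^T *m z w) 0 0) =
    \int[m]_(t in `]0, +oo[) expR (- ((b^T *m b) 0 0 / t) / 2) /\
  \int[P]_w sin ((b^T *m z w) 0 0) = 0.

Let S w := ((z w)^T *m z w) 0 0.
Let x (b : 'cV[K]_p) w := (b^T *m z w) 0 0.
Let dot (a b : 'cV[K]_p) := (a^T *m b) 0 0.
Let D w := nu + S w.
Let n : K := nu + p%:R.
Let kap : K := (n * (n + 2))^-1.

Let mx b : measurable_fun setT (x b).
Proof.
rewrite /x; under eq_fun do rewrite mulmx_dotE.
by apply: measurable_sum => i; exact: measurable_funM.
Qed.

Let mS : measurable_fun setT S.
Proof.
rewrite /S; under eq_fun do rewrite mulmx_dotE.
by apply: measurable_sum => i; exact: measurable_funM.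
Qed.

Let S0 w : 0 <= S w.
Proof. exact: dot_ge0. Qed.

Let n0 : 0 < n.
Proof. by rewrite ltr_wpDr. Qed.

Let D0 w : 0 < D w.
Proof. by rewrite ltr_pwDl. Qed.

Let dot0 b : 0 <= dot b b.
Proof. exact: dot_ge0. Qed.

Let tilted u b : 0 < u -> forall c,
  \int[P]_w (cos (c * x b w) * expR (- (u * S w) / 2)) =
     \int[m]_t (if 0 < t then Num.sqrt (t / (t + u)) ^+ p *
        expR (- (c ^+ 2 * dot b b / (t + u)) / 2) else 0) /\
  \int[P]_w (sin (c * x b w) * expR (- (u * S w) / 2)) = 0.
Proof.
move=> u0 c.
have H b' : \int[P]_w cos (\sum_k b' k * z w k 0) = \int[m]_t tilt u [::] b' t /\
    \int[P]_w sin (\sum_k b' k * z w k 0) = 0.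
  have [] := z_cf (\col_k b' k).
  have xE w : ((\col_k b' k)^T *m z w) 0 0 = \sum_k b' k * z w k 0.
    by rewrite mulmx_dotE; apply: eq_bigr => k _; rewrite mxE.
  under eq_Rintegral do rewrite xE.
  move=> cE; under eq_Rintegral do rewrite xE.
  move=> sE; split => //; rewrite cE Rintegral_mkcond; apply: eq_Rintegral => t _.
  rewrite /patch /tilt mem_setE in_itv/= andbT; case: ifP => // t0.
  rewrite expr0 mul1r mulmx_dotE mulr_suml; congr (expR (- _ / 2)); apply: eq_bigr => k _.
  by rewrite !mxE mul0r addr0.
(* The list of tilted coordinates is the full enumeration, whence the exponent p of the square
   root. *)
have [] := @cf_tilt K _ _ P m p (fun w k => z w k 0) u u0 mz H (index_enum _) (fun k => c * b k 0)
  (index_enum_uniq _).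
have xE w : \sum_k c * b k 0 * z w k 0 = c * x b w.
  by rewrite /x mulmx_dotE mulr_sumr; apply: eq_bigr => k _; rewrite mulrA.
have SE w : \sum_k u * z w k 0 ^+ 2 = u * S w.
  by rewrite /S mulmx_dotE mulr_sumr.
under eq_Rintegral do rewrite xE SE.
move=> cE; under eq_Rintegral do rewrite xE SE.
move=> sE; split => //; rewrite cE; apply: eq_Rintegral => t _; rewrite /tilt; case: ifP => // t0.
have -> : size (index_enum 'I_p) = p by rewrite -[RHS]card_ord cardT enumT.
congr (_ * expR (- _ / 2)).
rewrite /dot mulmx_dotE mulr_sumr mulr_suml; apply: eq_bigr => k _.
by rewrite mem_index_enum mul1r exprMn expr2.
Qed.

Let moments u b : 0 < u ->
  [/\ \int[P]_w (x b w * expR (- (u * S w) / 2)) = 0,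
      \int[P]_w (x b w ^+ 3 * expR (- (u * S w) / 2)) = 0,
      \int[P]_w (x b w ^+ 2 * expR (- (u * S w) / 2)) = dot b b * \int[m]_t tilt_power p u 1 t &
      \int[P]_w (x b w ^+ 4 * expR (- (u * S w) / 2)) =
        3 * dot b b ^+ 2 * \int[m]_t tilt_power p u 2 t].
Proof.
move=> u0; apply: (tilted_moments u0 (dot0 b) (mx b) mS S0).
  by move=> w; exact: cauchy_schwarz_mx.
exact: tilted.
Qed.

Let xS b w : x b w ^+ 2 <= dot b b * S w.
Proof. exact: cauchy_schwarz_mx. Qed.

Let pow_mean b (q j : nat) a : (q <= j.*2)%N -> (j <= 2)%N ->
  \int[P]_w (x b w ^+ q / (nu + S w) ^+ j) = a ->
  has_mean P (fun w => x b w ^+ q / D w ^+ j) a.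
Proof.
move=> qj j2 E; split => //.
apply: (@integrable_ratio _ _ nu0 _ _ P _ _ _ (dot0 b) mS S0 (xS b) (fun w => x b w ^+ q)
  q j (measurable_funX q (mx b)) _ qj j2).
by move=> w; rewrite normrX.
Qed.

Let mean1 b : has_mean P (fun w => x b w / D w) 0.
Proof.
have H : has_mean P (fun w => x b w ^+ 1 / D w ^+ 1) 0.
  apply: pow_mean => //.
  apply: (@odd_ratio _ _ nu0 _ _ P _ _ _ (dot0 b) mS S0 (xS b) (fun w => x b w ^+ 1)
    1 1 (measurable_funX 1 (mx b))) => //.
  by move=> u u0; have [] := moments b u0.
by apply: (eq_has_mean H) => // w; rewrite !expr1.
Qed.

Let mean2 b : has_mean P (fun w => x b w ^+ 2 / D w) (dot b b / n).
Proof.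
have H : has_mean P (fun w => x b w ^+ 2 / D w ^+ 1) (dot b b / n).
  apply: pow_mean => //.
  under eq_Rintegral do rewrite expr1.
  apply: (even_ratio1 nu0 gam (dot0 b) (mx b) mS S0 (xS b)) => u u0.
  by have [] := moments b u0.
by apply: (eq_has_mean H) => // w; rewrite !expr1.
Qed.

Let mean3 b : has_mean P (fun w => x b w ^+ 3 / D w ^+ 2) 0.
Proof.
apply: pow_mean => //.
apply: (@odd_ratio _ _ nu0 _ _ P _ _ _ (dot0 b) mS S0 (xS b) (fun w => x b w ^+ 3)
  3 2 (measurable_funX 3 (mx b))) => //.
  by move=> w; rewrite normrX.
by move=> u u0; have [] := moments b u0.
Qed.

Let mean4 b : has_mean P (fun w => x b w ^+ 4 / D w ^+ 2) (3 * dot b b ^+ 2 * kap).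
Proof.
apply: pow_mean => //.
apply: (even_ratio2 nu0 gam (dot0 b) (mx b) mS S0 (xS b)) => u u0.
by have [] := moments b u0.
Qed.

Let xD a b w : x (a + b) w = x a w + x b w.
Proof. by rewrite /x linearD /= mulmxDl mxE. Qed.

Let xZ c a w : x (c *: a) w = c * x a w.
Proof. by rewrite /x linearZ /= -scalemxAl mxE. Qed.

Let dotC a b : dot a b = dot b a.
Proof. by rewrite /dot !mulmx_dotE; apply: eq_bigr => i _; rewrite mulrC. Qed.

Let dotDl a b c : dot (a + b) c = dot a c + dot b c.
Proof. by rewrite /dot linearD /= mulmxDl mxE. Qed.

Let dotZl e a c : dot (e *: a) c = e * dot a c.
Proof. by rewrite /dot linearZ /= -scalemxAl mxE. Qed.

Let dot_lin4 a b c d' (e f g : K) :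
  dot (a + (e *: b + (f *: c + g *: d'))) (a + (e *: b + (f *: c + g *: d'))) =
  dot a a + e ^+ 2 * dot b b + f ^+ 2 * dot c c + g ^+ 2 * dot d' d' +
  2 * (e * dot a b + f * dot a c + g * dot a d' + e * f * dot b c + e * g * dot b d' +
       f * g * dot c d').
Proof.
rewrite !(dotDl, dotZl) ![dot _ (_ + _)]dotC !(dotDl, dotZl).
rewrite (dotC b a) (dotC c a) (dotC d' a) (dotC c b) (dotC d' b) (dotC d' c).
by ring.
Qed.

(** Isserlis' formula up to the factor [kap], by polarization of [mean4]: the sum over the eight
    sign patterns of e f g (a + e b + f c + g d')^4 is 8 * 24 = 192 times the product of the four
    linear forms. For cubes below, four patterns give 4 * 6 = 24. *)
Let mean_x4 a b c d' : has_mean P (fun w => x a w * x b w * x c w * x d' w / D w ^+ 2)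
  ((dot a b * dot c d' + dot a c * dot b d' + dot a d' * dot b c) * kap).
Proof.
pose T e f g := has_meanZ (e * f * g / 192) (mean4 (a + (e *: b + (f *: c + g *: d')))).
have H := has_meanD (has_meanD (has_meanD (T 1 1 1) (T 1 1 (-1))) (has_meanD (T 1 (-1) 1) (T 1 (-1) (-1))))
  (has_meanD (has_meanD (T (-1) 1 1) (T (-1) 1 (-1))) (has_meanD (T (-1) (-1) 1) (T (-1) (-1) (-1)))).
apply: (eq_has_mean H) => [w|].
  by rewrite !xD !xZ; field; rewrite gt_eqF.
rewrite !dot_lin4; by field.
Qed.

Let mean_x3 a b c : has_mean P (fun w => x a w * x b w * x c w / D w ^+ 2) 0.
Proof.
pose T e f := has_meanZ (e * f / 24) (mean3 (a + (e *: b + f *: c))).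
have H := has_meanD (has_meanD (T 1 1) (T 1 (-1))) (has_meanD (T (-1) 1) (T (-1) (-1))).
apply: (eq_has_mean H) => [w|]; last by rewrite !mulr0 !addr0.
by rewrite !xD !xZ; field; rewrite gt_eqF.
Qed.

Let mean_x2 a b : has_mean P (fun w => x a w * x b w / D w) (dot a b / n).
Proof.
(* The two null summands give the argument the shape expected by [dot_lin4]. *)
pose T e := has_meanZ (e / 4) (mean2 (a + (e *: b + (0 *: a + 0 *: a)))).
apply: (eq_has_mean (has_meanD (T 1) (T (-1)))) => [w|].
  by rewrite !xD !xZ; field; rewrite gt_eqF.
rewrite !dot_lin4; field; exact: lt0r_neq0.
Qed.

Let u i : 'cV[K]_p := delta_mx i 0.

Let x_u i w : x (u i) w = z w i 0.
Proof. by rewrite /x /u trmx_delta -rowE mxE. Qed.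

Let dot_u a i : dot (u i) a = a i 0.
Proof. by rewrite /dot /u trmx_delta -rowE mxE. Qed.

Let q (M : 'M[K]_p) w := ((z w)^T *m M *m z w) 0 0.

Let qE M w : q M w = \sum_i x (u i) w * x (M^T *m u i) w.
Proof.
rewrite /q -mulmxA mulmx_dotE; apply: eq_bigr => i _; rewrite x_u /x trmx_mul trmxK.
by rewrite /u trmx_delta -mulmxA -rowE [row _ _ _ _]mxE.
Qed.

Let mean_qx1 M : has_mean P (fun w => q M w / D w) (\tr M / n).
Proof.
apply: (eq_has_mean (has_mean_sum (index_enum _) (fun i => mean_x2 (u i) (M^T *m u i)))) => [w|].
  by rewrite qE mulr_suml.
rewrite -mulr_suml; congr (_ / _); apply: eq_bigr => i _.
by rewrite dot_u /u -colE !mxE.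
Qed.

Let mean_lq l M : has_mean P (fun w => x l w * q M w / D w ^+ 2) 0.
Proof.
apply: (eq_has_mean (has_mean_sum (index_enum _) (fun i => mean_x3 l (u i) (M^T *m u i)))) => [w|].
  by rewrite qE mulr_sumr mulr_suml; apply: eq_bigr => i _; rewrite mulrA.
by rewrite big1.
Qed.

Let sum_dot_u a b : \sum_i dot a (u i) * dot b (u i) = dot a b.
Proof. by rewrite {3}/dot mulmx_dotE; apply: eq_bigr => i _; rewrite !(dotC _ (u i)) !dot_u. Qed.

Let mean_llq l l' M : has_mean P (fun w => x l w * x l' w * q M w / D w ^+ 2)
  ((dot l l' * \tr M + (l^T *m M *m l') 0 0 + (l'^T *m M *m l) 0 0) * kap).
Proof.
apply: (eq_has_mean (has_mean_sum (index_enum _) (fun i => mean_x4 l l' (u i) (M^T *m u i)))) => [w|].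
  by rewrite qE mulr_sumr mulr_suml; apply: eq_bigr => i _; rewrite !mulrA.
have H a i : dot a (M^T *m u i) = dot (M *m a) (u i).
  by rewrite /dot trmx_mul mulmxA.
rewrite -mulr_suml; congr (_ * _); rewrite !big_split/= -mulr_sumr; congr (_ * _ + _ + _).
- by apply: eq_bigr => i _; rewrite H dotC dot_u /u -colE mxE.
- by under eq_bigr do rewrite H; rewrite sum_dot_u /dot mulmxA.
- under eq_bigr do rewrite H; under eq_bigr do rewrite mulrC.
  by rewrite sum_dot_u /dot mulmxA.
Qed.

Let mean_qq M N : has_mean P (fun w => q M w * q N w / D w ^+ 2)
  ((\tr M * \tr N + \tr (M *m N^T) + \tr (M *m N)) * kap).
Proof.
apply: (eq_has_mean (has_mean_sum (index_enum _) (fun i => mean_llq (u i) (N^T *m u i) M))) => [w|].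
  by rewrite [q N w]qE mulr_sumr mulr_suml; apply: eq_bigr => i _; rewrite [q M w * _]mulrC.
have E (A : 'M[K]_p) i : ((u i)^T *m A *m u i) 0 0 = A i i.
  by rewrite /u trmx_delta -mulmxA -rowE -colE !mxE.
rewrite -mulr_suml; congr (_ * _); rewrite !big_split/= -mulr_suml mulrC; congr (_ * _ + _ + _).
- by apply: eq_bigr => i _; rewrite /dot mulmxA E mxE.
- by apply: eq_bigr => i _; rewrite mulmxA -[_ *m M *m _]mulmxA E.
- rewrite mxtrace_mulC; apply: eq_bigr => i _.
  by rewrite trmx_mul trmxK -[_ *m N *m M]mulmxA E.
Qed.

Let qS w : q 1%:M w = S w.
Proof. by rewrite /q mulmx1. Qed.

Let D_neq0 w : D w != 0.
Proof. exact: lt0r_neq0. Qed.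

Let nu_neq0 : nu != 0.
Proof. exact: lt0r_neq0. Qed.

Let n_neq0 : n != 0.
Proof. exact: lt0r_neq0. Qed.

Let n2_neq0 : n + 2 != 0.
Proof. by rewrite gt_eqF// addr_gt0. Qed.

Let SD w : S w = D w - nu.
Proof. by rewrite /D addrC addKr. Qed.

(** As S = D - nu, one has 1 / D = (1 - S / D) / nu: a numerator of lower degree is traded for known
    means. The same device serves [mean_xl2], [mean_ll2] and [mean_D2]. *)
Let mean_D1 : has_mean P (fun w => 1 / D w) (1 / n).
Proof.
apply: (eq_has_mean (has_meanZ nu^-1 (has_meanD (has_mean_cst P 1)
  (has_meanZ (- 1) (mean_qx1 1%:M))))) => [w|].
  by rewrite qS SD; have := D_neq0 w; move: (D w) => y y0; field; rewrite y0 nu_neq0.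
by rewrite mxtrace1 [p%:R](_ : _ = n - nu); [field; rewrite n_neq0 nu_neq0|rewrite /n addrC addKr].
Qed.

Let mean_xl2 l : has_mean P (fun w => x l w / D w ^+ 2) 0.
Proof.
apply: (eq_has_mean (has_meanZ nu^-1 (has_meanD (mean1 l) (has_meanZ (- 1) (mean_lq l 1%:M))))) => [w|].
  rewrite qS SD; have := D_neq0 w; move: (D w) => y y0; field; by rewrite y0 nu_neq0.
by rewrite !mulr0 addr0 mulr0.
Qed.

Let mean_ll2 l l' : has_mean P (fun w => x l w * x l' w / D w ^+ 2) (dot l l' * kap).
Proof.
apply: (eq_has_mean (has_meanZ nu^-1 (has_meanD (mean_x2 l l')
  (has_meanZ (- 1) (mean_llq l l' 1%:M))))) => [w|].
  rewrite qS SD; have := D_neq0 w; move: (D w) => y y0; field; by rewrite y0 nu_neq0.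
rewrite mxtrace1 !mulmx1 -/(dot l l') -/(dot l' l) (dotC l' l) /kap.
rewrite [p%:R](_ : _ = n - nu); last by rewrite /n addrC addKr.
field; by rewrite n_neq0 nu_neq0 n2_neq0.
Qed.

Let mean_qx2 M : has_mean P (fun w => q M w / D w ^+ 2) (\tr M * kap).
Proof.
apply: (eq_has_mean (has_mean_sum (index_enum _) (fun i => mean_ll2 (u i) (M^T *m u i)))) => [w|].
  by rewrite qE mulr_suml.
rewrite -mulr_suml; congr (_ * _); apply: eq_bigr => i _.
by rewrite dot_u /u -colE !mxE.
Qed.

Let mean_D2 : has_mean P (fun w => 1 / D w ^+ 2) ((nu + 2) / nu * kap).
Proof.
apply: (eq_has_mean (has_meanZ nu^-1 (has_meanD mean_D1
  (has_meanZ (- 1) (mean_qx2 1%:M))))) => [w|].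
  rewrite qS SD; have := D_neq0 w; move: (D w) => y y0; field; by rewrite y0 nu_neq0.
rewrite mxtrace1 /kap [p%:R](_ : _ = n - nu); last by rewrite /n addrC addKr.
field; by rewrite n_neq0 nu_neq0 n2_neq0.
Qed.

(** Derivatives of the quadratic form are polynomials of degree at most two in z. The Hessian
    contains one of them over D or a product of two over D^2, so this lemma and [t_mean_quad_sqr]
    give all the means that occur. *)
Lemma t_mean_quad (c : K) (l : 'cV[K]_p) (M : 'M[K]_p) :
  has_mean P (fun w => (c + (l^T *m z w) 0 0 + ((z w)^T *m M *m z w) 0 0) /
      (nu + ((z w)^T *m z w) 0 0))
    ((c + \tr M) / (nu + p%:R)).
Proof.
apply: (eq_has_mean (has_meanD (has_meanD (has_meanZ c mean_D1) (mean1 l)) (mean_qx1 M))) => [w|].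
  by rewrite -/(S w) -/(D w) -/(x l w) -/(q M w) !mulrDl mul1r.
by rewrite -/n addr0 mul1r mulrDl.
Qed.

Lemma t_mean_quad_sqr (c c' : K) (l l' : 'cV[K]_p) (M N : 'M[K]_p) :
  has_mean P (fun w => (c + (l^T *m z w) 0 0 + ((z w)^T *m M *m z w) 0 0) *
      (c' + (l'^T *m z w) 0 0 + ((z w)^T *m N *m z w) 0 0) /
      (nu + ((z w)^T *m z w) 0 0) ^+ 2)
    ((c * c' * ((nu + 2) / nu) + c * \tr N + c' * \tr M + (l^T *m l') 0 0 +
      \tr M * \tr N + \tr (M *m N^T) + \tr (M *m N)) /
     ((nu + p%:R) * (nu + p%:R + 2))).
Proof.
have H := has_meanD (has_meanD (has_meanD (has_meanD (has_meanZ (c * c') mean_D2)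
  (has_meanZ c (mean_xl2 l'))) (has_meanD (has_meanZ c (mean_qx2 N)) (has_meanZ c' (mean_xl2 l))))
  (has_meanD (mean_ll2 l l') (mean_lq l N)))
  (has_meanD (has_meanD (has_meanZ c' (mean_qx2 M)) (mean_lq l' M)) (mean_qq M N)).
apply: (eq_has_mean H) => [w|].
  rewrite -/(S w) -/(D w) -!/(x _ w) -!/(q _ w).
  by move: (D w ^+ 2)^-1 => y; ring.
rewrite -/n -/kap -/(dot l l').
by ring.
Qed.
End t_moments.

(** At u = T'b, with T the Kronecker product of the two whitening matrices, the variance u'S u
    becomes b'b. *)
Lemma tBFA_whitened (K : realType) (d : measure_display) (Om : measurableType d)
    (P : probability Om K) (dc dr qc qr : nat) (W : 'M[K]_(dc, dr))
    (C : 'M[K]_(dc, qc)) (Psic : 'M[K]_dc) (R : 'M[K]_(dr, qr))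
    (Psir : 'M[K]_dr) (nu : K) (X : Om -> 'M[K]_(dc, dr)) (Tc : 'M[K]_dc) (Tr : 'M[K]_dr) :
  pos_diag Psic -> pos_diag Psir ->
  tBFA P W C Psic R Psir nu X ->
  Tc *m (C *m C^T + Psic) *m Tc^T = 1%:M -> Tr *m (R *m R^T + Psir) *m Tr^T = 1%:M ->
  exists2 m : probability K K, is_gamma (nu / 2) (nu / 2) m &
    forall b : 'cV[K]_(dr * dc),
    \int[P]_w cos ((b^T *m ((Tr *t Tc) *m vec (X w - W))) 0 0) =
      \int[m]_(t in `]0, +oo[) expR (- ((b^T *m b) 0 0 / t) / 2) /\
    \int[P]_w sin ((b^T *m ((Tr *t Tc) *m vec (X w - W))) 0 0) = 0.
Proof.
move=> pc pr model Ec Er; have [m gam cf] := tBFA_cf pc pr model.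
exists m => // b; have [] := cf ((Tr *t Tc)^T *m b).
have -> : (((Tr *t Tc)^T *m b)^T *m ((R *m R^T + Psir) *t (C *m C^T + Psic)) *m
    ((Tr *t Tc)^T *m b)) = b^T *m b.
  rewrite trmx_mul trmxK !mulmxA -[_ *m _ *m (_ *t _)]mulmxA tensmx_mul.
  by rewrite trmx_tens -[_ *m _ *m (_ *t _)]mulmxA tensmx_mul Ec Er tensmx1 mulmx1.
rewrite trmx_mul trmxK => cE sE.
by split; [rewrite -cE|rewrite -sE]; apply: eq_Rintegral => w _; rewrite mulmxA.
Qed.

(** * The Gamma function *)

(** For t > 0, the k-th derivative in x of the integrand of [Gamma]. *)
Definition Gamma_log (K : realType) (k : nat) (x t : K) : K :=
  ln t ^+ k * t `^ (x - 1) * expR (- t).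

Lemma measurable_Gamma_log (K : realType) (k : nat) (x : K) (D : set K) :
  measurable_fun D (Gamma_log k x).
Proof.
apply: (@measurable_funS _ _ _ _ setT) => //.
apply: measurable_funM; last by apply: measurableT_comp => //; exact: measurableT_comp.
by apply: measurable_funM; [apply: measurable_funX; exact: measurable_ln|exact: measurable_powR].
Qed.

Lemma pos_itv (K : realType) (t : K) : `]0, +oo[%classic t -> 0 < t.
Proof. by rewrite /= in_itv/= andbT. Qed.

(** The inequality ln y <= y - 1 at y = t / (2 b), multiplied by b = |a - 1| + 1, gives b ln t <= t
    / 2 + b (ln (2 b) - 1). The added 1 keeps b positive. *)
Lemma powR_le_expR (K : realType) (a t : K) : 1 <= t ->
  t `^ (a - 1) <= expR ((`|a - 1| + 1) * (ln (2 * (`|a - 1| + 1)) - 1)) * expR (t / 2).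
Proof.
move=> t1; have t0 : 0 < t by exact: lt_le_trans t1.
set b := `|a - 1| + 1; have b0 : 0 < b by rewrite ltr_wpDl.
rewrite /powR gt_eqF// -expRD ler_expR.
have lt0 : 0 <= ln t by exact: ln_ge0.
have h1 : (a - 1) * ln t <= b * ln t.
  by rewrite ler_wpM2r// (le_trans (ler_norm _))// /b lerDl.
have h2 : ln (t / (2 * b)) <= t / (2 * b) - 1.
  have y0 : 0 < t / (2 * b) by rewrite divr_gt0// mulr_gt0.
  by rewrite lerBrDl -[leRHS](lnK y0) expR_ge1Dx.
rewrite ln_div ?posrE ?mulr_gt0// in h2.
apply: (le_trans h1).
have h3 : b * (ln t - ln (2 * b)) <= b * (t / (2 * b) - 1) by rewrite ler_pM2l.
have h4 : b * (t / (2 * b) - 1) = t / 2 - b by field; rewrite gt_eqF.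
by lra.
Qed.

(** On ]0, 1] the power alone dominates and is integrable by [integral_powR_itv]. Beyond 1 the
    integrand is at most c exp(- t / 2), which is 2 c times [exp_weight 1]. *)
Lemma integrable_Gamma (K : realType) (a : K) : 0 < a ->
  lebesgue_measure.-integrable `]0, +oo[ (EFin \o Gamma_log 0 a).
Proof.
move=> a0.
set c := expR ((`|a - 1| + 1) * (ln (2 * (`|a - 1| + 1)) - 1)).
have mD : measurable (`]0, +oo[%classic : set (measurableTypeR K)) by exact: measurable_itv.
have m1 : measurable (`]0, 1]%classic : set (measurableTypeR K)) by exact: measurable_itv.
pose g (t : measurableTypeR K) := t `^ (a - 1) * \1_(`]0, 1]%classic) t + c * 2 * exp_weight 1 t.
have g1 : lebesgue_measure.-integrable setT (fun t : measurableTypeR K => (t `^ (a - 1) * \1_(`]0, 1]%classic) t)%:E).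
  have mf : measurable_fun setT (fun t : measurableTypeR K => (t `^ (a - 1) * \1_(`]0, 1]%classic) t)%:E).
    apply/measurable_EFinP; apply: measurable_funM; first exact: measurable_powR.
    exact: measurable_indic.
  apply/integrableP; split => //.
  have -> : (\int[lebesgue_measure]_x `|(x `^ (a - 1) * \1_(`]0, 1]%classic) x)%:E| =
      (1 `^ a / a)%:E)%E.
    rewrite -(integral_powR_itv a0 ltr01).
    rewrite [RHS]integral_mkcond; apply: eq_integral => t _.
    rewrite patchE indicE; case: ifPn => tI; last by rewrite mulr0 abse0.
    by rewrite mulr1/= ger0_norm// powR_ge0.
  exact: ltry.
have g2 : lebesgue_measure.-integrable setT (fun t : measurableTypeR K => (c * 2 * exp_weight 1 t)%:E).
  have e1 : lebesgue_measure.-integrable setT (fun t : measurableTypeR K => (exp_weight 1 t)%:E).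
    apply/integrableP; split.
      by apply/measurable_EFinP; exact: measurable_exp_weight.
    have -> : (\int[lebesgue_measure]_x `|(exp_weight 1 x)%:E| = (1^-1 : K)%:E)%E.
      rewrite -(integral_exp_weight (@ltr01 K)); apply: eq_integral => t _.
      by rewrite /= ger0_norm ?exp_weight_ge0.
    exact: ltry.
  exact: (integrableZl measurableT (c * 2) e1).
have gi : lebesgue_measure.-integrable setT (EFin \o g).
  exact: (integrableD measurableT g1 g2).
apply: (le_integrable mD _ _ (integrableS measurableT mD (@subsetT _ _) gi)).
  by apply/measurable_EFinP; exact: measurable_Gamma_log.
move=> t /pos_itv t0; rewrite lee_fin.
rewrite !ger0_norm; last 2 first.
- by rewrite addr_ge0 ?mulr_ge0 ?powR_ge0 ?expR_ge0 ?exp_weight_ge0.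
- by rewrite !mulr_ge0 ?powR_ge0 ?expR_ge0.
rewrite /Gamma_log expr0 mul1r /g /exp_weight t0 indicE.
have [t1|t1] := leP t 1.
  rewrite mem_setE in_itv/= t0 t1 /= mulr1n !mulr1.
  apply: (@le_trans _ _ (t `^ (a - 1))); last by rewrite lerDl !mulr_ge0 ?expR_ge0.
  by rewrite ler_piMr ?powR_ge0// -[leRHS]expR0 ler_expR oppr_le0 ltW.
rewrite mem_setE in_itv/= [t <= 1]leNgt t1 andbF mulr0 add0r.
apply: (le_trans (ler_wpM2r (expR_ge0 _) (powR_le_expR a (ltW t1)))).
rewrite -/c -[leLHS]mulrA -expRD.
rewrite [t / 2 - t](_ : _ = - (t * 1) / 2); last by field.
by rewrite le_eqVlt; apply/orP; left; apply/eqP; field.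
Qed.

(** The k-th power of w <= exp w at w = e y / (k + 1). The denominator k + 1 covers k = 0, and k /
    (k + 1) <= 1 brings the exponent down to e y. *)
Lemma expn_le_expR (K : realType) (k : nat) (e y : K) : 0 < e -> 0 <= y ->
  y ^+ k <= (k.+1%:R / e) ^+ k * expR (e * y).
Proof.
move=> e0 y0; set n : K := k.+1%:R; have n0 : 0 < n by rewrite ltr0n.
have -> : y ^+ k = (n / e) ^+ k * (e / n * y) ^+ k.
  by rewrite -exprMn; congr (_ ^+ _); field; rewrite !gt_eqF.
rewrite ler_wpM2l ?exprn_ge0 ?divr_ge0 ?(ltW n0) ?(ltW e0)//.
have h0 : 0 <= e / n * y by rewrite mulr_ge0// divr_ge0// ltW.
apply: (@le_trans _ _ (expR (e / n * y) ^+ k)).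
  apply: lerXn2r; rewrite ?nnegrE ?expR_ge0//.
  by apply: le_trans (expR_ge1Dx _); rewrite lerDr.
rewrite -expRM_natl ler_expR.
rewrite [leLHS](_ : _ = (k%:R / n) * (e * y)); last by ring.
rewrite ler_piMl ?mulr_ge0 ?(ltW e0)//.
by rewrite ler_pdivrMr// mul1r ler_nat.
Qed.

(** By [expn_le_expR] the factor |ln t|^k costs at most a power u / 2 of t or of 1 / t. For t >= 1
    the shape stays below v + u / 2, and for t < 1 above u / 2 because x > u. Two integrands without
    logarithm therefore dominate uniformly for x in ]u, v[. *)
Lemma Gamma_log_bound (K : realType) (k : nat) (u v x t : K) : 0 < u -> u < x -> x < v -> 0 < t ->
  `|Gamma_log k x t| <= (k.+1%:R / (u / 2)) ^+ k *
     (Gamma_log 0 (u / 2) t + Gamma_log 0 (v + u / 2) t).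
Proof.
move=> u0 ux xv t0; have e0 : 0 < u / 2 by rewrite divr_gt0.
rewrite /Gamma_log !expr0 !mul1r -mulrDl mulrA normrM [X in _ * X <= _]gtr0_norm ?expR_gt0//.
rewrite ler_wpM2r ?expR_ge0// /powR gt_eqF// normrM normrX [X in _ * X <= _]gtr0_norm ?expR_gt0//.
move: (ln t) => s.
have h := expn_le_expR k e0 (normr_ge0 s).
apply: (le_trans (ler_wpM2r (expR_ge0 _) h)); rewrite -[leLHS]mulrA -expRD.
apply: ler_wpM2l; first by rewrite exprn_ge0// divr_ge0// ltW.
have [s0|s0] := leP 0 s.
  rewrite ger0_norm//; apply: (@le_trans _ _ (expR ((v + u / 2 - 1) * s))).
    by rewrite ler_expR -mulrDl ler_wpM2r//; lra.
  by rewrite lerDr expR_ge0.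
rewrite ltr0_norm//; apply: (@le_trans _ _ (expR ((u / 2 - 1) * s))).
  rewrite ler_expR mulrN -mulNr -mulrDl; apply: ler_wnM2r; first exact: ltW.
  by lra.
by rewrite lerDl expR_ge0.
Qed.

Lemma integrable_Gamma_bound (K : realType) (c u v : K) : 0 < u -> 0 < v ->
  lebesgue_measure.-integrable `]0, +oo[
    (EFin \o (fun t => c * (Gamma_log 0 (u / 2) t + Gamma_log 0 (v + u / 2) t))).
Proof.
move=> u0 v0; have e0 : 0 < u / 2 by rewrite divr_gt0.
have mD : measurable (`]0, +oo[%classic : set (measurableTypeR K)) by exact: measurable_itv.
have H := integrableD mD (integrable_Gamma e0) (integrable_Gamma (addr_gt0 v0 e0)).
exact: (integrableZl mD c H).
Qed.

Lemma integrable_Gamma_log (K : realType) (k : nat) (x : K) : 0 < x ->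
  lebesgue_measure.-integrable `]0, +oo[ (EFin \o Gamma_log k x).
Proof.
move=> x0; have u0 : 0 < x / 2 by rewrite divr_gt0.
have mD : measurable (`]0, +oo[%classic : set (measurableTypeR K)) by exact: measurable_itv.
have xv : x < x + 1 by rewrite ltrDl.
have ux : x / 2 < x by lra.
have B := @integrable_Gamma_bound K ((k.+1%:R / (x / 2 / 2)) ^+ k) _ _ u0 (lt_trans x0 xv).
apply: (le_integrable mD _ _ B).
  by apply/measurable_EFinP; exact: measurable_Gamma_log.
move=> t /pos_itv t0; rewrite lee_fin.
exact: (le_trans (Gamma_log_bound k u0 ux xv t0) (ler_norm _)).
Qed.

Lemma is_derive_Gamma_log (K : realType) (k : nat) (x t : K) :
  0 < t -> is_derive x (1 : K) (fun y : K => Gamma_log k y t) (Gamma_log k.+1 x t).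
Proof.
move=> t0.
have -> : (fun y : K => Gamma_log k y t) =
    (fun y : K => ln t ^+ k * expR (- t) * expR ((y - 1) * ln t)).
  by apply/funext => y; rewrite /Gamma_log /powR gt_eqF// mulrAC.
have -> : (fun y : K => ln t ^+ k * expR (- t) * expR ((y - 1) * ln t)) =
   ((ln t ^+ k * expR (- t)) *: (expR \o (ln t *: ((id : K -> K) - cst 1)))).
  by apply/funext => y; congr (_ * expR _); exact: mulrC.
apply: is_derive_eq.
rewrite /Gamma_log /powR gt_eqF// exprS /= subr0.
rewrite [(ln t *: _) x](_ : _ = (x - 1) * ln t); last exact: mulrC.
by rewrite /GRing.scale /= mulr1; ring.
Qed.

Definition Gamma_diff (K : realType) (k : nat) (x : K) : K :=
  \int[lebesgue_measure]_(t in `]0, +oo[) Gamma_log k x t.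

(** Differentiation under the integral sign, dominated on ]x / 2, x + 1[ by [Gamma_log_bound] for
    the exponent k + 1. *)
Lemma is_derive_Gamma_diff (K : realType) (k : nat) (x : K) : 0 < x ->
  is_derive x (1 : K) (@Gamma_diff K k) (Gamma_diff k.+1 x).
Proof.
move=> x0; have u0 : 0 < x / 2 by rewrite divr_gt0.
have mD : measurable (`]0, +oo[%classic : set (measurableTypeR K)) by exact: measurable_itv.
have xv : x < x + 1 by rewrite ltrDl.
have ux : x / 2 < x by lra.
pose f (y : K) (t : measurableTypeR K) := Gamma_log k y t.
have xI : `](x / 2), (x + 1)[%classic x by rewrite /= in_itv/= ux xv.
have i1 y : `](x / 2), (x + 1)[%classic y ->
    lebesgue_measure.-integrable `]0, +oo[ (EFin \o f y).
  rewrite /= in_itv/= => /andP[xy _]; apply: integrable_Gamma_log.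
  exact: lt_trans u0 xy.
have i2 y t : `](x / 2), (x + 1)[%classic y -> `]0, +oo[%classic t -> derivable (f ^~ t) y 1.
  by move=> _ /pos_itv t0; case: (is_derive_Gamma_log k y t0).
have fE y t : 0 < t -> partial1of2 f y t = Gamma_log k.+1 y t.
  by move=> t0; rewrite partial1of2E; case: (is_derive_Gamma_log k y t0).
pose G (t : measurableTypeR K) : K := (k.+2%:R / (x / 2 / 2)) ^+ k.+1 *
    (Gamma_log 0 (x / 2 / 2) t + Gamma_log 0 (x + 1 + x / 2 / 2) t).
have G0 t : 0 <= G t.
  have g0 a : 0 <= Gamma_log 0 a t by rewrite /Gamma_log expr0 mul1r mulr_ge0 ?powR_ge0 ?expR_ge0.
  by apply: mulr_ge0; [rewrite exprn_ge0// !divr_ge0// ltW|exact: addr_ge0].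
have iG := @integrable_Gamma_bound K ((k.+2%:R / (x / 2 / 2)) ^+ k.+1) _ _ u0 (lt_trans x0 xv).
have Gb y t : `](x / 2), (x + 1)[%classic y -> `]0, +oo[%classic t -> `|partial1of2 f y t| <= G t.
  rewrite /= in_itv/= => /andP[xy yx] /pos_itv t0; rewrite fE//.
  exact: Gamma_log_bound.
apply: DeriveDef.
  exact: (derivable_under_integral mD xI i1 i2 G0 iG Gb).
have := differentiation_under_integral mD xI i1 i2 G0 iG Gb.
rewrite derive1E => ->; apply: eq_Rintegral => t; rewrite inE => /pos_itv t0.
exact: fE.
Qed.

Lemma Gamma_diff0 (K : realType) (x : K) : Gamma_diff 0 x = Gamma x.
Proof. by apply: eq_Rintegral => t _; rewrite /Gamma_log expr0 mul1r. Qed.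

(** The integrand is at least [c] on ]1, 2], an interval of length 1. *)
Lemma Gamma_gt0 (K : realType) (x : K) : 0 < x -> 0 < Gamma x.
Proof.
move=> x0.
have mD : measurable (`]0, +oo[%classic : set (measurableTypeR K)) by exact: measurable_itv.
have mI : measurable (`]1, 2]%classic : set (measurableTypeR K)) by exact: measurable_itv.
pose c : K := expR (- (`|x - 1| * ln 2)) * expR (- 2).
have c0 : 0 < c by rewrite mulr_gt0 ?expR_gt0.
have g0 t : 0 <= Gamma_log 0 x t.
  by rewrite /Gamma_log expr0 mul1r mulr_ge0 ?powR_ge0 ?expR_ge0.
have lt : (c%:E <= \int[lebesgue_measure]_(t in `]0%R, +oo[) (Gamma_log 0 x t)%:E)%E.
  apply: (@le_trans _ _ (\int[lebesgue_measure]_(t in `]1%R, 2%R]) (c%:E))%E).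
    rewrite integral_cst//= lebesgue_measure_itv/= lte_fin.
    by rewrite ltr1n -EFinB -EFinM lee_fin; lra.
  apply: (@le_trans _ _ (\int[lebesgue_measure]_(t in `]1%R, 2%R]) (Gamma_log 0 x t)%:E)%E).
    apply: ge0_le_integral => //.
    - by move=> t _; rewrite lee_fin ltW.
    - by apply/measurable_EFinP; exact: measurable_Gamma_log.
    move=> t; rewrite /= in_itv/= => /andP[t1 t2]; rewrite lee_fin /Gamma_log expr0 mul1r.
    have t0 : 0 < t by exact: lt_trans t1.
    rewrite /c ler_pM ?expR_ge0 ?powR_ge0//; last by rewrite ler_expR lerN2.
    rewrite /powR gt_eqF// ler_expR.
    have l0 : 0 <= ln t by rewrite ln_ge0// ltW.
    have l2 : ln t <= ln 2 by rewrite ler_ln ?posrE.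
    apply: (@le_trans _ _ (- (`|x - 1| * ln t))).
      by rewrite lerN2 ler_wpM2l.
    by rewrite -mulNr ler_wpM2r// lerNl -normrN ler_norm.
  apply: ge0_subset_integral => //.
  - by apply/measurable_EFinP; exact: measurable_Gamma_log.
  - by move=> t _; rewrite lee_fin.
  - by move=> t; rewrite /= !in_itv/= andbT => /andP[t1 _]; exact: lt_trans t1.
have fi := integrable_Gamma_log 0 x0.
rewrite -Gamma_diff0 /Gamma_diff -lte_fin -Rintegral_EFin//.
exact: (lt_le_trans _ lt).
Qed.

Definition digamma (K : realType) (x : K) : K := Gamma_diff 1 x / Gamma_diff 0 x.

Lemma is_derive_ln_Gamma (K : realType) (x : K) : 0 < x ->
  is_derive x (1 : K) (fun y : K => ln (Gamma y)) (digamma x).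
Proof.
move=> x0; have G0 := Gamma_gt0 x0.
have -> : (fun y : K => ln (Gamma y)) = @ln K \o @Gamma_diff K 0.
  by apply/funext => y; rewrite /= Gamma_diff0.
have d0 := is_derive_Gamma_diff 0 x0.
have dl : is_derive (Gamma_diff 0 x) (1 : K) (@ln K) (Gamma_diff 0 x)^-1.
  by apply: is_derive1_ln; rewrite Gamma_diff0.
apply: is_derive_eq.
by rewrite /digamma mulrC.
Qed.

(** [TG] is an iterated derivative of ln Gamma, so the first derivative has to be identified with
    [digamma] on a whole neighbourhood of x. *)
Lemma is_derive_digamma (K : realType) (x : K) : 0 < x ->
  is_derive x (1 : K) (@digamma K) (TG x).
Proof.
move=> x0; have G0 := Gamma_gt0 x0.
have d0 := is_derive_Gamma_diff 0 x0.
have d1 := is_derive_Gamma_diff 1 x0.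
have g0 : Gamma_diff 0 x != 0 by rewrite Gamma_diff0 gt_eqF.
have dv : derivable (@digamma K) x 1.
  by apply: derivableM => //; apply: derivableV.
apply: DeriveDef => //.
rewrite /TG /derive1n /= derive1E; apply: near_eq_derive => //.
near=> y; rewrite derive1E.
have y0 : 0 < y by near: y; exact: lt_nbhsr.
by have [_ ->] := is_derive_ln_Gamma y0.
Unshelve. all: by end_near.
Qed.

(** * Directional derivatives of matrix-valued functions *)

Section directional.
Context (K : realType) (V : normedModType K).
Implicit Types (f g : V -> K) (y v : V).

(** Restriction to the line through y along v turns directional derivatives into one-variable ones,
    which makes the real chain rule available. *)
Lemma is_derive_line f y v df :
  is_derive y v f df <-> is_derive (0 : K) (1 : K) (fun h : K => f (h *: v + y)) df.
Proof.
have E : 'D_v f y = 'D_1 (fun h : K => f (h *: v + y)) 0.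
  rewrite /derive; set g1 := fun h => h^-1 *: _; set g2 := fun h => h^-1 *: _.
  suff -> : g1 = g2 by [].
  apply/funext => h; rewrite /g1 /g2 /=.
  by rewrite addr0 scale0r add0r [_%:A]mulr1.
have [H1 H2] := derivable1P f y v.
split=> -[fd fE]; apply: DeriveDef.
- exact: H1.
- by rewrite -E.
- exact: H2.
- by rewrite E.
Qed.

Lemma is_derive_comp (f : K -> K) g y v df dg :
  is_derive (g y) (1 : K) f df -> is_derive y v g dg ->
  is_derive y v (fun z => f (g z)) (df * dg).
Proof.
move=> fd /is_derive_line gd; apply/is_derive_line.
have fd' : is_derive (g (0 *: v + y)) (1 : K) f df by rewrite scale0r add0r.
exact: (@is_derive1_comp K f (fun h : K => g (h *: v + y)) 0 df dg fd' gd).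
Qed.

Lemma is_derive_add f g y v df dg : is_derive y v f df -> is_derive y v g dg ->
  is_derive y v (fun z => f z + g z) (df + dg).
Proof. exact: is_deriveD. Qed.

Lemma is_derive_sub f g y v df dg : is_derive y v f df -> is_derive y v g dg ->
  is_derive y v (fun z => f z - g z) (df - dg).
Proof. exact: is_deriveB. Qed.

Lemma is_derive_mul f g y v df dg : is_derive y v f df -> is_derive y v g dg ->
  is_derive y v (fun z => f z * g z) (df * g y + f y * dg).
Proof.
move=> fd gd; apply: (is_derive_eq (is_deriveM fd gd)).
by rewrite addrC [df * _]mulrC.
Qed.

Lemma is_derive_const (c : K) y v : is_derive y v (fun=> c) 0.
Proof. exact: is_derive_cst. Qed.

Lemma is_derive_scale (c : K) f y v df : is_derive y v f df ->
  is_derive y v (fun z => c * f z) (c * df).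
Proof. exact: is_deriveZ. Qed.

Lemma is_derive_bigsum (I : Type) (s : seq I) (P : pred I) (f : I -> V -> K) (df : I -> K) y v :
  (forall i, is_derive y v (f i) (df i)) ->
  is_derive y v (fun z => \sum_(i <- s | P i) f i z) (\sum_(i <- s | P i) df i).
Proof.
move=> H; elim: s => [|i s IH].
  rewrite big_nil; apply: near_eq_is_derive (is_derive_const 0 y v).
  by apply: nearW => z; rewrite big_nil.
rewrite big_cons; case: ifPn => Pi.
  apply: near_eq_is_derive (is_derive_add (H i) IH).
  by apply: nearW => z; rewrite big_cons Pi.
by apply: near_eq_is_derive IH; apply: nearW => z; rewrite big_cons (negbTE Pi).
Qed.

Lemma is_derive_bigprod (I : eqType) (s : seq I) (f : I -> V -> K) (df : I -> K) y v :
  uniq s -> (forall i, is_derive y v (f i) (df i)) ->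
  is_derive y v (fun z => \prod_(i <- s) f i z)
    (\sum_(k <- s) \prod_(i <- s) (if i == k then df i else f i y)).
Proof.
move=> us H; elim: s us => [_|a s IH /= /andP[ax us]].
  rewrite big_nil; apply: near_eq_is_derive (is_derive_const 1 y v).
  by apply: nearW => z; rewrite big_nil.
have D := is_derive_mul (H a) (IH us).
have E : (fun z => f a z * \prod_(i <- s) f i z) = (fun z => \prod_(i <- a :: s) f i z).
  by apply/funext => z; rewrite big_cons.
rewrite E in D; apply: (is_derive_eq D).
rewrite big_cons big_cons eqxx; congr (_ * _ + _).
  rewrite !big_seq; apply: eq_bigr => i si.
  by case: eqP => // ia; rewrite -ia si in ax.
rewrite mulr_sumr !big_seq; apply: eq_bigr => k sk; rewrite big_cons.
by case: eqP => // ak; rewrite ak sk in ax.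
Qed.

(** Stated entry by entry, so that matrix calculus reduces to the scalar rules; [is_dmx_derive] goes
    back to the derivative of the matrix-valued function. *)
Definition is_dmx (a b : nat) (F : V -> 'M[K]_(a, b)) y v (dF : 'M[K]_(a, b)) : Prop :=
  forall i j, is_derive y v (fun z => F z i j) (dF i j).

Lemma is_dmx_eq (a b : nat) (F : V -> 'M[K]_(a, b)) y v dF dF' :
  is_dmx F y v dF -> dF = dF' -> is_dmx F y v dF'.
Proof. by move=> H <-. Qed.

Lemma near_is_dmx (a b : nat) (F G : V -> 'M[K]_(a, b)) y v dF :
  (\near y, F y = G y) -> is_dmx F y v dF -> is_dmx G y v dF.
Proof.
move=> FG H i j; apply: near_eq_is_derive (H i j).
by apply: filterS FG => z ->.
Qed.

Lemma is_dmx_cst (a b : nat) (A : 'M[K]_(a, b)) y v : is_dmx (fun=> A) y v 0.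
Proof. by move=> i j; rewrite mxE; exact: is_derive_const. Qed.

Lemma is_dmxD (a b : nat) (F G : V -> 'M[K]_(a, b)) y v dF dG :
  is_dmx F y v dF -> is_dmx G y v dG -> is_dmx (fun z => F z + G z) y v (dF + dG).
Proof.
move=> HF HG i j; rewrite mxE; apply: near_eq_is_derive (is_derive_add (HF i j) (HG i j)).
by apply: nearW => z; rewrite mxE.
Qed.

Lemma is_dmxT (a b : nat) (F : V -> 'M[K]_(a, b)) y v dF :
  is_dmx F y v dF -> is_dmx (fun z => (F z)^T) y v dF^T.
Proof.
move=> HF i j; rewrite mxE; apply: near_eq_is_derive (HF j i).
by apply: nearW => z; rewrite mxE.
Qed.

Lemma is_dmxM (a b c : nat) (F : V -> 'M[K]_(a, b)) (G : V -> 'M[K]_(b, c)) y v dF dG :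
  is_dmx F y v dF -> is_dmx G y v dG ->
  is_dmx (fun z => F z *m G z) y v (dF *m G y + F y *m dG).
Proof.
move=> HF HG i k.
have D := is_derive_bigsum (index_enum _) xpredT (fun j => is_derive_mul (HF i j) (HG j k)).
rewrite !mxE -big_split; apply: near_eq_is_derive D.
by apply: nearW => z; rewrite mxE.
Qed.

Lemma is_dmx_tens (a b c d : nat) (F : V -> 'M[K]_(a, b)) (G : V -> 'M[K]_(c, d)) y v dF dG :
  is_dmx F y v dF -> is_dmx G y v dG ->
  is_dmx (fun z => F z *t G z) y v (dF *t G y + F y *t dG).
Proof.
move=> HF HG i j; rewrite !mxE.
apply: near_eq_is_derive (is_derive_mul (HF _ _) (HG _ _)).
by apply: nearW => z; rewrite mxE.
Qed.

Lemma is_derive_trace (a : nat) (F : V -> 'M[K]_a) y v dF :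
  is_dmx F y v dF -> is_derive y v (fun z => \tr (F z)) (\tr dF).
Proof. by move=> H; exact: (is_derive_bigsum (index_enum _) xpredT (fun i => H i i)). Qed.

(** Jacobi's formula. Differentiating the Leibniz expansion row by row gives a sum of determinants
    with one row replaced by its derivative; expanding each along that row produces the cofactors of
    [F y]. *)
Lemma is_derive_det (a : nat) (F : V -> 'M[K]_a) y v dF :
  is_dmx F y v dF -> is_derive y v (fun z => \det (F z)) (\tr (\adj (F y) *m dF)).
Proof.
move=> H.
have D (s : {perm 'I_a}) := is_derive_scale ((-1) ^+ s)
  (is_derive_bigprod (index_enum_uniq _) (fun i => H i (s i))).
apply: (is_derive_eq (is_derive_bigsum (index_enum _) xpredT D)).
transitivity (\sum_k \det (\matrix_(i, j) if i == k then dF i j else F y i j)).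
  under eq_bigr do rewrite mulr_sumr.
  rewrite exchange_big; apply: eq_bigr => k _; apply: eq_bigr => s _.
  by congr (_ * _); apply: eq_bigr => i _; rewrite mxE.
rewrite mxtrace_mulC; apply: eq_bigr => k _.
rewrite (expand_det_row _ k) mxE; apply: eq_bigr => j _.
rewrite !mxE eqxx; congr (_ * (_ * \det _)).
by apply/matrixP => i l; rewrite !mxE eq_sym (negbTE (neq_lift _ _)).
Qed.

(** Entries of the adjugate are signed minors. Existence is all that is asked here, since the
    derivative of the inverse is identified by other means. *)
Lemma is_derive_adj (a : nat) (F : V -> 'M[K]_a) y v dF :
  is_dmx F y v dF -> exists dA, is_dmx (fun z => \adj (F z)) y v dA.
Proof.
move=> H.
suff D i j : exists d, is_derive y v (fun z => (\adj (F z)) i j) d.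
  exists (\matrix_(i, j) projT1 (cid (D i j))) => i j.
  by rewrite mxE; exact: projT2 (cid (D i j)).
have H' : is_dmx (fun z => row' j (col' i (F z))) y v (row' j (col' i dF)).
  move=> k l; rewrite !mxE; apply: near_eq_is_derive (H _ _).
  by apply: nearW => z; rewrite !mxE.
eexists; apply: near_eq_is_derive (is_derive_scale ((-1) ^+ (j + i)) (is_derive_det H')).
by apply: nearW => z; rewrite mxE.
Qed.

Lemma is_derive_inv f y v df : f y != 0 -> is_derive y v f df ->
  is_derive y v (fun z => (f z)^-1) (- (f y) ^- 2 * df).
Proof.
move=> f0 fd; have D := @is_deriveV K id (f y) 1 1 f0 (is_derive_id _ _).
by apply: (is_derive_eq (is_derive_comp D fd)); rewrite /GRing.scale /= mulr1.
Qed.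

(** Differentiability comes from the quotient of adjugate and determinant. The value then follows by
    differentiating F F^-1, which is constant near y. *)
Lemma is_dmx_inv (a : nat) (F : V -> 'M[K]_a) y v dF :
  (\forall z \near y, F z \in unitmx) -> is_dmx F y v dF ->
  is_dmx (fun z => invmx (F z)) y v (- (invmx (F y) *m dF *m invmx (F y))).
Proof.
move=> uF HF; have uy : F y \in unitmx by exact: nbhs_singleton uF.
have [dA HA] := is_derive_adj HF.
have d0 : \det (F y) != 0 by rewrite -unitfE -unitmxE.
have [dG HG] : exists dG, is_dmx (fun z => invmx (F z)) y v dG.
  pose dG := \matrix_(i, j) (- (\det (F y)) ^- 2 * \tr (\adj (F y) *m dF) * (\adj (F y)) i j +
     (\det (F y))^-1 * dA i j).
  exists dG => i j; rewrite mxE.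
  apply: near_eq_is_derive (is_derive_mul (is_derive_inv d0 (is_derive_det HF)) (HA i j)).
  by apply: filterS uF => z uz; rewrite /invmx uz [RHS]mxE.
have H1 : is_dmx (fun z => F z *m invmx (F z)) y v 0.
  apply: near_is_dmx (is_dmx_cst 1%:M y v).
  by apply: filterS uF => z uz; rewrite mulmxV.
have E : dF *m invmx (F y) + F y *m dG = 0.
  apply/matrixP => i j; have [_ <-] := is_dmxM HF HG i j.
  by have [_ <-] := H1 i j.
apply: (is_dmx_eq HG).
rewrite -mulmxA -mulmxN -(mulKmx uy dG); congr (_ *m _).
by apply/eqP; rewrite -addr_eq0 addrC E.
Qed.

Lemma is_derive_entry (F : V -> 'M[K]_1) y v dF :
  is_dmx F y v dF -> is_derive y v (fun z => F z 0 0) (dF 0 0).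
Proof. by []. Qed.
End directional.

(** * Score and Hessian of a multivariate t log-likelihood *)

Section t_likelihood.
Context (K : realType) (V : normedModType K) (p : nat) (U : set V)
  (S : V -> 'M[K]_p) (dS : V -> V -> 'M[K]_p) (ddS : V -> V -> V -> 'M[K]_p)
  (e : V -> 'cV[K]_p) (w : V -> 'cV[K]_p) (nu nudot : V -> K)
  (ld : V -> K) (ct ct1 ct2 : K -> K).
Hypothesis openU : forall y, U y -> \forall z \near y, U z.
Hypothesis nu0 : forall y, U y -> 0 < nu y.
Hypothesis S_whiten : forall y, U y -> exists T : 'M[K]_p, T *m S y *m T^T = 1%:M.
Hypothesis e_diff : forall y v, is_dmx e y v (- w v).
Hypothesis nu_diff : forall y v, is_derive y v nu (nudot v).
Hypothesis S_diff : forall y v, is_dmx S y v (dS v y).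
Hypothesis dS_diff : forall y u v, is_dmx (dS v) y u (ddS u v y).
Hypothesis ld_diff : forall y v, U y -> is_derive y v ld (- (1 / 2) * \tr (invmx (S y) *m dS v y)).
Hypothesis ct_diff : forall x : K, 0 < x -> is_derive x (1 : K) ct (ct1 x).
Hypothesis ct1_diff : forall x : K, 0 < x -> is_derive x (1 : K) ct1 (ct2 x).

Let J y := invmx (S y).
(** The derivatives [t_quad1] and [t_quad2] are spelled out from dJ = - J dS J, with J = S^-1, and
    de = - w; the latter depends on the direction alone because the location is linear in the
    parameters. *)
Definition t_quad y : K := ((e y)^T *m invmx (S y) *m e y) 0 0.
Definition t_quad1 v y : K :=
  - ((e y)^T *m (invmx (S y) *m dS v y *m invmx (S y)) *m e y) 0 0 -
  2 * ((w v)^T *m invmx (S y) *m e y) 0 0.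
Definition t_quad2 u v y : K :=
  let J := invmx (S y) in let M := J *m dS v y *m J in
  ((w u)^T *m M *m e y) 0 0 + ((e y)^T *m M *m w u) 0 0 +
  ((e y)^T *m (J *m dS u y *m M + M *m dS u y *m J - J *m ddS u v y *m J) *m e y) 0 0 +
  2 * ((w v)^T *m (J *m dS u y *m J) *m e y) 0 0 + 2 * ((w v)^T *m J *m w u) 0 0.

Definition t_loglik y : K := ld y + ct (nu y) - (nu y + p%:R) / 2 * ln (nu y + t_quad y).
Definition t_score v y : K := - (1 / 2) * \tr (invmx (S y) *m dS v y) +
  nudot v * (ct1 (nu y) - 1 / 2 * ln (nu y + t_quad y)) -
  (nu y + p%:R) / 2 * ((nudot v + t_quad1 v y) / (nu y + t_quad y)).
Definition t_hess u v y : K :=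
  - (1 / 2) * (\tr (invmx (S y) *m ddS u v y) -
     \tr (invmx (S y) *m dS u y *m invmx (S y) *m dS v y)) +
  nudot u * nudot v * ct2 (nu y) -
  1 / 2 * nudot v * ((nudot u + t_quad1 u y) / (nu y + t_quad y)) -
  1 / 2 * nudot u * ((nudot v + t_quad1 v y) / (nu y + t_quad y)) -
  (nu y + p%:R) / 2 * (t_quad2 u v y / (nu y + t_quad y) -
     (nudot v + t_quad1 v y) * (nudot u + t_quad1 u y) / (nu y + t_quad y) ^+ 2).

Let unitS y : U y -> S y \in unitmx.
Proof.
move=> /S_whiten[T TST]; have [uTS _] := mulmx1_unit TST.
by move: uTS; rewrite unitmx_mul => /andP[].
Qed.

Let J_diff y v : U y -> is_dmx J y v (- (J y *m dS v y *m J y)).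
Proof.
move=> Uy; apply: is_dmx_inv; last exact: S_diff.
by apply: filterS (openU Uy); exact: unitS.
Qed.

Let J_sym y : U y -> (J y)^T = J y.
Proof. by move=> /S_whiten[T TST]; rewrite /J (whiten_invmx TST) trmx_mul trmxK. Qed.

Let quad_ge0 y : U y -> 0 <= t_quad y.
Proof.
move=> /S_whiten[T TST]; rewrite /t_quad (whiten_invmx TST).
have -> : (e y)^T *m (T^T *m T) *m e y = (T *m e y)^T *m (T *m e y).
  by rewrite trmx_mul !mulmxA.
exact: dot_ge0.
Qed.

Let D0 y : U y -> 0 < nu y + t_quad y.
Proof. by move=> Uy; rewrite ltr_pwDl ?nu0 ?quad_ge0. Qed.

Let mx00D (A B : 'M[K]_1) : (A + B) 0 0 = A 0 0 + B 0 0.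
Proof. by rewrite mxE. Qed.

Let mx00N (A : 'M[K]_1) : (- A) 0 0 = - A 0 0.
Proof. by rewrite mxE. Qed.

Let mx00 := (mx00D, mx00N).

Let scalar_tr (A : 'M[K]_1) : A 0 0 = A^T 0 0.
Proof. by rewrite mxE. Qed.

Lemma t_quad_diff y v : U y -> is_derive y v t_quad (t_quad1 v y).
Proof.
move=> Uy; have H := is_dmxM (is_dmxM (is_dmxT (e_diff y v)) (J_diff v Uy)) (e_diff y v).
apply: (is_derive_eq (is_derive_entry H)).
rewrite /t_quad1 -/(J y) linearN /= !(mulmxDl, mulNmx, mulmxN) !mx00.
(* The two cross terms are transposes of each other, J being symmetric; this is the factor 2 of
   [t_quad1]. *)
rewrite (scalar_tr (_ *m _ *m w v)) !trmx_mul trmxK J_sym// mulmxA.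
by ring.
Qed.

Lemma t_quad1_diff y u v : U y -> is_derive y u (t_quad1 v) (t_quad2 u v y).
Proof.
move=> Uy; have HJ := J_diff u Uy.
have HM := is_dmxM (is_dmxM HJ (dS_diff y u v)) HJ.
have HA := is_derive_entry (is_dmxM (is_dmxM (is_dmxT (e_diff y u)) HM) (e_diff y u)).
have HB := is_derive_entry (is_dmxM (is_dmxM (is_dmx_cst (w v)^T y u) HJ) (e_diff y u)).
have D := is_derive_sub (is_derive_scale (- 1) HA) (is_derive_scale 2 HB).
have -> : t_quad1 v = (fun z => - 1 * ((e z)^T *m (J z *m dS v z *m J z) *m e z) 0 0 -
    2 * ((w v)^T *m J z *m e z) 0 0).
  by apply/funext => z; rewrite /t_quad1 mulN1r.
apply: (is_derive_eq D); rewrite /t_quad2 -/(J y).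
rewrite linearN /= mul0mx add0r !(mulmxDl, mulmxDr, mulNmx, mulmxN) !mx00 !mulmxA.
by ring.
Qed.

Let logD_diff y v : U y ->
  is_derive y v (fun z => ln (nu z + t_quad z)) ((nudot v + t_quad1 v y) / (nu y + t_quad y)).
Proof.
move=> Uy.
have D := is_derive_comp (f := @ln K) (g := fun z => nu z + t_quad z)
  (is_derive1_ln (D0 Uy)) (is_derive_add (nu_diff y v) (t_quad_diff v Uy)).
by apply: (is_derive_eq D); rewrite mulrC.
Qed.

Let halfnu_diff y v : is_derive y v (fun z => (nu z + p%:R) / 2) (1 / 2 * nudot v).
Proof.
have D := is_derive_scale (1 / 2) (is_derive_add (nu_diff y v) (is_derive_const (p%:R : K) y v)).
have -> : (fun z => (nu z + p%:R) / 2) = (fun z => 1 / 2 * (nu z + p%:R)).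
  by apply/funext => z; ring.
by apply: (is_derive_eq D); rewrite addr0.
Qed.

Lemma t_loglik_diff y v : U y -> is_derive y v t_loglik (t_score v y).
Proof.
move=> Uy.
have Dct := is_derive_comp (ct_diff (nu0 Uy)) (nu_diff y v).
have D := is_derive_sub (is_derive_add (ld_diff v Uy) Dct)
  (is_derive_mul (halfnu_diff y v) (logD_diff v Uy)).
apply: (is_derive_eq D); rewrite /t_score.
by ring.
Qed.

Lemma t_score_diff y u v : U y -> is_derive y u (t_score v) (t_hess u v y).
Proof.
move=> Uy.
have D1 := is_derive_scale (- (1 / 2)) (is_derive_trace (is_dmxM (J_diff u Uy) (dS_diff y u v))).
have D2 := is_derive_scale (nudot v) (is_derive_sub
  (is_derive_comp (ct1_diff (nu0 Uy)) (nu_diff y u)) (is_derive_scale (1 / 2) (logD_diff u Uy))).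
have Dn := D0 Uy.
have D3 := is_derive_mul (halfnu_diff y u)
  (is_derive_mul (is_derive_add (is_derive_const (nudot v) y u) (t_quad1_diff u v Uy))
    (is_derive_inv (f := fun z => nu z + t_quad z) (lt0r_neq0 Dn) (is_derive_add (nu_diff y u) (t_quad_diff u Uy)))).
apply: (is_derive_eq (is_derive_sub (is_derive_add D1 D2) D3)).
rewrite /t_hess mulNmx mxtraceD linearN /= -/(J y).
have := lt0r_neq0 Dn; move: (nu y + t_quad y) => D' D'0.
by field.
Qed.
End t_likelihood.

(** * Information of a multivariate t family *)

Section t_information.
Context (K : realType) (d : measure_display) (Om : measurableType d)
  (P : probability Om K) (m : probability K K) (V : normedModType K) (p : nat)
  (S : V -> 'M[K]_p) (dS : V -> V -> 'M[K]_p) (ddS : V -> V -> V -> 'M[K]_p)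
  (e : Om -> V -> 'cV[K]_p) (w : V -> 'cV[K]_p) (nu nudot : V -> K)
  (ct2 : K -> K) (u v y : V) (T : 'M[K]_p).
Hypothesis nu0 : 0 < nu y.
Hypothesis gam : is_gamma (nu y / 2) (nu y / 2) m.
Hypothesis TST : T *m S y *m T^T = 1%:M.
Hypothesis me : forall k, measurable_fun setT (fun o => (T *m e o y) k 0).
Hypothesis e_cf : forall b : 'cV[K]_p,
  \int[P]_o cos ((b^T *m (T *m e o y)) 0 0) =
    \int[m]_(t in `]0, +oo[) expR (- ((b^T *m b) 0 0 / t) / 2) /\
  \int[P]_o sin ((b^T *m (T *m e o y)) 0 0) = 0.
Hypothesis dSu_sym : (dS u y)^T = dS u y.

Let n : K := nu y + p%:R.
Let Ju := invmx (S y) *m dS u y.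
Let Jv := invmx (S y) *m dS v y.

(** In the coordinates z = T e the quadratic form is |z|^2, and its derivatives are polynomials in z
    with matrices T dS T', whose traces and trace products are those of S^-1 dS. Every term of
    [t_hess] is then covered by [t_mean_quad] or [t_mean_quad_sqr]. *)
Lemma t_hess_mean :
  has_mean P (fun o => t_hess S dS ddS (e o) w nu nudot ct2 u v y)
    (- (n / (2 * (n + 2))) * \tr (Ju *m Jv) + 1 / (2 * (n + 2)) * (\tr Ju * \tr Jv) -
     n / (n + 2) * ((w u)^T *m invmx (S y) *m w v) 0 0 +
     (nudot v * \tr Ju + nudot u * \tr Jv) / (n * (n + 2)) +
     nudot u * nudot v * (ct2 (nu y) - 1 / n + (nu y + 2) / (2 * nu y * (n + 2)))).
Proof.
have JE := whiten_invmx TST.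
pose Z o := T *m e o y.
pose Ku := T *m dS u y *m T^T; pose Kv := T *m dS v y *m T^T; pose Kuv := T *m ddS u v y *m T^T.
pose mu := T *m w u; pose mv := T *m w v.
have QE o : t_quad S (e o) y = ((Z o)^T *m Z o) 0 0.
  by rewrite /t_quad JE /Z trmx_mul !mulmxA.
have dotC (a b : 'cV[K]_p) : (a^T *m b) 0 0 = (b^T *m a) 0 0.
  by rewrite !mulmx_dotE; apply: eq_bigr => i _; rewrite mulrC.
have N00 (A : 'M[K]_1) : (- A) 0 0 = - A 0 0 by rewrite mxE.
have D00 (A B : 'M[K]_1) : (A + B) 0 0 = A 0 0 + B 0 0 by rewrite mxE.
have Z00 c (A : 'M[K]_1) : (c *: A) 0 0 = c * A 0 0 by rewrite mxE.
have tZ a b c (A : 'M[K]_(a, b)) : (c *: A)^T = c *: A^T by rewrite linearZ.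
have tN a b (A : 'M[K]_(a, b)) : (- A)^T = - A^T by rewrite linearN.
have tD a b (A B : 'M[K]_(a, b)) : (A + B)^T = A^T + B^T by rewrite linearD.
have dQE o a : t_quad1 S dS (e o) w a y =
    0 + ((- (2 *: (T *m w a)))^T *m Z o) 0 0 +
    ((Z o)^T *m (- (T *m dS a y *m T^T)) *m Z o) 0 0.
  rewrite /t_quad1 JE /Z tN tZ !(mulNmx, mulmxN) -scalemxAl N00 N00 Z00.
  by rewrite !trmx_mul !mulmxA add0r addrC.
(* Linear coefficient, in z, of the second derivative of the form. Symmetry is assumed for [dS u],
   so [Kv] appears along with its transpose. *)
pose l := Kv *m mu + Kv^T *m mu + 2 *: (Ku^T *m mv).
pose M := Ku *m Kv + Kv *m Ku - Kuv.
have ddQE o : t_quad2 S dS ddS (e o) w u v y =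
    2 * (mv^T *m mu) 0 0 + (l^T *m Z o) 0 0 + ((Z o)^T *m M *m Z o) 0 0.
  rewrite /t_quad2 JE /l /M /Z /mu /mv /Ku /Kv /Kuv !tD tZ !trmx_mul !trmxK.
  rewrite !(mulmxDl, mulmxDr, mulNmx, mulmxN) -scalemxAl !(D00, N00, Z00) !mulmxA.
  (* A scalar equals its transpose, which brings this term into the shape l'z. *)
  have -> : ((e o y)^T *m T^T *m T *m dS v y *m T^T *m T *m w u) 0 0 =
      ((w u)^T *m T^T *m T *m (dS v y)^T *m T^T *m T *m e o y) 0 0.
    rewrite -[LHS]/(((_ *m _)) 0 0) -!mulmxA dotC.
    by rewrite !trmx_mul !trmxK !mulmxA.
  by ring.
have trK A : \tr (T *m A *m T^T) = \tr (invmx (S y) *m A).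
  by rewrite JE mxtrace_mulC mulmxA.
have KuS : Ku^T = Ku by rewrite /Ku !trmx_mul trmxK dSu_sym mulmxA.
have trKK : \tr (Ku *m Kv) = \tr (Ju *m Jv).
  by rewrite /Ku /Kv !mulmxA mxtrace_mulC /Ju /Jv JE !mulmxA.
have trKK' : \tr (Kv *m Ku) = \tr (Ju *m Jv) by rewrite mxtrace_mulC.
have mm : (mv^T *m mu) 0 0 = ((w u)^T *m invmx (S y) *m w v) 0 0.
  by rewrite dotC /mu /mv JE trmx_mul !mulmxA.
have n0 : 0 < n by rewrite ltr_wpDr.
pose la a : 'cV[K]_p := - (2 *: (T *m w a)).
pose Ma a : 'M[K]_p := - (T *m dS a y *m T^T).
have F1 := t_mean_quad nu0 gam me e_cf (nudot u) (la u) (Ma u).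
have F2 := t_mean_quad nu0 gam me e_cf (nudot v) (la v) (Ma v).
have F3 := t_mean_quad nu0 gam me e_cf (2 * (mv^T *m mu) 0 0) l M.
have F4 := t_mean_quad_sqr nu0 gam me e_cf (nudot v) (nudot u) (la v) (la u) (Ma v) (Ma u).
pose c0 := - (1 / 2) * (\tr (invmx (S y) *m ddS u v y) - \tr (Ju *m Jv)) +
  nudot u * nudot v * ct2 (nu y).
have H := has_meanD (has_mean_cst P c0) (has_meanD
  (has_meanD (has_meanZ (- (1 / 2 * nudot v)) F1) (has_meanZ (- (1 / 2 * nudot u)) F2))
  (has_meanD (has_meanZ (- (n / 2)) F3) (has_meanZ (n / 2) F4))).
apply: (eq_has_mean H) => [s|].
  rewrite /t_hess QE !dQE ddQE /c0 -/n -/Ju -/Jv [Ju *m invmx _ *m _](_ : _ = Ju *m Jv).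
    by rewrite -/(Z s) -!/(la _) -!/(Ma _) !add0r !addrA; ring.
  by rewrite /Ju /Jv !mulmxA.
have trN (A : 'M[K]_p) : \tr (- A) = - \tr A by rewrite raddfN.
have trM a : \tr (Ma a) = - \tr (invmx (S y) *m dS a y) by rewrite trN trK.
have ll : ((la v)^T *m la u) 0 0 = 4 * (mv^T *m mu) 0 0.
  rewrite /la tN tZ mulNmx mulmxN opprK -scalemxAl -scalemxAr !Z00 -/mu -/mv mulrA.
  by congr (_ * _); ring.
(* As [Ku] is symmetric, two of the three pairings of the fourth moment coincide, whence the factor
   2. *)
have trMM x : x + \tr (Ma v *m (Ma u)^T) + \tr (Ma v *m Ma u) = x + 2 * \tr (Ju *m Jv).
  by rewrite /Ma tN mulNmx !mulmxN opprK mulNmx opprK -/Ku -/Kv KuS trKK'; ring.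
rewrite trMM ll !trM /M !mxtraceD trN trKK trKK' {1}/Kuv trK /c0 mm -/Ju -/Jv -/n.
have nn0 : n != 0 by exact: lt0r_neq0.
have n20 : n + 2 != 0 by rewrite gt_eqF// addr_gt0.
have nuy0 : nu y != 0 by exact: lt0r_neq0.
by field; rewrite nuy0 n20 nn0.
Qed.
End t_information.

(** * The parametrization of the model *)

Lemma is_dmx_derive (K : realType) (V : normedModType K) (a b : nat) (F : V -> 'M[K]_(a, b))
    (y v : V) dF : is_dmx F y v dF -> 'D_v F y = dF.
Proof.
move=> H; rewrite derive_mx; last by apply/derivable_mxP => i j; case: (H i j).
by apply/matrixP => i j; rewrite mxE; have [_ ->] := H i j.
Qed.

Lemma is_derive_affine (K : realType) (V : normedModType K) (f : V -> K) (y v : V) (df : K) :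
  (forall h : K, f (h *: v + y) = h * df + f y) -> is_derive y v f df.
Proof.
move=> H; apply/is_derive_line.
have -> : (fun h : K => f (h *: v + y)) = (fun h : K => df * id h + f y).
  by apply/funext => h; rewrite H mulrC.
apply: (is_derive_eq (is_derive_add (is_derive_scale df (is_derive_id (0 : K) (1 : K)))
  (is_derive_const (f y) (0 : K) 1))).
by rewrite mulr1 addr0.
Qed.

Section scale_family.
Context (K : realType) (d q n : nat) (L : 'M[K]_(d, q)) (Psi : 'M[K]_d)
  (free : 'I_n -> par_coord d q).
Implicit Types (s t : 'cV[K]_n).

(** [loading_at] is affine in the free values; with base matrix 0 it becomes its linear part, which
    is 0 at the fixed entries. *)
Definition loading_deriv t : 'M[K]_(d, q) := loading_at 0 free t.
Definition noise_deriv t : 'M[K]_d := noise_at 0 free t.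
Definition scale_deriv t s : 'M[K]_d :=
  loading_deriv t *m (loading_at L free s)^T + loading_at L free s *m (loading_deriv t)^T + noise_deriv t.
(** Independent of the base point, because the scale matrix is quadratic in the loadings and affine
    in the noise. *)
Definition scale_deriv2 s t : 'M[K]_d :=
  loading_deriv t *m (loading_deriv s)^T + loading_deriv s *m (loading_deriv t)^T.

Lemma loading_affine (h : K) t s i j :
  loading_at L free (h *: t + s) i j = h * loading_deriv t i j + loading_at L free s i j.
Proof. by rewrite !mxE; case: pickP => [k _|_]; rewrite ?mxE// mulr0 add0r. Qed.

Lemma noise_affine (h : K) t s i j :
  noise_at Psi free (h *: t + s) i j = h * noise_deriv t i j + noise_at Psi free s i j.
Proof. by rewrite !mxE; case: pickP => [k _|_]; rewrite ?mxE// mulr0 add0r. Qed.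

Lemma loading_deriv0 : loading_deriv 0 = 0.
Proof. by apply/matrixP => i j; rewrite !mxE; case: pickP => [k _|_]; rewrite ?mxE. Qed.

Lemma noise_deriv0 : noise_deriv 0 = 0.
Proof. by apply/matrixP => i j; rewrite !mxE; case: pickP => [k _|_]; rewrite ?mxE. Qed.

Lemma scale_deriv0 s : scale_deriv 0 s = 0.
Proof. by rewrite /scale_deriv loading_deriv0 noise_deriv0 mul0mx trmx0 mulmx0 !addr0. Qed.

Lemma noise_deriv_sym t : (noise_deriv t)^T = noise_deriv t.
Proof.
apply/matrixP => i j; rewrite !mxE; case: (eqVneq i j) => [->//|ij].
by case: pickP => // ?; case: pickP.
Qed.

Lemma scale_deriv_sym t s : (scale_deriv t s)^T = scale_deriv t s.
Proof.
by rewrite /scale_deriv !linearD /= !trmx_mul !trmxK noise_deriv_sym [_ *m _ + _]addrC.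
Qed.

Section diff.
Context (V : normedModType K) (th : V -> 'cV[K]_n) (thl : V -> 'cV[K]_n).
Hypothesis thE : forall (h : K) v y, th (h *: v + y) = h *: thl v + th y.

(** [th] extracts the free values of one side from the variable and [thl] is its action on
    directions; in use both are a coordinate projection or the identity. *)
Lemma loading_diff y v :
  is_dmx (fun z => loading_at L free (th z)) y v (loading_deriv (thl v)).
Proof. by move=> i j; apply: is_derive_affine => h; rewrite thE loading_affine. Qed.

Lemma noise_diff y v : is_dmx (fun z => noise_at Psi free (th z)) y v (noise_deriv (thl v)).
Proof. by move=> i j; apply: is_derive_affine => h; rewrite thE noise_affine. Qed.

Lemma scale_diff y v : is_dmx (fun z => scale_at L Psi free (th z)) y v (scale_deriv (thl v) (th y)).
Proof.
have H := loading_diff y v.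
exact: (is_dmxD (is_dmxM H (is_dmxT H)) (noise_diff y v)).
Qed.

Lemma scale_deriv_diff y u t :
  is_dmx (fun z => scale_deriv t (th z)) y u (scale_deriv2 (thl u) t).
Proof.
have H := loading_diff y u.
have H1 := is_dmxM (is_dmx_cst (loading_deriv t) y u) (is_dmxT H).
have H2 := is_dmxM H (is_dmx_cst (loading_deriv t)^T y u).
apply: (is_dmx_eq (is_dmxD (is_dmxD H1 H2) (is_dmx_cst (noise_deriv t) y u))).
by rewrite !mul0mx mulmx0 add0r !addr0.
Qed.
End diff.

Lemma noise_at_pos_diag t : is_diag_mx Psi -> (forall i, 0 < noise_at Psi free t i i) ->
  pos_diag (noise_at Psi free t).
Proof.
move=> /is_diag_mxP Pd Pp; split=> //; apply/is_diag_mxP => i j ij.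
rewrite mxE; have ijF : (i == j) = false by apply/eqP => ijE; rewrite ijE eqxx in ij.
case: pickP => [k|_]; first by rewrite ijF.
exact: Pd.
Qed.

Lemma loading_at_free_values : loading_at L free (free_values L Psi free) = L.
Proof.
apply/matrixP => i j; rewrite mxE; case: pickP => // k /eqP fk.
by rewrite mxE fk.
Qed.

Lemma noise_at_free_values : noise_at Psi free (free_values L Psi free) = Psi.
Proof.
apply/matrixP => i j; rewrite mxE; case: pickP => // k /andP[/eqP <- /eqP fk].
by rewrite mxE fk.
Qed.

(** Whether a diagonal entry is free depends on its index and not on z, so each entry is either
    constant in z or a continuous coordinate of [th z]. *)
Lemma noise_near (V : topologicalType) (th : V -> 'cV[K]_n) y :
  (forall k, {for y, continuous (fun z => th z k 0)}) ->
  (forall i, 0 < noise_at Psi free (th y) i i) ->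
  \forall z \near y, forall i, 0 < noise_at Psi free (th z) i i.
Proof.
move=> cth pos; apply: filter_forall => i; have := pos i; rewrite mxE.
case E: [pick k | _] => [k|] thk0; last first.
  by apply: nearW => z; rewrite mxE E.
have H : \forall z \near y, 0 < th z k 0 by apply: (cvgr_gt _ (cth k)).

by apply: filterS H => z; rewrite mxE E.
Qed.
End scale_family.

(** The terms of the log density that involve nu alone. Writing 1 + Q / nu as (nu + Q) / nu makes ln
    nu appear with coefficient (nu + p) / 2, of which the normalizing power of pi nu takes away p /
    2. *)
Definition lngamma_part (K : realType) (p : nat) (nu : K) : K :=
  ln (Gamma ((nu + p%:R) / 2)) - ln (Gamma (nu / 2)) - p%:R / 2 * ln pi + nu / 2 * ln nu.

Definition lngamma_part1 (K : realType) (p : nat) (nu : K) : K :=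
  1 / 2 * digamma ((nu + p%:R) / 2) - 1 / 2 * digamma (nu / 2) + 1 / 2 * ln nu + 1 / 2.

Definition lngamma_part2 (K : realType) (p : nat) (nu : K) : K :=
  1 / 4 * TG ((nu + p%:R) / 2) - 1 / 4 * TG (nu / 2) + 1 / (2 * nu).

Section lngamma.
Context (K : realType) (p : nat) (x : K) (x0 : 0 < x).

Let half_diff (c : K) : is_derive x (1 : K) (fun z : K => (z + c) / 2) (1 / 2).
Proof.
have -> : (fun z : K => (z + c) / 2) = (fun z : K => 1 / 2 * (id z + c)).
  by apply/funext => z; ring.
apply: (is_derive_eq (is_derive_scale (1 / 2)
  (is_derive_add (is_derive_id x (1 : K)) (is_derive_const c x (1 : K))))).
by rewrite addr0 mulr1.
Qed.

Let half0 : is_derive x (1 : K) (fun z : K => z / 2) (1 / 2).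
Proof.
have -> : (fun z : K => z / 2) = (fun z : K => (z + 0) / 2).
  by apply/funext => z; rewrite addr0.
exact: half_diff.
Qed.

Let xp0 : 0 < (x + p%:R) / 2.
Proof. by rewrite divr_gt0// ltr_wpDr. Qed.

Let x20 : 0 < x / 2.
Proof. by rewrite divr_gt0. Qed.

Lemma lngamma_part_diff : is_derive x (1 : K) (@lngamma_part K p) (lngamma_part1 p x).
Proof.
have D1 := is_derive_comp (g := fun z : K => (z + p%:R) / 2) (is_derive_ln_Gamma xp0) (half_diff p%:R).
have D2 := is_derive_comp (g := fun z : K => z / 2) (is_derive_ln_Gamma x20) half0.
have D3 := is_derive_const (p%:R / 2 * ln pi) x (1 : K).
have D4 := is_derive_mul half0 (is_derive1_ln x0).
apply: (is_derive_eq (is_derive_add (is_derive_sub (is_derive_sub D1 D2) D3) D4)).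
rewrite /lngamma_part1; have := lt0r_neq0 x0; move: (digamma _) (digamma _) (ln x) => a b c x1.
by field.
Qed.

Lemma lngamma_part1_diff : is_derive x (1 : K) (@lngamma_part1 K p) (lngamma_part2 p x).
Proof.
have D1 := is_derive_comp (g := fun z : K => (z + p%:R) / 2) (is_derive_digamma xp0) (half_diff p%:R).
have D2 := is_derive_comp (g := fun z : K => z / 2) (is_derive_digamma x20) half0.
have D3 := is_derive_const (1 / 2) x (1 : K).
have D4 := is_derive_scale (1 / 2) (is_derive1_ln x0).
apply: (is_derive_eq (is_derive_add (is_derive_add (is_derive_sub
   (is_derive_scale (1 / 2) D1) (is_derive_scale (1 / 2) D2)) D4) D3)).
rewrite /lngamma_part2; have := lt0r_neq0 x0; move: (TG _) (TG _) => a b x1.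
by field.
Qed.
End lngamma.

Lemma is_derive_ln_det (K : realType) (V : normedModType K) (a : nat) (F : V -> 'M[K]_a) y v dF :
  0 < \det (F y) -> is_dmx F y v dF ->
  is_derive y v (fun z => ln (\det (F z))) (\tr (invmx (F y) *m dF)).
Proof.
move=> F0 H.
have D := is_derive_comp (f := @ln K) (g := fun z => \det (F z)) (is_derive1_ln F0) (is_derive_det H).
apply: (is_derive_eq D).
have uF : F y \in unitmx by rewrite unitmxE unitfE gt_eqF.
by rewrite /invmx uF -scalemxAl linearZ.
Qed.

(** * The log density of the model as a t log-likelihood *)

Section model.
Context (K : realType) (dc dr qc qr nc nr : nat)
  (C : 'M[K]_(dc, qc)) (Psic : 'M[K]_dc) (freec : 'I_nc -> par_coord dc qc)
  (R : 'M[K]_(dr, qr)) (Psir : 'M[K]_dr) (freer : 'I_nr -> par_coord dr qr)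
  (diagc : is_diag_mx Psic) (diagr : is_diag_mx Psir).

Local Notation V := 'cV[K]_(dr * dc + (nc + (nr + 1))).
Implicit Types (y u v : V) (x : 'M[K]_(dc, dr)).

Definition loc_of y : 'cV[K]_(dr * dc) := usubmx y.
Definition thc_of y : 'cV[K]_nc := usubmx (dsubmx y).
Definition thr_of y : 'cV[K]_nr := usubmx (dsubmx (dsubmx y)).
Definition nu_of y : K := dsubmx (dsubmx (dsubmx y)) 0 0.

Definition Sc_of y := scale_at C Psic freec (thc_of y).
Definition Sr_of y := scale_at R Psir freer (thr_of y).
Definition dSc_of v y := scale_deriv C freec (thc_of v) (thc_of y).
Definition dSr_of v y := scale_deriv R freer (thr_of v) (thr_of y).
Definition S_of y : 'M[K]_(dr * dc) := Sr_of y *t Sc_of y.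
Definition dS_of v y := dSr_of v y *t Sc_of y + Sr_of y *t dSc_of v y.
Definition ddS_of u v y := scale_deriv2 freer (thr_of u) (thr_of v) *t Sc_of y +
   dSr_of v y *t dSc_of u y + (dSr_of u y *t dSc_of v y +
   Sr_of y *t scale_deriv2 freec (thc_of u) (thc_of v)).
Definition ld_of y : K := - (dr%:R / 2) * ln (\det (Sc_of y)) - dc%:R / 2 * ln (\det (Sr_of y)).

(** An open set of parameter values on which both scale matrices are positive definite. Second
    derivatives need the closed form of the log density near the parameter and not only at it. *)
Definition regular : set V := [set y | [/\ forall i, 0 < noise_at Psic freec (thc_of y) i i,
   forall i, 0 < noise_at Psir freer (thr_of y) i i & 0 < nu_of y]].

Lemma loc_ofE (h : K) v y : loc_of (h *: v + y) = h *: loc_of v + loc_of y.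
Proof. by apply/colP => i; rewrite !mxE. Qed.

Lemma thc_ofE (h : K) v y : thc_of (h *: v + y) = h *: thc_of v + thc_of y.
Proof. by apply/colP => i; rewrite !mxE. Qed.

Lemma thr_ofE (h : K) v y : thr_of (h *: v + y) = h *: thr_of v + thr_of y.
Proof. by apply/colP => i; rewrite !mxE. Qed.

Lemma nu_ofE (h : K) v y : nu_of (h *: v + y) = h * nu_of v + nu_of y.
Proof. by rewrite /nu_of !mxE. Qed.

Lemma regular_open y : regular y -> \forall z \near y, regular z.
Proof.
move=> [Hc Hr Hn].
have c1 : \forall z \near y, forall i, 0 < noise_at Psic freec (thc_of z) i i.
  apply: noise_near => // k.
  have -> : (fun z => thc_of z k 0) = (fun z : V => z (rshift (dr * dc) (lshift (nr + 1) k)) 0).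
    by apply/funext => z; rewrite !mxE.
  exact: coord_continuous.
have c2 : \forall z \near y, forall i, 0 < noise_at Psir freer (thr_of z) i i.
  apply: noise_near => // k.
  have -> : (fun z => thr_of z k 0) =
      (fun z : V => z (rshift (dr * dc) (rshift nc (lshift 1 k))) 0).
    by apply/funext => z; rewrite !mxE.
  exact: coord_continuous.
have c3 : \forall z \near y, 0 < nu_of z.
  have E : nu_of = (fun z : V => z (rshift (dr * dc) (rshift nc (rshift nr 0))) 0).
    by apply/funext => z; rewrite /nu_of !mxE.
  have cn : {for y, continuous nu_of} by rewrite E; exact: coord_continuous.
  by apply: (cvgr_gt _ cn).
near=> z; split; near: z => //.
Unshelve. all: by end_near.
Qed.

Lemma posdef_Sc y : regular y -> posdef (Sc_of y).
Proof. by move=> [Hc _ _]; apply: posdef_scale; exact: noise_at_pos_diag. Qed.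

Lemma posdef_Sr y : regular y -> posdef (Sr_of y).
Proof. by move=> [_ Hr _]; apply: posdef_scale; exact: noise_at_pos_diag. Qed.

Lemma whiten_tens (a b : nat) (Tr S1 : 'M[K]_a) (Tc S2 : 'M[K]_b) :
  Tr *m S1 *m Tr^T = 1%:M -> Tc *m S2 *m Tc^T = 1%:M ->
  (Tr *t Tc) *m (S1 *t S2) *m (Tr *t Tc)^T = 1%:M.
Proof. by move=> Er Ec; rewrite tensmx_mul trmx_tens tensmx_mul Er Ec tensmx1. Qed.

Lemma S_whiten y : regular y -> exists T : 'M[K]_(dr * dc), T *m S_of y *m T^T = 1%:M.
Proof.
move=> ry; have [Tc Ec] := posdef_whiten (posdef_Sc ry); have [Tr Er] := posdef_whiten (posdef_Sr ry).
by exists (Tr *t Tc); exact: whiten_tens.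
Qed.

Lemma invmx_S y : regular y -> invmx (S_of y) = invmx (Sr_of y) *t invmx (Sc_of y).
Proof.
move=> ry; have [Tc Ec] := posdef_whiten (posdef_Sc ry); have [Tr Er] := posdef_whiten (posdef_Sr ry).
rewrite (whiten_invmx (whiten_tens Er Ec)) (whiten_invmx Ec) (whiten_invmx Er).
by rewrite trmx_tens tensmx_mul.
Qed.

Lemma Sc_diff y v : is_dmx Sc_of y v (dSc_of v y).
Proof. exact: (scale_diff _ _ _ thc_ofE). Qed.

Lemma Sr_diff y v : is_dmx Sr_of y v (dSr_of v y).
Proof. exact: (scale_diff _ _ _ thr_ofE). Qed.

Lemma S_diff y v : is_dmx S_of y v (dS_of v y).
Proof. exact: is_dmx_tens (Sr_diff y v) (Sc_diff y v). Qed.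

Lemma dS_diff y u v : is_dmx (dS_of v) y u (ddS_of u v y).
Proof.
have H1 : is_dmx (dSr_of v) y u (scale_deriv2 freer (thr_of u) (thr_of v)).
  exact: (scale_deriv_diff _ _ thr_ofE).
have H2 : is_dmx (dSc_of v) y u (scale_deriv2 freec (thc_of u) (thc_of v)).
  exact: (scale_deriv_diff _ _ thc_ofE).
exact: is_dmxD (is_dmx_tens H1 (Sc_diff y u)) (is_dmx_tens (Sr_diff y u) H2).
Qed.

Lemma trace_JdS y v : regular y -> \tr (invmx (S_of y) *m dS_of v y) =
  dc%:R * \tr (invmx (Sr_of y) *m dSr_of v y) + dr%:R * \tr (invmx (Sc_of y) *m dSc_of v y).
Proof.
move=> ry; rewrite invmx_S// /dS_of mulmxDr !tensmx_mul mxtraceD !mxtrace_tens.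
have uc : Sc_of y \in unitmx by rewrite unitmxE unitfE gt_eqF//; exact: posdef_det (posdef_Sc ry).
have ur : Sr_of y \in unitmx by rewrite unitmxE unitfE gt_eqF//; exact: posdef_det (posdef_Sr ry).
by rewrite !mulVmx// !mxtrace1 [_ * dc%:R]mulrC.
Qed.

(** The log-determinants of the two factors are differentiated separately, and [trace_JdS]
    reassembles the trace for their Kronecker product. *)
Lemma ld_diff y v : regular y ->
  is_derive y v ld_of (- (1 / 2) * \tr (invmx (S_of y) *m dS_of v y)).
Proof.
move=> ry.
have Dc := is_derive_ln_det (posdef_det (posdef_Sc ry)) (Sc_diff y v).
have Dr := is_derive_ln_det (posdef_det (posdef_Sr ry)) (Sr_diff y v).
apply: (is_derive_eq (is_derive_sub (is_derive_scale (- (dr%:R / 2)) Dc) (is_derive_scale (dc%:R / 2) Dr))).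
by rewrite trace_JdS//; ring.
Qed.

Definition resid x y : 'cV[K]_(dr * dc) := vec x - loc_of y.

Lemma resid_diff x y v : is_dmx (resid x) y v (- loc_of v).
Proof.
move=> i j; apply: is_derive_affine => h; rewrite /resid loc_ofE !mxE.
by ring.
Qed.

Lemma nu_diff y v : is_derive y v nu_of (nu_of v).
Proof. by apply: is_derive_affine => h; rewrite nu_ofE. Qed.

(** The trace in the density is the form of the inverse of [S_of y] at the vectorized residual, by
    [vec_mulmx] and [mxtrace_mul_vec]. All remaining factors are positive on [regular], so the
    logarithm splits into a sum. *)
Lemma log_pdf_regular x y : regular y ->
  log_pdf C Psic freec R Psir freer x y =
  t_loglik S_of (resid x) nu_of ld_of (@lngamma_part K (dr * dc)) y.
Proof.
move=> ry; rewrite /log_pdf /mt_pdf -/(loc_of y) -/(thc_of y) -/(thr_of y) -/(nu_of y).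
rewrite -/(Sc_of y) -/(Sr_of y).
have [_ _ n0] := ry.
have detc := posdef_det (posdef_Sc ry); have detr := posdef_det (posdef_Sr ry).
have QE : \tr (invmx (Sc_of y) *m (x - unvec (loc_of y)) *m invmx (Sr_of y) *m (x - unvec (loc_of y))^T) =
    t_quad S_of (resid x) y.
  rewrite mxtrace_mul_vec mulmx_dotE /t_quad invmx_S//.
  have [Tr Er] := posdef_whiten (posdef_Sr ry).
  have sr : (invmx (Sr_of y))^T = invmx (Sr_of y) by rewrite (whiten_invmx Er) trmx_mul trmxK.
  rewrite -{1}sr vec_mulmx vecB unvecK -/(resid x y).
  by rewrite -mulmxA mulmx_dotE; apply: eq_bigr => i _; rewrite mulrC.
rewrite QE.
have Q0 : 0 <= t_quad S_of (resid x) y.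
  have [T E] := S_whiten ry; rewrite /t_quad (whiten_invmx E).
  have -> : (resid x y)^T *m (T^T *m T) *m resid x y = (T *m resid x y)^T *m (T *m resid x y).
    by rewrite trmx_mul !mulmxA.
  exact: dot_ge0.
rewrite /t_loglik /ld_of /lngamma_part; move: (t_quad _ _ _) Q0 => Q Q0.
have -> : (dr * dc)%N = (dc * dr)%N by rewrite mulnC.
set p : K := (dc * dr)%:R; set nu := nu_of y in n0 *.
have p0 : 0 <= p by exact: ler0n.
have G1 : 0 < Gamma ((nu + p) / 2) by apply: Gamma_gt0; rewrite divr_gt0// ltr_wpDr.
have G2 : 0 < Gamma (nu / 2) by apply: Gamma_gt0; rewrite divr_gt0.
have pi0 : 0 < pi :> K by exact: pi_gt0.
have -> : 1 + nu^-1 * Q = (nu + Q) / nu by field; exact: lt0r_neq0.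
have nQ : 0 < nu + Q by rewrite ltr_wpDr.
have lnpos (a b : K) : 0 < a -> 0 < b -> ln (a * b) = ln a + ln b by move=> a0 b0; rewrite lnM.
have lnVpos (a : K) : 0 < a -> ln (a^-1) = - ln a by move=> a0; rewrite lnV.
have W (a b : K) : 0 < a -> 0 < a `^ b by move=> a0; exact: powR_gt0.
have A1 := W _ (- (dr%:R / 2)) detc; have A2 := W _ (- (dc%:R / 2)) detr.
have A3 := W _ (p / 2) (mulr_gt0 pi0 n0).
have A4 : 0 < (nu + Q) / nu by rewrite divr_gt0.
have A5 := mulr_gt0 (mulr_gt0 A1 A2) G1; have A6 := mulr_gt0 A3 G2.
rewrite (lnpos _ _ (divr_gt0 A5 A6) (W _ _ A4)) (lnpos _ _ A5) ?invr_gt0// (lnVpos _ A6).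
rewrite (lnpos _ _ (mulr_gt0 A1 A2) G1) (lnpos _ _ A1 A2) (lnpos _ _ A3 G2) !ln_powR.
rewrite (lnpos _ _ pi0 n0) (lnpos _ _ nQ) ?invr_gt0// (lnVpos _ n0).
move: (ln (Gamma _)) (ln (Gamma _)) (ln pi) (ln nu) (ln (nu + Q)) (ln (\det _)) (ln (\det _)).
by move=> *; field.
Qed.
End model.

Section directions.
Context (K : realType) (d q n : nat) (L : 'M[K]_(d, q)) (Psi : 'M[K]_d)
  (free : 'I_n -> par_coord d q) (i : 'I_n) (t : 'cV[K]_n).

Lemma partial_scale_at :
  partial (scale_at L Psi free) i t = scale_deriv L free (delta_mx i 0) t.
Proof. exact: (is_dmx_derive (scale_diff L Psi free (th := id) (thl := id) _ t (delta_mx i 0))). Qed.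

Lemma loading_deriv_inr a : free i = inr a -> loading_deriv free (delta_mx i 0) = 0 :> 'M[K]_(d, q).
Proof.
move=> fi; apply/matrixP => k l; rewrite !mxE; case: pickP => [j /eqP fj|_]; rewrite ?mxE//.
by case: eqP => // ji; rewrite ji fi in fj.
Qed.

Lemma noise_deriv_inl a : free i = inl a -> noise_deriv free (delta_mx i 0) = 0 :> 'M[K]_d.
Proof.
move=> fi; apply/matrixP => k l; rewrite !mxE; case: pickP => [j /andP[_ /eqP fj]|_]; rewrite ?mxE//.
by case: eqP => // ji; rewrite ji fi in fj.
Qed.

(** [scale_deriv] contains the loading and the noise contributions at once; a coordinate direction
    of one kind makes the other contribution vanish. *)
Lemma partial_scale_at_cases : partial (scale_at L Psi free) i (free_values L Psi free) =
  match free i with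
  | inl _ => L *m (partial (loading_at L free) i (free_values L Psi free))^T +
             partial (loading_at L free) i (free_values L Psi free) *m L^T
  | inr _ => partial (noise_at Psi free) i (free_values L Psi free)
  end.
Proof.
rewrite [LHS](is_dmx_derive (scale_diff L Psi free (th := id) (thl := id) _ _ (delta_mx i 0)))//.
rewrite [partial (loading_at _ _) _ _](is_dmx_derive (loading_diff L free (th := id) (thl := id) _ _ (delta_mx i 0)))//.
rewrite [partial (noise_at _ _) _ _](is_dmx_derive (noise_diff Psi free (th := id) (thl := id) _ _ (delta_mx i 0)))//.
rewrite /scale_deriv loading_at_free_values.
case E: (free i) => [a|a]; first by rewrite (noise_deriv_inl E) addr0 addrC.
by rewrite (loading_deriv_inr E) mul0mx trmx0 mulmx0 !add0r.
Qed.
End directions.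

(** * The Hessian of the log density and its mean *)

Section hessian_model.
Context (K : realType) (dc dr qc qr nc nr : nat)
  (C : 'M[K]_(dc, qc)) (Psic : 'M[K]_dc) (freec : 'I_nc -> par_coord dc qc)
  (R : 'M[K]_(dr, qr)) (Psir : 'M[K]_dr) (freer : 'I_nr -> par_coord dr qr)
  (diagc : is_diag_mx Psic) (diagr : is_diag_mx Psir).

Local Notation V := 'cV[K]_(dr * dc + (nc + (nr + 1))).
Local Notation S := (S_of C Psic freec R Psir freer).
Local Notation dS := (dS_of C Psic freec R Psir freer).
Local Notation ddS := (ddS_of C Psic freec R Psir freer).
Local Notation reg := (regular Psic freec Psir freer).
Local Notation lp := (log_pdf C Psic freec R Psir freer).
Local Notation e x := (@resid K dc dr nc nr x).
Local Notation loc := (@loc_of K dc dr nc nr).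
Local Notation nuf := (@nu_of K dc dr nc nr).
Implicit Types (y u v : V) (x : 'M[K]_(dc, dr)).

Let nu_reg y : reg y -> 0 < nuf y.
Proof. by move=> [_ _]. Qed.

Let ct1 := @lngamma_part1 K (dr * dc).
Let ct2 := @lngamma_part2 K (dr * dc).

Lemma log_pdf_diff x y v : reg y ->
  is_derive y v (lp x) (t_score S dS (e x) loc nuf nuf ct1 v y).
Proof.
move=> ry.
have D := t_loglik_diff (@regular_open _ _ _ _ _ _ _ Psic freec Psir freer) nu_reg
  (@S_whiten _ _ _ _ _ _ _ C Psic freec R Psir freer diagc diagr)
  (resid_diff x) (@nu_diff K dc dr nc nr) (@S_diff _ _ _ _ _ _ _ C Psic freec R Psir freer)
  (@ld_diff _ _ _ _ _ _ _ C Psic freec R Psir freer diagc diagr)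
  (@lngamma_part_diff K (dr * dc)) v ry.
apply: near_eq_is_derive D.
by apply: filterS (regular_open ry) => z rz; rewrite -log_pdf_regular.
Qed.

Lemma score_diff x y u v : reg y ->
  is_derive y u (t_score S dS (e x) loc nuf nuf ct1 v)
    (t_hess S dS ddS (e x) loc nuf nuf ct2 u v y).
Proof.
move=> ry.
exact: (t_score_diff (@regular_open _ _ _ _ _ _ _ Psic freec Psir freer) nu_reg
  (@S_whiten _ _ _ _ _ _ _ C Psic freec R Psir freer diagc diagr)
  (resid_diff x) (@nu_diff K dc dr nc nr) (@S_diff _ _ _ _ _ _ _ C Psic freec R Psir freer)
  (@dS_diff _ _ _ _ _ _ _ C Psic freec R Psir freer)
  (@lngamma_part1_diff K (dr * dc)) u v ry).
Qed.

Let partial_score x y j : reg y ->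
  \near y, t_score S dS (e x) loc nuf nuf ct1 (delta_mx j 0) y = partial (lp x) j y.
Proof.
move=> ry; apply: filterS (regular_open ry) => z rz.
by rewrite /partial; have [_ ->] := log_pdf_diff x (delta_mx j 0) rz.
Qed.

Let partial_diff x y i j : reg y -> is_derive y (delta_mx i 0) (partial (lp x) j)
  (t_hess S dS ddS (e x) loc nuf nuf ct2 (delta_mx i 0) (delta_mx j 0) y).
Proof. by move=> ry; apply: near_eq_is_derive (partial_score x j ry) (score_diff x _ _ ry). Qed.

Lemma has_hessian_log_pdf x y : reg y -> has_hessian (lp x) y.
Proof.
move=> ry i j; split; last by case: (partial_diff x i j ry).
by apply: filterS (regular_open ry) => z rz; case: (log_pdf_diff x (delta_mx j 0) rz).
Qed.

Lemma hessian_log_pdf x y i j : reg y -> hessian (lp x) y i j =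
  t_hess S dS ddS (e x) loc nuf nuf ct2 (delta_mx i 0) (delta_mx j 0) y.
Proof. by move=> ry; rewrite mxE {1}/partial; have [_ ->] := partial_diff x i j ry. Qed.

(* The information form at a pair of directions u, v: Au = Sc^-1 dSc_u and
   Bu = Sr^-1 dSr_u, for which S^-1 dS_u = Bu (x) I + I (x) Au, ww stands for
   w_u' S^-1 w_v, and su, sv are the components of the directions along nu. *)
Definition information (y : V) (Au Av : 'M[K]_dc) (Bu Bv : 'M[K]_dr) (ww su sv : K) : K :=
  let c : K := dc%:R in let r : K := dr%:R in let n := nuf y + c * r in
  n / (2 * (n + 2)) * (c * \tr (Bu *m Bv) + \tr Bu * \tr Av + \tr Bv * \tr Au + r * \tr (Au *m Av)) -
  1 / (2 * (n + 2)) * ((c * \tr Bu + r * \tr Au) * (c * \tr Bv + r * \tr Av)) +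
  n / (n + 2) * ww -
  (sv * (c * \tr Bu + r * \tr Au) + su * (c * \tr Bv + r * \tr Av)) / (n * (n + 2)) -
  su * sv * (ct2 (nuf y) - 1 / n + (nuf y + 2) / (2 * nuf y * (n + 2))).

Context (d : measure_display) (Om : measurableType d) (P : probability Om K).

(** Along a direction with parts B and A for the two sides, S^-1 dS is the Kronecker sum of B and A,
    so the traces in [t_hess_mean] split into traces of the factors, with weights dc and dr. *)
Lemma hessian_mean (W : 'M[K]_(dc, dr)) (X : {mfun Om >-> borel_mx K dc dr}) y i j :
  reg y ->
  loc y = vec W -> thc_of y = free_values C Psic freec -> thr_of y = free_values R Psir freer ->
  pos_diag Psic -> pos_diag Psir ->
  tBFA P W C Psic R Psir (nuf y) X ->
  let Ic := invmx (Sc_of C Psic freec y) in let Ir := invmx (Sr_of R Psir freer y) in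
  let u := delta_mx i 0 : V in let v := delta_mx j 0 : V in
  has_mean P (fun o => hessian (lp (X o)) y i j)
    (- information y (Ic *m dSc_of C freec u y) (Ic *m dSc_of C freec v y)
       (Ir *m dSr_of R freer u y) (Ir *m dSr_of R freer v y)
       (((loc u)^T *m (Ir *t Ic) *m loc v) 0 0) (nuf u) (nuf v)).
Proof.
move=> ry locW thcE thrE pc pr model Ic Ir u v.
have ScE : Sc_of C Psic freec y = C *m C^T + Psic.
  by rewrite /Sc_of thcE /scale_at loading_at_free_values noise_at_free_values.
have SrE : Sr_of R Psir freer y = R *m R^T + Psir.
  by rewrite /Sr_of thrE /scale_at loading_at_free_values noise_at_free_values.
have [Tc Ec] := posdef_whiten (posdef_Sc C diagc ry).
have [Tr Er] := posdef_whiten (posdef_Sr R diagr ry).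
rewrite ScE in Ec; rewrite SrE in Er.
have [m gam cf] := tBFA_whitened pc pr model Ec Er.
have ET : (Tr *t Tc) *m S y *m (Tr *t Tc)^T = 1%:M.
  by apply: whiten_tens; rewrite ?ScE ?SrE.
have residE o : e (X o) y = vec ((X o : 'M[K]_(dc, dr)) - W).
  by rewrite /resid locW vecB.
have me k : measurable_fun setT (fun o => ((Tr *t Tc) *m e (X o) y) k 0).
  rewrite (_ : (fun o => _) = (fun o => \sum_l (Tr *t Tc) k l * (vec (X o : 'M[K]_(dc, dr)) - vec W) l 0)).
    apply: measurable_sum => l; apply: measurable_funM => //.
    rewrite (_ : (fun o => _) = (fun o => (X o : 'M[K]_(dc, dr))
        (mxtens_unindex l).2 (mxtens_unindex l).1 - vec W l 0)).
      apply: measurable_funB => //.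
      exact: (measurableT_comp (measurable_mx_coord _ _)).
    by apply/funext => o'; rewrite !mxE.
  by apply/funext => o'; rewrite mxE residE vecB.
have cf' (b : 'cV[K]_(dr * dc)) :
  \int[P]_o cos ((b^T *m ((Tr *t Tc) *m e (X o) y)) 0 0) =
    \int[m]_(t in `]0, +oo[) expR (- ((b^T *m b) 0 0 / t) / 2) /\
  \int[P]_o sin ((b^T *m ((Tr *t Tc) *m e (X o) y)) 0 0) = 0.
  have [<- <-] := cf b.
  by split; apply: eq_Rintegral => o _; rewrite residE.
have dSu_sym : (dS u y)^T = dS u y.
  rewrite /dS_of linearD /= !trmx_tens /dSr_of /dSc_of !scale_deriv_sym.
  have [sc _] := posdef_Sc C diagc ry; have [sr _] := posdef_Sr R diagr ry.
  by rewrite sc sr.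
have H := t_hess_mean (e := fun o => e (X o : 'M[K]_(dc, dr))) ddS loc nuf ct2 v (nu_reg ry) gam ET me cf' dSu_sym.
have uc : Sc_of C Psic freec y \in unitmx.
  by rewrite unitmxE unitfE gt_eqF//; exact: posdef_det (posdef_Sc C diagc ry).
have ur : Sr_of R Psir freer y \in unitmx.
  by rewrite unitmxE unitfE gt_eqF//; exact: posdef_det (posdef_Sr R diagr ry).
have JdS a : invmx (S y) *m dS a y = (Ir *m dSr_of R freer a y) *t 1%:M +
    1%:M *t (Ic *m dSc_of C freec a y).
  by rewrite invmx_S// /dS_of mulmxDr !tensmx_mul mulVmx// mulVmx.
apply: (eq_has_mean H) => [s|]; first by rewrite hessian_log_pdf.
rewrite !JdS invmx_S// -/Ic -/Ir !mulmxDl !mulmxDr !tensmx_mul !mul1mx !mulmx1.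
rewrite !mxtraceD !mxtrace_tens !mxtrace1 /information natrM [dr%:R * dc%:R]mulrC.
by ring.
Qed.
End hessian_model.

Lemma has_mean_expectation (K : realType) (d : measure_display) (Om : measurableType d)
    (P : probability Om K) (f : Om -> K) (a : K) : has_mean P f a -> fine ('E_P[f])%E = a.
Proof. by move=> [_ <-]; rewrite unlock. Qed.

(** * The four blocks of coordinate directions *)

Section coordinates.
Context (K : realType) (dc dr nc nr : nat).
Local Notation V := 'cV[K]_(dr * dc + (nc + (nr + 1))).
Local Notation loc := (@loc_of K dc dr nc nr).
Local Notation thc := (@thc_of K dc dr nc nr).
Local Notation thr := (@thr_of K dc dr nc nr).
Local Notation nuf := (@nu_of K dc dr nc nr).

Definition dir_mu (k : 'I_(dr * dc)) : 'I_(dr * dc + (nc + (nr + 1))) := lshift _ k.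
Definition dir_c (k : 'I_nc) : 'I_(dr * dc + (nc + (nr + 1))) := rshift _ (lshift _ k).
Definition dir_r (k : 'I_nr) : 'I_(dr * dc + (nc + (nr + 1))) := rshift _ (rshift _ (lshift _ k)).
Definition dir_nu : 'I_(dr * dc + (nc + (nr + 1))) := rshift _ (rshift _ (rshift _ 0)).

Lemma coords_mu k (t : V := delta_mx (dir_mu k) 0) :
  [/\ loc t = delta_mx k 0, thc t = 0, thr t = 0 & nuf t = 0].
Proof.
rewrite /t /loc_of /thc_of /thr_of /nu_of /dir_mu delta_mx_ushift col_mxKu col_mxKd !linear0.
by rewrite mxE.
Qed.

Lemma coords_c k (t : V := delta_mx (dir_c k) 0) :
  [/\ loc t = 0, thc t = delta_mx k 0, thr t = 0 & nuf t = 0].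
Proof.
rewrite /t /loc_of /thc_of /thr_of /nu_of /dir_c delta_mx_dshift col_mxKu col_mxKd.
by rewrite delta_mx_ushift col_mxKu col_mxKd !linear0 mxE.
Qed.

Lemma coords_r k (t : V := delta_mx (dir_r k) 0) :
  [/\ loc t = 0, thc t = 0, thr t = delta_mx k 0 & nuf t = 0].
Proof.
rewrite /t /loc_of /thc_of /thr_of /nu_of /dir_r delta_mx_dshift col_mxKu col_mxKd.
rewrite delta_mx_dshift col_mxKu col_mxKd.
by rewrite delta_mx_ushift col_mxKu col_mxKd mxE.
Qed.

Lemma coords_nu (t : V := delta_mx dir_nu 0) :
  [/\ loc t = 0, thc t = 0, thr t = 0 & nuf t = 1].
Proof.
rewrite /t /loc_of /thc_of /thr_of /nu_of /dir_nu delta_mx_dshift col_mxKu col_mxKd.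
rewrite delta_mx_dshift col_mxKu col_mxKd.
by rewrite delta_mx_dshift col_mxKu col_mxKd mxE !eqxx.
Qed.

Lemma dirP (Q : 'I_(dr * dc + (nc + (nr + 1))) -> Prop) :
  (forall k, Q (dir_mu k)) -> (forall k, Q (dir_c k)) -> (forall k, Q (dir_r k)) ->
  Q dir_nu -> forall i, Q i.
Proof.
move=> Hm Hc Hr Hn i; case: (split_ordP i) => [k ->|k ->]; first exact: Hm.
case: (split_ordP k) => [l ->|l ->]; first exact: Hc.
case: (split_ordP l) => [j ->|j ->]; first exact: Hr.
by rewrite (ord1 j).
Qed.

Lemma coords_Theta (mu : 'cV[K]_(dr * dc)) (tc : 'cV[K]_nc) (tr : 'cV[K]_nr) (nu : K)
    (t : V := Theta_of mu tc tr nu) :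
  [/\ loc t = mu, thc t = tc, thr t = tr & nuf t = nu].
Proof.
rewrite /t /Theta_of /loc_of /thc_of /thr_of /nu_of !(col_mxKu, col_mxKd).
by rewrite mxE eqxx.
Qed.
End coordinates.

(** * The Fisher information, block by block *)

Theorem theorem2 (K : realType) (d : measure_display) (Om : measurableType d)
    (P : probability Om K) (dc dr qc qr N nc nr : nat)
    (hdc : (1 <= dc)%N) (hdr : (1 <= dr)%N)
    (hqc : (1 <= qc)%N) (hqr : (1 <= qr)%N)
    (W : 'M[K]_(dc, dr)) (C : 'M[K]_(dc, qc)) (Psic : 'M[K]_dc)
    (R : 'M[K]_(dr, qr)) (Psir : 'M[K]_dr) (nu : K)
    (hPsic : pos_diag Psic) (hPsir : pos_diag Psir) (hnu : 0 < nu)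
    (freec : 'I_nc -> par_coord dc qc) (freer : 'I_nr -> par_coord dr qr)
    (hfreec : injective freec) (hfreer : injective freer)
    (X : 'I_N -> {mfun Om >-> borel_mx K dc dr})
    (hXindep : mutually_independent P (fun n => X n : Om -> borel_mx K dc dr))
    (hXmodel : forall n, tBFA P W C Psic R Psir nu (X n)) :
  let Sc := C *m C^T + Psic in
  let Sr := R *m R^T + Psir in
  let thc := free_values C Psic freec in
  let thr := free_values R Psir freer in
  let Theta := Theta_of (vec W) thc thr nu in
  let H (n : 'I_N) (w : Om) :=
    hessian (log_pdf C Psic freec R Psir freer (X n w)) Theta in
  let I_N := - \sum_(n < N) mx_expectation P (H n) in
  let dC i := partial (loading_at C freec) i thc in
  let dPsic i := partial (noise_at Psic freec) i thc in
  let dSc i := partial (scale_at C Psic freec) i thc in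
  let dR k := partial (loading_at R freer) k thr in
  let dPsir k := partial (noise_at Psir freer) k thr in
  let dSr k := partial (scale_at R Psir freer) k thr in
  let n := N%:R : K in
  let c := dc%:R : K in
  let r := dr%:R : K in
  let Imm : 'M[K]_(dr * dc) :=
    (n * ((nu + c * r) / (nu + c * r + 2))) *: (invmx Sr *t invmx Sc) in
  let Inunu : 'M[K]_1 :=
    (n * (1 / 4 * TG (nu / 2) - 1 / 4 * TG ((nu + c * r) / 2)
          - (c * r * (nu + c * r + 4))
            / (2 * nu * (nu + c * r) * (nu + c * r + 2))))%:M in
  let Icc : 'M[K]_nc := \matrix_(i, j)
    (n * r / (2 * (nu + c * r + 2))
     * ((nu + c * r) * \tr (invmx Sc *m dSc i *m invmx Sc *m dSc j)
        - r * \tr (invmx Sc *m dSc i) * \tr (invmx Sc *m dSc j))) in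
  let Icr : 'M[K]_(nc, nr) := \matrix_(i, k)
    (n / (2 * (nu + c * r + 2))
     * ((nu + c * r) * \tr ((invmx Sr *m dSr k) *t (invmx Sc *m dSc i))
        - c * r * \tr (invmx Sr *m dSr k) * \tr (invmx Sc *m dSc i))) in
  let Icnu : 'cV[K]_nc := \col_i
    (- n * r / ((nu + c * r) * (nu + c * r + 2)) * \tr (invmx Sc *m dSc i)) in
  let Irr : 'M[K]_nr := \matrix_(k, s)
    (n * c / (2 * (nu + c * r + 2))
     * ((nu + c * r) * \tr (invmx Sr *m dSr k *m invmx Sr *m dSr s)
        - c * \tr (invmx Sr *m dSr k) * \tr (invmx Sr *m dSr s))) in
  let Irnu : 'cV[K]_nr := \col_k
    (- n * c / ((nu + c * r) * (nu + c * r + 2)) * \tr (invmx Sr *m dSr k)) in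
  [/\ (forall x, has_hessian (log_pdf C Psic freec R Psir freer x) Theta)
      /\ (forall m, mx_integrable P (H m)),
      I_N = block_mx Imm 0 0
              (block_mx Icc     (row_mx Icr Icnu)
                        (col_mx Icr^T Icnu^T) (block_mx Irr    Irnu
                                                        Irnu^T Inunu)),
      I_N^T = I_N,
      (forall i, dSc i = match freec i with
                         | inl _ => C *m (dC i)^T + dC i *m C^T
                         | inr _ => dPsic i
                         end) &
      (forall k, dSr k = match freer k with
                         | inl _ => R *m (dR k)^T + dR k *m R^T
                         | inr _ => dPsir k
                         end)].
Proof.
move=> Sc Sr thc thr Theta H I_N dC dPsic dSc dR dPsir dSr n c r Imm Inunu Icc Icr Icnu Irr Irnu.
have [locE thcE thrE nuE] := coords_Theta (vec W) thc thr nu.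
have [diagc posc] := hPsic; have [diagr posr] := hPsir.
have ry : regular Psic freec Psir freer Theta.
  split=> [i|i|]; rewrite ?thcE ?thrE ?nuE// noise_at_free_values.
  - exact: posc.
  - exact: posr.
have ScE : Sc_of C Psic freec Theta = Sc.
  by rewrite /Sc_of thcE /scale_at loading_at_free_values noise_at_free_values.
have SrE : Sr_of R Psir freer Theta = Sr.
  by rewrite /Sr_of thrE /scale_at loading_at_free_values noise_at_free_values.
have model (k : 'I_N) : tBFA P W C Psic R Psir (nu_of Theta) (X k).
  by rewrite nuE; exact: hXmodel.
have HM (k : 'I_N) i j := hessian_mean diagc diagr i j ry locE thcE thrE hPsic hPsir (model k).
pose A (i : 'I_(dr * dc + (nc + (nr + 1)))) := invmx Sc *m dSc_of C freec (delta_mx i 0) Theta.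
pose B (i : 'I_(dr * dc + (nc + (nr + 1)))) := invmx Sr *m dSr_of R freer (delta_mx i 0) Theta.
pose w (i : 'I_(dr * dc + (nc + (nr + 1)))) := loc_of (delta_mx i 0 : 'cV[K]_(dr * dc + (nc + (nr + 1)))).
pose s (i : 'I_(dr * dc + (nc + (nr + 1)))) := nu_of (delta_mx i 0 : 'cV[K]_(dr * dc + (nc + (nr + 1)))).
(* Every observation follows the same model, so the N summands have a common mean and the sum is a
   multiple by [n]. *)
have IE i j : I_N i j = n * information Theta (A i) (A j) (B i) (B j)
    (((w i)^T *m (invmx Sr *t invmx Sc) *m w j) 0 0) (s i) (s j).
  rewrite /I_N mxE summxE -sumrN.
  transitivity (\sum_(k < N) information Theta (A i) (A j) (B i) (B j)
    (((w i)^T *m (invmx Sr *t invmx Sc) *m w j) 0 0) (s i) (s j)).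
    apply: eq_bigr => k _; rewrite mxE (has_mean_expectation (HM k i j)) opprK.
    by rewrite ScE SrE.
  by rewrite sumr_const card_ord mulr_natl.
have Amu k : A (dir_mu nc nr k) = 0.
  have [_ E _ _] := @coords_mu K dc dr nc nr k.
  by rewrite /A /dSc_of E scale_deriv0 mulmx0.
have Bmu k : B (dir_mu nc nr k) = 0.
  have [_ _ E _] := @coords_mu K dc dr nc nr k.
  by rewrite /B /dSr_of E scale_deriv0 mulmx0.
have Ac k : A (dir_c dc dr nr k) = invmx Sc *m dSc k.
  have [_ E _ _] := @coords_c K dc dr nc nr k.
  by rewrite /A /dSc_of E thcE /dSc partial_scale_at.
have Bc k : B (dir_c dc dr nr k) = 0.
  have [_ _ E _] := @coords_c K dc dr nc nr k.
  by rewrite /B /dSr_of E scale_deriv0 mulmx0.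
have Ar k : A (dir_r dc dr nc k) = 0.
  have [_ E _ _] := @coords_r K dc dr nc nr k.
  by rewrite /A /dSc_of E scale_deriv0 mulmx0.
have Br k : B (dir_r dc dr nc k) = invmx Sr *m dSr k.
  have [_ _ E _] := @coords_r K dc dr nc nr k.
  by rewrite /B /dSr_of E thrE /dSr partial_scale_at.
have [wnu Anu' Bnu' snu] := @coords_nu K dc dr nc nr.
have Anu : A (dir_nu dc dr nc nr) = 0 by rewrite /A /dSc_of Anu' scale_deriv0 mulmx0.
have Bnu : B (dir_nu dc dr nc nr) = 0 by rewrite /B /dSr_of Bnu' scale_deriv0 mulmx0.
have JS : (invmx Sr *t invmx Sc)^T = invmx Sr *t invmx Sc.
  rewrite trmx_tens; congr (_ *t _); rewrite trmx_inv; congr invmx.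
  - by have [-> _] := @posdef_scale _ _ _ R Psir hPsir.
  - by have [-> _] := @posdef_scale _ _ _ C Psic hPsic.
have [wmu smu] : (forall k, w (dir_mu nc nr k) = delta_mx k 0) /\ forall k, s (dir_mu nc nr k) = 0.
  by split=> k; have [E1 _ _ E2] := @coords_mu K dc dr nc nr k.
have [wc sc] : (forall k, w (dir_c dc dr nr k) = 0) /\ forall k, s (dir_c dc dr nr k) = 0.
  by split=> k; have [E1 _ _ E2] := @coords_c K dc dr nc nr k.
have [wr sr] : (forall k, w (dir_r dc dr nc k) = 0) /\ forall k, s (dir_r dc dr nc k) = 0.
  by split=> k; have [E1 _ _ E2] := @coords_r K dc dr nc nr k.
have wn : w (dir_nu dc dr nc nr) = 0 by [].
have sn : s (dir_nu dc dr nc nr) = 1 by [].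
have wJ0 (v : 'cV[K]_(dr * dc)) : (v^T *m (invmx Sr *t invmx Sc) *m 0) 0 0 = 0.
  by rewrite mulmx0 mxE.
have w0J (v : 'cV[K]_(dr * dc)) : ((0 : 'cV[K]_(dr * dc))^T *m (invmx Sr *t invmx Sc) *m v) 0 0 = 0.
  by rewrite trmx0 !mul0mx mxE.
have wJw k l : ((delta_mx k 0 : 'cV[K]_(dr * dc))^T *m (invmx Sr *t invmx Sc) *m delta_mx l 0) 0 0 =
    (invmx Sr *t invmx Sc) k l.
  rewrite trmx_delta -mulmxA -rowE; move: (invmx Sr *t invmx Sc) => M'.
  rewrite [LHS]mxE mxE (bigD1 l)//= mxE !eqxx mulr1 big1 ?addr0// => h hl.
  by rewrite mxE (negbTE hl) mulr0.
(* Each coordinate direction moves just one of location, column side, row side and nu. These rules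
   annihilate the other parts and reduce [information] to the entry of one block. *)
have simp := (Amu, Bmu, Ac, Bc, Ar, Br, Anu, Bnu, wmu, smu, wc, sc, wr, sr, wn, sn,
  mul0mx, mulmx0, mxtrace0, nuE, wJw, wJ0, w0J).
have nu1 : nu != 0 by exact: lt0r_neq0.
have cr0 : 0 <= c * r by rewrite mulr_ge0.
have n1 : nu + c * r != 0 by rewrite gt_eqF// ltr_wpDr.
have n2 : nu + c * r + 2 != 0 by rewrite gt_eqF// addr_gt0// ltr_wpDr.
(* Symmetry leaves ten of the sixteen blocks to compute. *)
have Isym i j : I_N i j = I_N j i.
  rewrite !IE; congr (_ * _).
  have -> : ((w j)^T *m (invmx Sr *t invmx Sc) *m w i) 0 0 =
      ((w i)^T *m (invmx Sr *t invmx Sc) *m w j) 0 0.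
    have tr00 (M : 'M[K]_1) : M 0 0 = M^T 0 0 by rewrite [RHS]mxE.
    by rewrite [LHS]tr00 !trmx_mul trmxK JS mulmxA.
  rewrite /information (mxtrace_mulC (A j)) (mxtrace_mulC (B j)).
  by ring.
have Emm k l : I_N (dir_mu nc nr k) (dir_mu nc nr l) = Imm k l.
  rewrite IE /information !simp -/c -/r [RHS]mxE; move: (_ k l) (lngamma_part2 _ _) => a g.
  by field; rewrite -/c -/r ?n2 ?nu1 ?n1.
have Emc k l : I_N (dir_mu nc nr k) (dir_c dc dr nr l) = 0.
  by rewrite IE /information !simp -/c -/r; ring.
have Emr k l : I_N (dir_mu nc nr k) (dir_r dc dr nc l) = 0.
  by rewrite IE /information !simp -/c -/r; ring.
have Emn k : I_N (dir_mu nc nr k) (dir_nu dc dr nc nr) = 0.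
  by rewrite IE /information !simp -/c -/r; ring.
have Ecc k l : I_N (dir_c dc dr nr k) (dir_c dc dr nr l) = Icc k l.
  rewrite IE /information !simp -/c -/r [RHS]mxE !mulmxA.
  (* With the traces and the trigamma terms abstracted to scalars, a rational identity remains. *)
  have gen (g a b b' : K) : n * ((nu + c * r) / (2 * (nu + c * r + 2)) * (c * 0 + 0 * b' + 0 * b + r * a) -
       1 / (2 * (nu + c * r + 2)) * ((c * 0 + r * b) * (c * 0 + r * b')) +
       (nu + c * r) / (nu + c * r + 2) * 0 -
       (0 * (c * 0 + r * b) + 0 * (c * 0 + r * b')) / ((nu + c * r) * (nu + c * r + 2)) -
       0 * 0 * g) = n * r / (2 * (nu + c * r + 2)) * ((nu + c * r) * a - r * b * b').
    by field; rewrite -/c -/r ?n2 ?nu1 ?n1.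
  exact: gen.
have Ecr k l : I_N (dir_c dc dr nr k) (dir_r dc dr nc l) = Icr k l.
  rewrite IE /information !simp -/c -/r [RHS]mxE mxtrace_tens.
  move: (lngamma_part2 _ _) (\tr (_ *m _)) (\tr (_ *m _)) => g b b'.
  by field; rewrite -/c -/r ?n2 ?nu1 ?n1.
have Ecn k : I_N (dir_c dc dr nr k) (dir_nu dc dr nc nr) = Icnu k 0.
  rewrite IE /information !simp -/c -/r [RHS]mxE.
  move: (lngamma_part2 _ _) (\tr (_ *m _)) => g b.
  by field; rewrite -/c -/r ?n2 ?nu1 ?n1.
have Err k l : I_N (dir_r dc dr nc k) (dir_r dc dr nc l) = Irr k l.
  rewrite IE /information !simp -/c -/r [RHS]mxE !mulmxA.
  have gen (g a b b' : K) : n * ((nu + c * r) / (2 * (nu + c * r + 2)) * (c * a + b * 0 + b' * 0 + r * 0) -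
       1 / (2 * (nu + c * r + 2)) * ((c * b + r * 0) * (c * b' + r * 0)) +
       (nu + c * r) / (nu + c * r + 2) * 0 -
       (0 * (c * b + r * 0) + 0 * (c * b' + r * 0)) / ((nu + c * r) * (nu + c * r + 2)) -
       0 * 0 * g) = n * c / (2 * (nu + c * r + 2)) * ((nu + c * r) * a - c * b * b').
    by field; rewrite -/c -/r ?n2 ?nu1 ?n1.
  exact: gen.
have Ern k : I_N (dir_r dc dr nc k) (dir_nu dc dr nc nr) = Irnu k 0.
  rewrite IE /information !simp -/c -/r [RHS]mxE.
  move: (lngamma_part2 _ _) (\tr (_ *m _)) => g b.
  by field; rewrite -/c -/r ?n2 ?nu1 ?n1.
(* With p = c r and D = nu + p, the rational terms - 1 / (2 nu), 1 / D and - (nu + 2) / (2 nu (D +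
   2)) add up to - p (D + 4) / (2 nu D (D + 2)). *)
have Enn : I_N (dir_nu dc dr nc nr) (dir_nu dc dr nc nr) = Inunu 0 0.
  rewrite IE /information !simp -/c -/r [RHS]mxE eqxx /lngamma_part2 natrM [dr%:R * dc%:R]mulrC -/c -/r mulr1n.
  move: (TG _) (TG _) => g g'.
  by field; rewrite -/c -/r ?n2 ?nu1 ?n1.
split.
- split; first by move=> x; exact: has_hessian_log_pdf.
  by move=> k i j; case: (HM k i j).
- apply/matrixP => i j.
  elim/dirP: i => [k|k|k|]; elim/dirP: j => [l|l|l|].
  + by rewrite Emm block_mxEul.
  + by rewrite Emc block_mxEur mxE.
  + by rewrite Emr block_mxEur mxE.
  + by rewrite Emn block_mxEur mxE.
  + by rewrite Isym Emc block_mxEdl mxE.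
  + by rewrite Ecc block_mxEdr block_mxEul.
  + by rewrite Ecr block_mxEdr block_mxEur row_mxEl.
  + by rewrite Ecn block_mxEdr block_mxEur row_mxEr.
  + by rewrite Isym Emr block_mxEdl mxE.
  + by rewrite Isym Ecr block_mxEdr block_mxEdl col_mxEu [RHS]mxE.
  + by rewrite Err block_mxEdr block_mxEdr block_mxEul.
  + by rewrite Ern block_mxEdr block_mxEdr block_mxEur.
  + by rewrite Isym Emn block_mxEdl mxE.
  + by rewrite Isym Ecn block_mxEdr block_mxEdl col_mxEd [RHS]mxE.
  + by rewrite Isym Ern block_mxEdr block_mxEdr block_mxEdl [RHS]mxE.
  + by rewrite Enn block_mxEdr block_mxEdr block_mxEdr.
- by apply/matrixP => i j; rewrite mxE Isym.
- by move=> i; exact: partial_scale_at_cases.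
- by move=> k; exact: partial_scale_at_cases.
Qed.
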